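(* Let $n\in\{1,2,\dots,\infty\}$ and let $\mathsf{P}_n$ be any cofibrant $E_n$-operad (in the category $\mathcal{O}_0$ of non-unitary operads in dg-modules over $\Bbbk$). All morphisms of operads $\phi^0,\phi^1:\mathsf{P}_n\to\mathsf{C}$ which induce in homology the canonical augmentation $\mathsf{G}_n=\mathsf{C}\circ\Lambda^{1-n}\mathsf{L}\to\mathsf{C}$ are right-homotopic in the category of operads.
   Context: Fix a (commutative) ground ring $\Bbbk$. A dg-module is a $\mathbb{Z}$-graded $\Bbbk$-module (lower grading) with a differential of degree $-1$. Operads are symmetric operads in dg-modules, and $\mathcal{O}_0$ is the category of non-unitary operads ($\mathsf{P}(0)=0$), with the model structure in which weak-equivalences are the arity-wise quasi-isomorphisms and fibrations are the arity-wise, degreewise surjections. Right-homotopic means homotopic through a path-object of the target in this model category. The commutative operad $\mathsf{C}$ has $\mathsf{C}(0)=0$ and $\mathsf{C}(r)=\Bbbk$ (trivial action, degree $0$) for $r>0$, generated by $\mu\in\mathsf{C}(2)$. An $E_n$-operad is an operad in $\mathcal{O}_0$ weakly-equivalent to the non-unitary version (arity-zero term set to $0$) of the chain operad of little $n$-cubes if $n<\infty$, to $\mathsf{C}$ if $n=\infty$. The operadic suspension $\Lambda\mathsf{P}$ is $\Lambda\mathsf{P}(r)=\Bbbk[1-r]\otimes\mathsf{P}(r)^{\pm}$, where $\Bbbk[1-r]$ is free of rank one in degree $1-r$ and $\pm$ is the twist of the $\Sigma_r$-action by the signature; $\Lambda^{-1}$ is the inverse operation. $\mathsf{L}$ is the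 Lie operad, generated by the bracket $\lambda\in\mathsf{L}(2)$. For $1<n<\infty$, the $n$-Gerstenhaber operad $\mathsf{G}_n=\mathsf{C}\circ\Lambda^{1-n}\mathsf{L}$ (composite of the underlying symmetric sequences) is generated by the commutative associative product $\mu$ of degree $0$ and the $(n-1)$-fold desuspended Lie bracket $\lambda_{n-1}\in\Lambda^{1-n}\mathsf{L}(2)$ of degree $n-1$, together with a distribution (Poisson) relation between them. The homology $H_*(\mathsf{P}_n)$ of an $E_n$-operad is identified with $\mathsf{G}_n$ for $1<n<\infty$. The canonical augmentation $\mathsf{G}_n\to\mathsf{C}$ is induced by the augmentation of the Lie operad; it is the operad morphism with $\mu\mapsto\mu$, $\lambda_{n-1}\mapsto 0$. For $n=1$, $H_*(\mathsf{P}_1)$ is the associative operad $\mathsf{A}$ and the augmentation is the usual morphism $\mathsf{A}\to\mathsf{C}$; for $n=\infty$, $H_*(\mathsf{P}_\infty)=\mathsf{C}$ and the augmentation is the identity. *)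

(* Defs.v *)
From HB Require Import structures.
From mathcomp Require Import all_boot all_order all_algebra all_fingroup.
From mathcomp Require Import mathcomp_extra boolp classical_sets functions reals.
From mathcomp Require Import topology normedtype.
From Stdlib Require Import Relations.

Set Implicit Arguments.
Unset Strict Implicit.
Unset Printing Implicit Defensive.

Import Order.TTheory GRing.Theory Num.Theory.
Import numFieldNormedType.Exports.
Local Open Scope ring_scope.

(** Throughout, equalities between degrees (in [int]) and between arities (in
    [nat]) are carried as proof arguments: [dgd e x], [ocomp a el ed p q], etc.
    live in whatever degree/arity the proofs [e], [el], [ed] name, so that no
    transport is ever needed.  These proofs are irrelevant, [nat] and [int]
    having decidable equality. *)

(** * dg-modules and non-unitary symmetric operads *)

Section Operads.
Variable k : comPzRingType.

Record dgmod := DGMod {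
  dg_mod :> int -> lmodType k;
  dgd : forall i j : int, i = j + 1 -> {linear dg_mod i -> dg_mod j};
  dgdd : forall (i j l : int) (e : i = j + 1) (e' : j = l + 1) (x : dg_mod i),
    dgd e' (dgd e x) = 0 }.

Arguments dgd {d i j} e.

Definition koszul (i : int) : k := (-1) ^+ `|i|%N.

(** Inputs of an operation are numbered from 0.  In [p o_a q], with [q] of
    arity [n] plugged in the input [a] of [p], the input [j] of [q] becomes
    [inner a j] and the input [c != a] of [p] becomes [outer a n c]. *)
Definition inner (a j : nat) : nat := (a + j)%N.
Definition outer (a n c : nat) : nat := if (c < a)%N then c else (c + n).-1.

(** [rho] is the block permutation with which relabelling [p] by [s] and [q] by
    [t] relabels [p o_a q]. *)
Definition block_perm (m n l : nat) (a : 'I_m) (s : 'S_m) (t : 'S_n)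
    (rho : 'S_l) : Prop :=
  (forall (c : 'I_m) (x : 'I_l), c != a -> x = outer a n c :> nat ->
     rho x = outer (s a) n (s c) :> nat) /\
  (forall (j : 'I_n) (x : 'I_l), x = inner a j :> nat ->
     rho x = inner (s a) (t j) :> nat).

(** Operads are given by their partial composites [p o_a q].  [oact s p]
    relabels the input [i] of [p] as [s i].  Since [s * t] is "[s], then [t]"
    in MathComp, this is a right action of ['S_r]; for the product of
    permutations read as functions it is [p . s^-1]. *)
Record operad := Operad {
  osym :> nat -> dgmod;
  oact : forall {r : nat} {i : int}, 'S_r -> {linear osym r i -> osym r i};
  ounit : osym 1%N 0;
  ocomp : forall {m n l : nat} {i j h : int} (a : 'I_m),
    l.+1 = (m + n)%N -> h = i + j -> osym m i -> osym n j -> osym l h;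
  ononunitary : forall (i : int) (x : osym 0 i), x = 0;
  oact1 : forall r i (x : osym r i), oact 1%g x = x;
  oactM : forall r i (s t : 'S_r) (x : osym r i),
    oact t (oact s x) = oact (s * t)%g x;
  oact_d : forall r i j (e : i = j + 1) (s : 'S_r) (x : osym r i),
    dgd e (oact s x) = oact s (dgd e x);
  ocompDl : forall m n l i j h (a : 'I_m) (el : l.+1 = (m + n)%N)
    (ed : h = i + j) (c : k) (p p' : osym m i) (q : osym n j),
    ocomp a el ed (c *: p + p') q = c *: ocomp a el ed p q + ocomp a el ed p' q;
  ocompDr : forall m n l i j h (a : 'I_m) (el : l.+1 = (m + n)%N)
    (ed : h = i + j) (c : k) (p : osym m i) (q q' : osym n j),
    ocomp a el ed p (c *: q + q') = c *: ocomp a el ed p q + ocomp a el ed p q';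
  ounit_d : forall j (e : 0 = j + 1), dgd e ounit = 0;
  ocomp_d : forall m n l i j h i' j' h' (a : 'I_m) (el : l.+1 = (m + n)%N)
    (ed : h = i + j) (edl : h' = i' + j) (edr : h' = i + j')
    (ei : i = i' + 1) (ej : j = j' + 1) (eh : h = h' + 1)
    (p : osym m i) (q : osym n j),
    dgd eh (ocomp a el ed p q) =
      ocomp a el edl (dgd ei p) q + koszul i *: ocomp a el edr p (dgd ej q);
  ocomp_act : forall m n l i j h (a : 'I_m) (el : l.+1 = (m + n)%N)
    (ed : h = i + j) (s : 'S_m) (t : 'S_n) (rho : 'S_l)
    (p : osym m i) (q : osym n j), block_perm a s t rho ->
    ocomp (s a) el ed (oact s p) (oact t q) = oact rho (ocomp a el ed p q);
  ocomp1l : forall n i (el : n.+1 = (1 + n)%N) (ed : i = 0 + i) (q : osym n i),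
    ocomp ord0 el ed ounit q = q;
  ocomp1r : forall m i (a : 'I_m) (el : m.+1 = (m + 1)%N) (ed : i = i + 0)
    (p : osym m i), ocomp a el ed p ounit = p;
  ocompA : forall m n n' l1 l2 l i j j' h1 h2 h
    (a : 'I_m) (b : 'I_n) (ab : 'I_l1)
    (el1 : l1.+1 = (m + n)%N) (ed1 : h1 = i + j)
    (el2 : l2.+1 = (n + n')%N) (ed2 : h2 = j + j')
    (el1' : l.+1 = (l1 + n')%N) (ed1' : h = h1 + j')
    (el2' : l.+1 = (m + l2)%N) (ed2' : h = i + h2)
    (p : osym m i) (q : osym n j) (q' : osym n' j'),
    ab = inner a b :> nat ->
    ocomp ab el1' ed1' (ocomp a el1 ed1 p q) q' =
      ocomp a el2' ed2' p (ocomp b el2 ed2 q q');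
  ocompAC : forall m n n' l1 l2 l i j j' h1 h2 h
    (a b : 'I_m) (b' : 'I_l1) (a' : 'I_l2)
    (el1 : l1.+1 = (m + n)%N) (ed1 : h1 = i + j)
    (el2 : l2.+1 = (m + n')%N) (ed2 : h2 = i + j')
    (el1' : l.+1 = (l1 + n')%N) (ed1' : h = h1 + j')
    (el2' : l.+1 = (l2 + n)%N) (ed2' : h = h2 + j)
    (p : osym m i) (q : osym n j) (q' : osym n' j'),
    (a < b)%N -> b' = outer a n b :> nat -> a' = outer b n' a :> nat ->
    ocomp b' el1' ed1' (ocomp a el1 ed1 p q) q' =
      (-1) ^+ (`|j| * `|j'|)%N *: ocomp a' el2' ed2' (ocomp b el2 ed2 p q') q }.

Arguments oact {o r i} s.
Arguments ounit : clear implicits.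
Arguments ocomp {o m n l i j h} a el ed p q.

Record operad_mor (P Q : operad) := OperadMor {
  omor :> forall (r : nat) (i : int), {linear P r i -> Q r i};
  omor_d : forall r i j (e : i = j + 1) (x : P r i),
    omor r j (dgd e x) = dgd e (omor r i x);
  omor_act : forall r i (s : 'S_r) (x : P r i),
    omor r i (oact s x) = oact s (omor r i x);
  omor_unit : omor 1%N 0 (ounit P) = ounit Q;
  omor_comp : forall m n l i j h (a : 'I_m) (el : l.+1 = (m + n)%N)
    (ed : h = i + j) (p : P m i) (q : P n j),
    omor l h (ocomp a el ed p q) = ocomp a el ed (omor m i p) (omor n j q) }.

Definition omor_eq (P Q : operad) (f g : operad_mor P Q) : Prop :=
  forall r i (x : P r i), f r i x = g r i x.

(** * Homology *)

Definition cycle (M : dgmod) (i : int) (x : M i) : Prop :=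
  forall j (e : i = j + 1), dgd e x = 0.

Definition boundary (M : dgmod) (i : int) (x : M i) : Prop :=
  exists (j : int) (e : j = i + 1) (y : M j), dgd e y = x.

Definition homologous (M : dgmod) (i : int) (x y : M i) : Prop :=
  boundary (x - y).

(** [f] induces a bijection [H_i (P r) -> H_i (Q r)] for all [r], [i]. *)
Definition weak_equivalence (P Q : operad) (f : operad_mor P Q) : Prop :=
  forall (r : nat) (i : int),
    (forall x y : P r i, cycle x -> cycle y ->
       homologous (f r i x) (f r i y) -> homologous x y) /\
    (forall z : Q r i, cycle z ->
       exists x : P r i, cycle x /\ homologous (f r i x) z).

(** An identification [H_*(P) ~ G] of operads, as a map [z |-> h [z]] defined
    on cycles: it is onto, its kernel consists of the boundaries, and it
    preserves the operad structure; [H_*(P)] has the zero differential.  The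
    values of [h] outside of cycles are irrelevant. *)
Record homology_iso (P G : operad) (h : forall r i, P r i -> G r i) : Prop := {
  hiso_linear : forall r i (c : k) (x y : P r i), cycle x -> cycle y ->
    h r i (c *: x + y) = c *: h r i x + h r i y;
  hiso_onto : forall r i (g : G r i), exists x : P r i, cycle x /\ h r i x = g;
  hiso_ker : forall r i (x : P r i), cycle x -> (h r i x = 0 <-> boundary x);
  hiso_d : forall r i j (e : i = j + 1) (g : G r i), dgd e g = 0;
  hiso_act : forall r i (s : 'S_r) (x : P r i), cycle x ->
    h r i (oact s x) = oact s (h r i x);
  hiso_unit : h 1%N 0 (ounit P) = ounit G;
  hiso_comp : forall m n l i j d (a : 'I_m) (el : l.+1 = (m + n)%N)
    (ed : d = i + j) (p : P m i) (q : P n j), cycle p -> cycle q ->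
    h l d (ocomp a el ed p q) = ocomp a el ed (h m i p) (h n j q) }.

(** Under the identification [h], [f] and [eps] are the same map in homology. *)
Definition induces_in_homology (P G Q : operad)
    (h : forall r i, P r i -> G r i) (eps : operad_mor G Q)
    (f : operad_mor P Q) : Prop :=
  forall r i (x : P r i), cycle x -> homologous (f r i x) (eps r i (h r i x)).

(** * Model structure *)

Definition fibration (P Q : operad) (f : operad_mor P Q) : Prop :=
  forall r i (y : Q r i), exists x : P r i, f r i x = y.

Definition cofibration (A B : operad) (u : operad_mor A B) : Prop :=
  forall (X Y : operad) (f : operad_mor X Y),
    fibration f -> weak_equivalence f ->
    forall (v : operad_mor A X) (w : operad_mor B Y),
      (forall r i (x : A r i), f r i (v r i x) = w r i (u r i x)) ->
      exists g : operad_mor B X,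
        (forall r i (x : A r i), g r i (u r i x) = v r i x) /\
        (forall r i (x : B r i), f r i (g r i x) = w r i x).

Definition initial_operad (I : operad) : Prop :=
  forall Q : operad, exists u : operad_mor I Q,
    forall v : operad_mor I Q, omor_eq u v.

Definition cofibrant (P : operad) : Prop :=
  exists (I : operad) (u : operad_mor I P), initial_operad I /\ cofibration u.

Definition weakly_equivalent : operad -> operad -> Prop :=
  clos_refl_sym_trans operad
    (fun P Q => exists f : operad_mor P Q, weak_equivalence f).

Section Product.
Variables P Q : operad.

Section DG.
Variables (M N : dgmod) (i j : int) (e : i = j + 1).
Definition prod_d_fun (x : (M i * N i)%type) : (M j * N j)%type :=
  (dgd e x.1, dgd e x.2).
Fact prod_d_linear : linear prod_d_fun.
Proof. by move=> c x y; rewrite /prod_d_fun !linearP. Qed.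
HB.instance Definition _ :=
  GRing.isLinear.Build k (M i * N i)%type (M j * N j)%type _ prod_d_fun
    prod_d_linear.
End DG.

Definition prod_dgmod (M N : dgmod) : dgmod.
Proof.
refine (@DGMod (fun i => (M i * N i)%type : lmodType k)
  (fun i j e => @prod_d_fun M N i j e : {linear _ -> _}) _).
by move=> i j l e e' [x y]; rewrite /= /prod_d_fun /= !dgdd.
Defined.

Section Act.
Variables (r : nat) (i : int) (s : 'S_r).
Definition prod_act_fun (x : (P r i * Q r i)%type) : (P r i * Q r i)%type :=
  (oact s x.1, oact s x.2).
Fact prod_act_linear : linear prod_act_fun.
Proof. by move=> c x y; rewrite /prod_act_fun !linearP. Qed.
HB.instance Definition _ :=
  GRing.isLinear.Build k (P r i * Q r i)%type (P r i * Q r i)%type _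
    prod_act_fun prod_act_linear.
End Act.

Definition prod_operad : operad.
Proof.
refine (@Operad (fun r => prod_dgmod (P r) (Q r))
  (fun r i s => @prod_act_fun r i s : {linear _ -> _})
  (ounit P, ounit Q)
  (fun m n l i j h a el ed p q =>
     (ocomp a el ed p.1 q.1, ocomp a el ed p.2 q.2)) _ _ _ _ _ _ _ _ _ _ _ _ _).
- by move=> i [x y]; rewrite (ononunitary x) (ononunitary y).
- by move=> r i [x y]; rewrite /= /prod_act_fun /= !oact1.
- by move=> r i s t [x y]; rewrite /= /prod_act_fun /= !oactM.
- by move=> r i j e s [x y]; rewrite /= /prod_act_fun /prod_d_fun /= !oact_d.
- by move=> *; rewrite /= !ocompDl.
- by move=> *; rewrite /= !ocompDr.
- by move=> *; rewrite /= /prod_d_fun /= !ounit_d.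
- move=> m n l i j h i' j' h' a el ed edl edr ei ej eh p q.
  by rewrite /= /prod_d_fun /= !(ocomp_d _ _ _ edl edr ei ej eh).
- by move=> m n l i j h a el ed s t rho p q B; rewrite /= !(ocomp_act _ _ _ _ B).
- by move=> n i el ed [x y]; rewrite /= !ocomp1l.
- by move=> m i a el ed [x y]; rewrite /= !ocomp1r.
- move=> m n n' l1 l2 l i j j' h1 h2 h a b ab el1 ed1 el2 ed2 el1' ed1' el2' ed2'.
  by move=> p q q' E; rewrite /= !(ocompA _ _ el2 ed2 _ _ el2' ed2' _ _ _ E).
- move=> m n n' l1 l2 l i j j' h1 h2 h a b b' a' el1 ed1 el2 ed2 el1' ed1'.
  move=> el2' ed2' p q q' ab Eb Ea.
  by rewrite /= !(ocompAC _ _ el2 ed2 _ _ el2' ed2' _ _ _ ab Eb Ea).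
Defined.

End Product.

(** Homotopy through some path-object [B -> path -> B x B] of the target. *)
Definition right_homotopic (A B : operad) (f0 f1 : operad_mor A B) : Prop :=
  exists (path : operad) (s : operad_mor B path)
         (p : operad_mor path (prod_operad B B)),
    [/\ weak_equivalence s, fibration p,
        (forall r i (x : B r i), p r i (s r i x) = (x, x)) &
        exists H : operad_mor A path,
          forall r i (x : A r i), p r i (H r i x) = (f0 r i x, f1 r i x)].

(** * The commutative operad *)

(** [C(r)_i] is free of rank one if [r > 0] and [i = 0], and zero otherwise:
    row vectors of length [true = 1] or [false = 0]. *)
Definition com_mod (r : nat) (i : int) : lmodType k :=
  'rV[k]_((0 < r)%N && (i == 0)).

Definition com_coef (b : bool) (v : 'rV[k]_b) : k := \sum_j v 0 j.

Definition com_dgmod (r : nat) : dgmod.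
Proof.
refine (@DGMod (com_mod r)
  (fun i j e => \0 : {linear com_mod r i -> com_mod r j}) _).
by [].
Defined.

Lemma com_coef_const (b : bool) (c : k) : com_coef (const_mx c : 'rV_b) = c *+ b.
Proof.
rewrite /com_coef; under eq_bigr do rewrite mxE.
by rewrite sumr_const card_ord.
Qed.

Lemma com_coef_linear (b : bool) (c : k) (u v : 'rV[k]_b) :
  com_coef (c *: u + v) = c * com_coef u + com_coef v.
Proof.
by rewrite /com_coef mulr_sumr -big_split; apply: eq_bigr => j _; rewrite !mxE.
Qed.

Lemma com_coefK (b : bool) (v : 'rV[k]_b) : const_mx (com_coef v) = v.
Proof.
apply/rowP; case: b v => v [[|i] //= Hi]; rewrite mxE /com_coef big_ord1.
by congr (v _ _); apply: val_inj.
Qed.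

Lemma com_coef0 (b : bool) (v : 'rV[k]_b) : ~~ b -> com_coef v = 0.
Proof. by case: b v => // v _; rewrite /com_coef big_ord0. Qed.

Lemma com_coef_comp (m n l : nat) (i j h : int) 
    (p : 'rV[k]_((0 < m)%N && (i == 0))) (q : 'rV[k]_((0 < n)%N && (j == 0))) :
  l.+1 = (m + n)%N -> h = i + j ->
  com_coef (const_mx (com_coef p * com_coef q) : 'rV_((0 < l)%N && (h == 0))) =
  com_coef p * com_coef q.
Proof.
move=> el ed; rewrite com_coef_const.
case: (boolP ((0 < l)%N && (h == 0))) => [_|] /=; first by rewrite mulr1n.
rewrite mulr0n.
have [/andP[m0 i0]|/com_coef0-> _] :=
  orP (orbN ((0 < m)%N && (i == 0))); last first.
  by rewrite mul0r.
have [/andP[n0 j0]|/com_coef0-> _] :=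
  orP (orbN ((0 < n)%N && (j == 0))); last first.
  by rewrite mulr0.
have -> : h == 0 by rewrite ed; apply/eqP; rewrite (eqP i0) (eqP j0) addr0.
rewrite andbT -leqNgt leqn0 => /eqP l0.
by move: (leq_add m0 n0); rewrite -el l0.
Qed.

Lemma com_coef_zero (b : bool) : com_coef (0 : 'rV[k]_b) = 0.
Proof. by rewrite /com_coef big1 // => j _; rewrite mxE. Qed.

Definition com : operad.
Proof.
refine (@Operad com_dgmod
  (fun r i s => idfun : {linear com_mod r i -> com_mod r i})
  (const_mx 1)
  (fun m n l i j h a el ed p q => const_mx (com_coef p * com_coef q))
  _ _ _ _ _ _ _ _ _ _ _ _ _).
- by move=> i x; apply/rowP => -[].
- by [].
- by [].
- by [].
- move=> m n l i j h a el ed c p p' q; apply/rowP => x.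
  by rewrite !mxE com_coef_linear mulrDl mulrA.
- move=> m n l i j h a el ed c p q q'; apply/rowP => x.
  by rewrite !mxE com_coef_linear mulrDr mulrCA.
- by [].
- move=> m n l i j h i' j' h' a el ed edl edr ei ej eh p q.
  by apply/rowP => x; rewrite !mxE !com_coef_zero mul0r mulr0 mulr0 addr0.
- by [].
- move=> n i el ed q; rewrite com_coef_const /= mul1r; exact: com_coefK.
- move=> m i a el ed p; rewrite com_coef_const /= mulr1; exact: com_coefK.
- move=> m n n' l1 l2 l i j j' h1 h2 h a b ab el1 ed1 el2 ed2 el1' ed1'.
  move=> el2' ed2' p q q' _.
  rewrite (com_coef_comp _ _ el1 ed1) (com_coef_comp _ _ el2 ed2).
  by rewrite mulrA.
- move=> m n n' l1 l2 l i j j' h1 h2 h a b b' a' el1 ed1 el2 ed2 el1' ed1'.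
  move=> el2' ed2' p q q' ab Eb Ea.
  rewrite (com_coef_comp _ _ el1 ed1) (com_coef_comp _ _ el2 ed2).
  apply/rowP => x; rewrite !mxE mulrAC.
  have [/andP[_ /eqP j0]|/com_coef0->] :=
    orP (orbN ((0 < n)%N && (j == 0))).
    have -> : (`|j| * `|j'|)%N = 0%N by rewrite j0 mul0n.
    by rewrite expr0 mul1r.
  by rewrite mulr0 mulr0.
Defined.

(** * Operads generated by binary operations *)

Definition comp2 (Q : operad) (i j h : int) (a : 'I_2) (e : h = i + j)
    (p : Q 2%N i) (q : Q 2%N j) : Q 3%N h :=
  ocomp a (erefl 4 : 4 = 2 + 2)%N e p q.

Definition swap01 : 'S_2 := tperm ord0 ord_max.
Definition swap12 : 'S_3 := tperm (inord 1) ord_max.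
Definition rot3 : 'S_3 := perm (can_inj (@ordSK 3)).

Definition assoc_relations (Q : operad) (mu : Q 2%N 0) : Prop :=
  [/\ cycle mu &
      forall e : 0 = 0 + 0,
        comp2 ord0 e mu mu = comp2 ord_max e mu mu].

(** The bracket [lam] has degree [n - 1].  The sign [(-1)^n] is that of the
    action of the transposition on [Lambda^(1-n) L (2)]: [-1] from [L], and
    [(-1)^(n-1)] from the twists by the signature.  The three terms of the
    Jacobi relation differ by even permutations, so it is not affected by the
    twists.  [gerst_poisson] is [lam(mu(x0,x1),x2) = mu(x0,lam(x1,x2)) +
    mu(lam(x0,x2),x1)]. *)
Record gerst_relations (n : nat) (Q : operad)
    (mu : Q 2%N 0) (lam : Q 2%N (n.-1)%:Z) : Prop := {
  gerst_assoc : assoc_relations mu;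
  gerst_comm : oact swap01 mu = mu;
  gerst_cycle : cycle lam;
  gerst_antisym : oact swap01 lam = (-1) ^+ n *: lam;
  gerst_jacobi : forall h (e : h = (n.-1)%:Z + (n.-1)%:Z),
    let x := comp2 ord0 e lam lam in
    x + oact rot3 x + oact (rot3 * rot3)%g x = 0;
  gerst_poisson : forall (e : (n.-1)%:Z = (n.-1)%:Z + 0)
                         (e' : (n.-1)%:Z = 0 + (n.-1)%:Z),
    comp2 ord0 e lam mu =
      comp2 ord_max e' mu lam + oact swap12 (comp2 ord0 e' mu lam) }.

(** [A], the operad generated by an associative product [mu]. *)
Definition is_assoc_operad (A : operad) (mu : A 2%N 0) : Prop :=
  assoc_relations mu /\
  forall (Q : operad) (mu' : Q 2%N 0), assoc_relations mu' ->
    exists f : operad_mor A Q, f _ _ mu = mu' /\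
      forall g : operad_mor A Q, g _ _ mu = mu' -> omor_eq f g.

(** [G_n], the operad generated by a commutative associative product [mu] and
    a Lie bracket [lam] of degree [n - 1] satisfying the Poisson relation. *)
Definition is_gerst_operad (n : nat) (G : operad)
    (mu : G 2%N 0) (lam : G 2%N (n.-1)%:Z) : Prop :=
  gerst_relations mu lam /\
  forall (Q : operad) (mu' : Q 2%N 0) (lam' : Q 2%N (n.-1)%:Z),
    gerst_relations mu' lam' ->
    exists f : operad_mor G Q, [/\ f _ _ mu = mu', f _ _ lam = lam' &
      forall g : operad_mor G Q,
        g _ _ mu = mu' -> g _ _ lam = lam' -> omor_eq f g].

Definition com_mu : com 2%N 0 := const_mx 1.

(** [G] is [A] if [n = 1], [G_n] if [1 < n < oo], and [eps : G -> C] is its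
    canonical augmentation; [None] stands for [n = oo], and then [(G, eps)] is
    [(C, id)] up to isomorphism. *)
Definition canonical_augmentation (n : option nat) (G : operad)
    (eps : operad_mor G com) : Prop :=
  match n with
  | Some 1%N => exists mu, is_assoc_operad mu /\ eps _ _ mu = com_mu
  | Some n => exists mu lam, [/\ is_gerst_operad (n := n) mu lam,
                eps _ _ mu = com_mu & eps _ _ lam = 0]
  | None => forall r i, bijective (eps r i)
  end.

End Operads.

Arguments dgd {k d i j} e.
Arguments oact {k o r i} s.
Arguments ounit {k} o.
Arguments ocomp {k o m n l i j h} a el ed p q.

(** * Little cubes *)

Section LittleCubes.
Variable R : realType.

Definition std_simplex (m : nat) : set 'rV[R]_m.+1 :=
  [set x | (forall i, 0 <= x 0 i) /\ \sum_i x 0 i = 1]%classic.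

Arguments std_simplex : clear implicits.

(** With the subspace topology. *)
Definition simplex (m : nat) := set_type (std_simplex m).

Definition push_fun (m p : nat) (theta : 'I_m.+1 -> 'I_p.+1)
  (x : simplex m) : 'rV[R]_p.+1 :=
  \row_i \sum_(j | theta j == i) (val x) 0 j.

Fact push_subproof (m p : nat) (theta : 'I_m.+1 -> 'I_p.+1) (x : simplex m) :
  push_fun theta x \in std_simplex p.
Proof.
have /set_mem[x0 x1] := valP x; apply/mem_set; split => [i|].
  by rewrite mxE; apply: sumr_ge0.
under eq_bigr do rewrite mxE /=.
by rewrite -x1 (partition_big theta xpredT).
Qed.

(** The affine map [Delta^m -> Delta^p] given by [theta] on vertices. *)
Definition push (m p : nat) (theta : 'I_m.+1 -> 'I_p.+1) (x : simplex m) :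
  simplex p := exist _ (push_fun theta x) (push_subproof theta x).

(** [c : cubes n r] encodes the [r] maps [t |-> (c.1 x j + (c.2 x j - c.1 x j) *
    t_j)_j] from [[0,1]^n] to [R^n], for [x < r]. *)
Definition cubes (n r : nat) : Type := ('M[R]_(r, n) * 'M[R]_(r, n))%type.

(** The space [D_n(r)] is the subspace of the [c : cubes n r] such that: *)
Definition little_cubes (n r : nat) (c : cubes n r) : Prop :=
  (forall x j, [/\ 0 <= c.1 x j, c.1 x j < c.2 x j & c.2 x j <= 1]) /\
  (forall x y, x != y -> ~ exists t : 'rV[R]_n, forall j,
     (c.1 x j < t 0 j < c.2 x j) /\ (c.1 y j < t 0 j < c.2 y j)).

Definition cubes_act (n r : nat) (s : 'S_r) (c : cubes n r) : cubes n r :=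
  (row_perm (s^-1)%g c.1, row_perm (s^-1)%g c.2).

Definition cubes_unit (n : nat) : cubes n 1 := (const_mx 0, const_mx 1).

(** The input of [p] or [q] which an input [x] of [p o_a q] comes from. *)
Definition comp_input (m n l : nat) (a : 'I_m) (x : 'I_l) : 'I_m + 'I_n :=
  if [pick j : 'I_n | x == inner a j :> nat] is Some j then inr j
  else if [pick c : 'I_m | (c != a) && (x == outer a n c :> nat)] is Some c
  then inl c else inl a.

Definition cubes_comp (n r s l : nat) (a : 'I_r) (c : cubes n r)
    (d : cubes n s) : cubes n l :=
  let corner (e : 'M[R]_(r, n)) (f : 'M[R]_(s, n)) : 'M[R]_(l, n) :=
    \matrix_(x, j) match comp_input s a x with
      | inl y => e y j
      | inr y => c.1 a j + (c.2 a j - c.1 a j) * f y j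
      end in
  (corner c.1 d.1, corner c.2 d.2).

(** * The chain operad of little cubes *)

Definition singular (n r m : nat) (f : simplex m -> cubes n r) : Prop :=
  continuous f /\ forall x, little_cubes (f x).

(** [(p,q)]-shuffles, as maximal chains [x |-> (st.1 x, st.2 x)] of the poset
    [[p] x [q]], from [(0,0)] to [(p,q)]. *)
Definition shuffle (p q m : nat)
    (st : {ffun 'I_m.+1 -> 'I_p.+1} * {ffun 'I_m.+1 -> 'I_q.+1}) : bool :=
  [forall x : 'I_m.+1, forall y : 'I_m.+1, (x <= y)%N ==>
     (st.1 x <= st.1 y)%N && (st.2 x <= st.2 y)%N] &&
  [forall x : 'I_m.+1, st.1 x + st.2 x == x :> nat]%N.

(** The signature of a shuffle is the parity of the number of pairs of steps
    where a [q]-step precedes a [p]-step. *)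
Definition shuffle_inv (p q m : nat)
    (st : {ffun 'I_m.+1 -> 'I_p.+1} * {ffun 'I_m.+1 -> 'I_q.+1}) : nat :=
  (\sum_(x < m) (st.1 (lift ord0 x) - st.1 (widen_ord (leqnSn m) x)) *
                st.2 (widen_ord (leqnSn m) x))%N.

Variable k : comPzRingType.

(** [Q] is the operad of singular chains [C_*(D_n(r); k)], for [r > 0], and is
    zero in arity [0]; [ch f] is the basis element of the singular simplex [f]
    (and irrelevant when [f] is not [singular]).  Composites are given by the
    shuffle cross product followed by the composition of little cubes. *)
Record little_cubes_chains (n : nat) (Q : operad k)
    (ch : forall r m : nat, (simplex m -> cubes n r) -> Q r m%:Z) : Prop := {
  chains_neg : forall r m (z : Q r (- (m.+1)%:Z)), z = 0;
  chains_span : forall r m, (0 < r)%N -> forall z : Q r m%:Z,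
    exists (N : nat) (f : 'I_N -> simplex m -> cubes n r) (c : 'I_N -> k),
      (forall x, singular (f x)) /\ z = \sum_x c x *: ch r m (f x);
  chains_free : forall r m, (0 < r)%N ->
    forall (N : nat) (f : 'I_N -> simplex m -> cubes n r) (c : 'I_N -> k),
      injective f -> (forall x, singular (f x)) ->
      \sum_x c x *: ch r m (f x) = 0 -> forall x, c x = 0;
  chains_d : forall r m (e : (m.+1)%:Z = m%:Z + 1)
    (f : simplex m.+1 -> cubes n r), (0 < r)%N -> singular f ->
    dgd e (ch r m.+1 f) =
      \sum_(x < m.+2) (-1) ^+ x *: ch r m (fun y => f (push (lift x) y));
  chains_act : forall r m (s : 'S_r) (f : simplex m -> cubes n r),
    (0 < r)%N -> singular f ->
    oact s (ch r m f) = ch r m (fun y => cubes_act s (f y));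
  chains_unit : ounit Q = ch 1%N 0%N (fun=> cubes_unit n);
  chains_comp : forall r s l p q (a : 'I_r) (el : l.+1 = (r + s)%N)
    (ed : (p + q)%:Z = p%:Z + q%:Z)
    (f : simplex p -> cubes n r) (g : simplex q -> cubes n s),
    (0 < s)%N -> singular f -> singular g ->
    ocomp a el ed (ch r p f) (ch s q g) =
      \sum_(st | shuffle st) (-1) ^+ shuffle_inv st *:
        ch l (p + q)%N (fun y => cubes_comp l a (f (push st.1 y))
                                                (g (push st.2 y))) }.

Definition En_operad (n : option nat) (P : operad k) : Prop :=
  match n with
  | Some n => exists (Q : operad k)
      (ch : forall r m : nat, (simplex m -> cubes n r) -> Q r m%:Z),
      little_cubes_chains ch /\ weakly_equivalent P Q
  | None => weakly_equivalent P (com k)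
  end.

End LittleCubes.

(* Main.v *)
Require Import Defs.
From HB Require Import structures.
From mathcomp Require Import all_boot all_order all_algebra all_fingroup reals.
From mathcomp Require Import boolp zify ring.
From Stdlib Require Import Relations.
Import Defs.

Set Implicit Arguments.
Unset Strict Implicit.
Unset Printing Implicit Defensive.

Import Order.TTheory GRing.Theory Num.Theory.
Local Open Scope ring_scope.

(** The commutative operad [C] vanishes outside of degree 0 and has no
    differential, so that a morphism [P -> C] is determined on the cycles of
    degree 0 by the map induced in homology, and is zero in non-zero degrees.
    Hence [phi0] and [phi1] agree on the connective cover [tP] of [P], made of
    the operations of positive degree and of the cycles of degree 0.  They may
    differ on operations of degree 0 which are not cycles, because a cofibrant
    operad may be non-zero in negative degrees.  But the homology of an
    [E_n]-operad vanishes in negative degrees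
    ([En_negatively_acyclic]), so that [tP -> P] is a weak-equivalence, and it
    remains to deform [P] into [tP] by means of the cofibrancy of [P].

    The tool is a path object [P^I] which exists for every non-unitary operad
    over every ring ([path_operad]).  One sets [P^I(r) = N^*([0,1]^r) (x) P(r)],
    where [N^*] denotes the normalized cubical cochains.  The composite of [p]
    and [q] at the input [a] is obtained by pulling back along the map
    [[0,1]^(m+n-1) -> [0,1]^m x [0,1]^n] whose coordinate of index [a] in
    [[0,1]^m] is the minimum of the [n] coordinates of the block of [q], the
    other coordinates being unchanged.  The associativity of minima gives the
    axioms of an operad, though no strictly commutative cochain algebra of the
    interval exists over a general ring.  The vertices [(0, ..., 0)] and
    [(1, ..., 1)] define the two endpoints of a path ([endpoint]): the
    minimum of a non-empty family of zeros is zero, and this is where the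
    operads have to be non-unitary.  A cycle of [P^I] is homologous to the
    constant path at its starting point, by contraction of the cube to the
    vertex [(0, ..., 0)] ([path_homologous_const]).

    The suboperad [X] of [P^I] of the paths which start in [tP] is then
    mapped onto [P] by an acyclic fibration, the end of a path
    ([connective_end_weak_equivalence], [connective_end_fibration]).  As [P] is
    cofibrant, this has a section [g].  The morphisms [phi0^I g] and
    [phi1^I g] have the same starting point, since [phi0] and [phi1] agree on
    [tP].  Together they form a morphism with values in the operad of pairs of
    paths of [C] with a common starting point.  This operad is a path object of
    [C] when a pair is sent to its two ends
    ([double_const_weak_equivalence], [double_ends_fibration]), and the ends of
    the pair in question are [phi0] and [phi1]. *)

(** * Submodules and families *)
Section Submodule.
Variable k : comPzRingType.

Record submodule (V : lmodType k) := Submodule {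
  submodule_pred :> V -> Prop;
  submodule0 : submodule_pred 0;
  submodule_lin : forall (c : k) x y,
    submodule_pred x -> submodule_pred y -> submodule_pred (c *: x + y) }.

Variables (V : lmodType k) (K : submodule V).

Record submod := Submod { submod_val :> V; submodP : K submod_val }.

Lemma submod_inj (x y : submod) : submod_val x = submod_val y -> x = y.
Proof.
case: x y => [x Kx] [y Ky] /= e; case: y / e Ky => Ky.
by rewrite (Prop_irrelevance Kx Ky).
Qed.

HB.instance Definition _ := gen_eqMixin submod.
HB.instance Definition _ := gen_choiceMixin submod.

Fact submod_addP (x y : submod) : K (submod_val x + submod_val y).
Proof. by rewrite -[submod_val x]scale1r; apply: submodule_lin; apply: submodP. Qed.
Fact submod_scaleP (c : k) (x : submod) : K (c *: submod_val x).
Proof. by rewrite -[_ *: _]addr0; apply: submodule_lin; [exact: submodP|exact: submodule0]. Qed.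
Fact submod_oppP (x : submod) : K (- submod_val x).
Proof. by rewrite -scaleN1r; exact: submod_scaleP. Qed.

Definition submod_zero := Submod (submodule0 K).
Definition submod_add x y := Submod (submod_addP x y).
Definition submod_opp x := Submod (submod_oppP x).
Definition submod_scale c x := Submod (submod_scaleP c x).

Fact submod_addA : associative submod_add.
Proof. by move=> x y z; apply: submod_inj; exact: addrA. Qed.
Fact submod_addC : commutative submod_add.
Proof. by move=> x y; apply: submod_inj; exact: addrC. Qed.
Fact submod_add0 : left_id submod_zero submod_add.
Proof. by move=> x; apply: submod_inj; exact: add0r. Qed.
Fact submod_addN : left_inverse submod_zero submod_opp submod_add.
Proof. by move=> x; apply: submod_inj; exact: addNr. Qed.

HB.instance Definition _ := GRing.isZmodule.Build submod
  submod_addA submod_addC submod_add0 submod_addN.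

Fact submod_scaleA a b x : submod_scale a (submod_scale b x) = submod_scale (a * b) x.
Proof. by apply: submod_inj; exact: scalerA. Qed.
Fact submod_scale1 : left_id 1 submod_scale.
Proof. by move=> x; apply: submod_inj; exact: scale1r. Qed.
Fact submod_scaleDr : right_distributive submod_scale +%R.
Proof. by move=> a x y; apply: submod_inj; exact: scalerDr. Qed.
Fact submod_scaleDl x : {morph submod_scale^~ x : a b / a + b}.
Proof. by move=> a b; apply: submod_inj; exact: scalerDl. Qed.

HB.instance Definition _ := GRing.Zmodule_isLmodule.Build k submod
  submod_scaleA submod_scale1 submod_scaleDr submod_scaleDl.

Lemma submodB (x y : submod) : submod_val (x - y) = submod_val x - submod_val y.
Proof. by []. Qed.

End Submodule.

Section Families.
Variables (k : comPzRingType) (I : Type) (V : I -> lmodType k).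

Definition depfun := forall i, V i.

HB.instance Definition _ := gen_eqMixin depfun.
HB.instance Definition _ := gen_choiceMixin depfun.

Definition depfun_zero : depfun := fun=> 0.
Definition depfun_add (x y : depfun) : depfun := fun i => x i + y i.
Definition depfun_opp (x : depfun) : depfun := fun i => - x i.
Definition depfun_scale (c : k) (x : depfun) : depfun := fun i => c *: x i.

Fact depfun_addA : associative depfun_add.
Proof. by move=> x y z; apply: functional_extensionality_dep => i; exact: addrA. Qed.
Fact depfun_addC : commutative depfun_add.
Proof. by move=> x y; apply: functional_extensionality_dep => i; exact: addrC. Qed.
Fact depfun_add0 : left_id depfun_zero depfun_add.
Proof. by move=> x; apply: functional_extensionality_dep => i; exact: add0r. Qed.
Fact depfun_addN : left_inverse depfun_zero depfun_opp depfun_add.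
Proof. by move=> x; apply: functional_extensionality_dep => i; exact: addNr. Qed.

HB.instance Definition _ := GRing.isZmodule.Build depfun
  depfun_addA depfun_addC depfun_add0 depfun_addN.

Fact depfun_scaleA a b x : depfun_scale a (depfun_scale b x) = depfun_scale (a * b) x.
Proof. by apply: functional_extensionality_dep => i; exact: scalerA. Qed.
Fact depfun_scale1 : left_id 1 depfun_scale.
Proof. by move=> x; apply: functional_extensionality_dep => i; exact: scale1r. Qed.
Fact depfun_scaleDr : right_distributive depfun_scale +%R.
Proof. by move=> a x y; apply: functional_extensionality_dep => i; exact: scalerDr. Qed.
Fact depfun_scaleDl x : {morph depfun_scale^~ x : a b / a + b}.
Proof. by move=> a b; apply: functional_extensionality_dep => i; exact: scalerDl. Qed.

HB.instance Definition _ := GRing.Zmodule_isLmodule.Build k depfun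
  depfun_scaleA depfun_scale1 depfun_scaleDr depfun_scaleDl.

End Families.

(** * Suboperads *)
Section Suboperad.
Variables (k : comPzRingType) (P : operad k).

Record suboperad := Suboperad {
  suboperad_mod :> forall r i, submodule (P r i);
  suboperad_d : forall r i j (e : i = j + 1) (x : P r i),
    suboperad_mod r i x -> suboperad_mod r j (dgd e x);
  suboperad_act : forall r i (s : 'S_r) (x : P r i),
    suboperad_mod r i x -> suboperad_mod r i (oact s x);
  suboperad_unit : suboperad_mod 1%N 0 (ounit P);
  suboperad_comp : forall m n l i j h (a : 'I_m) (el : l.+1 = (m + n)%N)
    (ed : h = i + j) (p : P m i) (q : P n j),
    suboperad_mod m i p -> suboperad_mod n j q ->
    suboperad_mod l h (ocomp a el ed p q) }.

Variable K : suboperad.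

Section D.
Variables (r : nat) (i j : int) (e : i = j + 1).
Definition sub_d_fun (x : submod (K r i)) : submod (K r j) :=
  Submod (suboperad_d e (submodP x)).
Fact sub_d_linear : linear sub_d_fun.
Proof. by move=> c x y; apply: submod_inj; exact: linearP. Qed.
HB.instance Definition _ := GRing.isLinear.Build k _ _ _ sub_d_fun sub_d_linear.
End D.

Section Act.
Variables (r : nat) (i : int) (s : 'S_r).
Definition sub_act_fun (x : submod (K r i)) : submod (K r i) :=
  Submod (suboperad_act s (submodP x)).
Fact sub_act_linear : linear sub_act_fun.
Proof. by move=> c x y; apply: submod_inj; exact: linearP. Qed.
HB.instance Definition _ := GRing.isLinear.Build k _ _ _ sub_act_fun sub_act_linear.
End Act.

Definition sub_dgmod (r : nat) : dgmod k.
Proof.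
refine (@DGMod k (fun i => submod (K r i) : lmodType k)
  (fun i j e => @sub_d_fun r i j e : {linear _ -> _}) _).
by move=> i j l e e' x; apply: submod_inj; exact: dgdd.
Defined.

Definition sub_operad : operad k.
Proof.
refine (@Operad k sub_dgmod
  (fun r i s => @sub_act_fun r i s : {linear _ -> _})
  (Submod (suboperad_unit K))
  (fun m n l i j h a el ed p q =>
     Submod (suboperad_comp a el ed (submodP p) (submodP q)))
  _ _ _ _ _ _ _ _ _ _ _ _ _).
- by move=> i x; apply: submod_inj; exact: ononunitary.
- by move=> r i x; apply: submod_inj; exact: oact1.
- by move=> r i s t x; apply: submod_inj; exact: oactM.
- by move=> r i j e s x; apply: submod_inj; exact: oact_d.
- by move=> *; apply: submod_inj; exact: ocompDl.
- by move=> *; apply: submod_inj; exact: ocompDr.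
- by move=> *; apply: submod_inj; exact: ounit_d.
- by move=> *; apply: submod_inj; exact: ocomp_d.
- by move=> *; apply: submod_inj; exact: ocomp_act.
- by move=> *; apply: submod_inj; exact: ocomp1l.
- by move=> *; apply: submod_inj; exact: ocomp1r.
- by move=> *; apply: submod_inj; exact: ocompA.
- by move=> *; apply: submod_inj; exact: ocompAC.
Defined.

End Suboperad.

(** * Alternating functions of lists *)
Lemma sign_eq (k : comPzRingType) (m n : nat) : odd m = odd n ->
  (-1) ^+ m = (-1) ^+ n :> k.
Proof. by move=> e; rewrite -signr_odd e signr_odd. Qed.

Lemma odd_abszD (x y : int) : odd (absz (x + y)) = odd (absz x) (+) odd (absz y).
Proof. by lia. Qed.

Ltac parity := apply: sign_eq; rewrite ?(oddD, oddM, oddS, odd_abszD, absz_nat) /=;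
  repeat match goal with |- context [odd ?n] => case: (odd n) end => //=.

Section Alternating.
Variables (k : comPzRingType) (V : lmodType k).
Implicit Types (F G : seq nat -> V) (l u : seq nat) (p : pred nat).

(** A cubical cell with [d] edge directions is given below by an arbitrary list
    of these directions, and cochains alternate in it.  Relabellings then act
    without signs, and the sign of a permutation never has to be computed.  The
    second condition does not follow from the first one when 2 is a zero divisor. *)
Definition alternating F : Prop :=
  (forall l1 x y l2, F (l1 ++ x :: y :: l2) = - F (l1 ++ y :: x :: l2)) /\
  (forall l1 x l2, F (l1 ++ x :: x :: l2) = 0).

Lemma alt_front F u x l : alternating F ->
  F (u ++ x :: l) = (-1) ^+ size u *: F (x :: u ++ l).
Proof.
move=> [sw _]; suff H v : F (v ++ u ++ x :: l) = (-1) ^+ size u *: F (v ++ x :: u ++ l).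
  exact: (H [::]).
elim: u v => [|y u IH] v /=; first by rewrite expr0 scale1r.
by rewrite -cat_rcons IH cat_rcons sw exprS mulN1r scaleNr scalerN.
Qed.

Lemma eq_alternating F G : F =1 G -> alternating F -> alternating G.
Proof. by move=> E [sw du]; split=> *; rewrite -!E; [apply: sw|apply: du]. Qed.

Lemma alternatingD F G : alternating F -> alternating G ->
  alternating (fun u => F u + G u).
Proof.
move=> [sF dF] [sG dG]; split=> [l1 x y l2|l1 x l2]; last by rewrite dF dG addr0.
by rewrite sF sG -opprD.
Qed.

Lemma alternating_cons F x : alternating F -> alternating (fun l => F (x :: l)).
Proof. by move=> [sw du]; split=> l1 *; [apply: (sw (x :: l1))|apply: (du (x :: l1))]. Qed.

Lemma alt_catC F u v l : alternating F ->
  F (u ++ v ++ l) = (-1) ^+ (size u * size v) *: F (v ++ u ++ l).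
Proof.
move=> aF; elim: v F aF => [|x v IH] F aF /=; first by rewrite muln0 expr0 scale1r.
rewrite (alt_front _ _ _ aF) (IH (fun l => F (x :: l))); last exact: alternating_cons.
by rewrite scalerA -exprD mulnS.
Qed.

Lemma alt_not_uniq F l : alternating F -> ~~ uniq l -> F l = 0.
Proof.
elim: l F => [//|x l IH] F aF /=; rewrite negb_and negbK => /orP[|ul].
  case/splitPr=> l1 l2; rewrite -cat1s catA (alt_front _ _ _ aF) /=.
  by case: aF => _ /(_ [::]) /= ->; rewrite scaler0.
by apply: (IH (fun l => F (x :: l))) => //; apply: alternating_cons.
Qed.

(** The exponent of the sign of the shuffle which brings the entries in [p] to
    the front of a list. *)
Fixpoint crossings p l : nat :=
  if l is x :: l' then ((~~ p x) * count p l' + crossings p l')%N else 0%N.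

Lemma crossings_cat p u v :
  crossings p (u ++ v) =
    (crossings p u + crossings p v + count (predC p) u * count p v)%N.
Proof.
elim: u => [|x u IH] /=; first by rewrite mul0n addn0.
by rewrite IH count_cat; ring.
Qed.

Lemma crossings_sorted p u v : all p u -> all (predC p) v -> crossings p (u ++ v) = 0%N.
Proof.
elim: u => [_|x u IH] /=.
  elim: v => //= y v IH /andP[_ pv]; rewrite IH // addn0.
  suff -> : count p v = 0%N by rewrite muln0.
  by apply/eqP; rewrite -[_ == _]negbK -lt0n -has_count -all_predC.
by case/andP=> -> pu pv; rewrite IH.
Qed.

Lemma alt_sort F p l : alternating F ->
  F l = (-1) ^+ crossings p l *: F (filter p l ++ filter (predC p) l).
Proof.
elim: l F => [|x l IH] F aF /=; first by rewrite expr0 scale1r.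
rewrite (IH (fun l => F (x :: l))); last exact: alternating_cons.
case: (boolP (p x)) => px //=.
rewrite (alt_front _ _ _ aF) scalerA -exprD mul1n size_filter addnC.
by congr (_ *: _); parity.
Qed.

(** Moving the entries in [p] to the front changes both functions by the same
    sign.  All identities between cochains are checked on cells sorted in this
    way by blocks, where most of the signs are trivial. *)
Lemma alt_eq F G p : alternating F -> alternating G ->
  (forall u v, all p u -> all (predC p) v -> F (u ++ v) = G (u ++ v)) -> F =1 G.
Proof.
move=> aF aG E l; rewrite (alt_sort p _ aF) (alt_sort p _ aG); congr (_ *: _).
by apply: E; apply: filter_all.
Qed.

(** A swap of two entries, one in [p] and the other not, leaves both arguments of
    [H] unchanged and changes the number of crossings by one: this is the sign of
    a cross product. *)
Lemma alternating_split p (f1 f2 : nat -> nat) e (H : seq nat -> seq nat -> V) :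
  (forall v, alternating (H^~ v)) -> (forall u, alternating (H u)) ->
  alternating (fun u => (-1) ^+ (e * count p u + crossings p u)%N *:
    H (map f1 (filter (predC p) u)) (map f2 (filter p u))).
Proof.
move=> H1 H2; split=> [u x y v|u x v].
  rewrite !(filter_cat, map_cat, count_cat, crossings_cat) /=.
  case: (boolP (p x)) => px; case: (boolP (p y)) => py //=.
  - have [sw _] := H2 (map f1 [seq x <- u | predC p x] ++ map f1 [seq x <- v | predC p x]).
    by rewrite sw scalerN.
  - rewrite -scaleNr; congr (_ *: _); rewrite -[RHS]mulN1r -exprS; parity.
  - rewrite -scaleNr; congr (_ *: _); rewrite -[RHS]mulN1r -exprS; parity.
  - have [sw _] := H1 (map f2 [seq x <- u | p x] ++ map f2 [seq x <- v | p x]).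
    by rewrite sw scalerN.
rewrite !(filter_cat, map_cat) /=; case: (boolP (p x)) => px //=.
  have [_ du] := H2 (map f1 [seq x <- u | predC p x] ++ map f1 [seq x <- v | predC p x]).
  by rewrite du scaler0.
have [_ du] := H1 (map f2 [seq x <- u | p x] ++ map f2 [seq x <- v | p x]).
by rewrite du scaler0.
Qed.

Lemma alternating_catr F v : alternating F -> alternating (fun u => F (u ++ v)).
Proof. by move=> [sw du]; split=> *; rewrite -!catA /=; [apply: sw|apply: du]. Qed.

Lemma alt_eq3 F G p q : alternating F -> alternating G ->
  (forall u v w, all p u -> all q u -> all p v -> all (predC q) v -> all (predC p) w ->
     F (u ++ v ++ w) = G (u ++ v ++ w)) -> F =1 G.
Proof.
move=> aF aG E; apply: (alt_eq (p := p) aF aG) => u w pu pw.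
rewrite (alt_sort q u (alternating_catr w aF)) (alt_sort q u (alternating_catr w aG)).
congr (_ *: _); rewrite -!catA; apply: E => //; try exact: filter_all.
  by rewrite all_filter; apply: sub_all pu => x px; apply/implyP.
by rewrite all_filter; apply: sub_all pu => x px; apply/implyP.
Qed.

(** The shape of a cubical differential: the faces of a cell are indexed by its
    edge directions, and the sign of a face is the one which brings its
    direction to the front. *)
Fixpoint removals (F : nat -> seq nat -> V) l : V :=
  if l is x :: l' then F x l' - removals (fun y u => F y (x :: u)) l' else 0.

Lemma removals_eq (F G : nat -> seq nat -> V) l :
  (forall u x v, l = u ++ x :: v -> F x (u ++ v) = G x (u ++ v)) ->
  removals F l = removals G l.
Proof.
elim: l F G => [//|x l IH] F G E /=; rewrite (E [::] x l) //; congr (_ - _).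
by apply: IH => u y v e; apply: (E (x :: u)); rewrite e.
Qed.

Lemma removals0 (F : nat -> seq nat -> V) l :
  (forall u x v, l = u ++ x :: v -> F x (u ++ v) = 0) -> removals F l = 0.
Proof.
move=> E; rewrite (@removals_eq _ (fun _ _ => 0)) //.
have z (s : seq nat) : removals (fun _ _ => 0) s = 0.
  by elim: s => //= x s ->; rewrite subr0.
exact: z.
Qed.

Lemma removalsD (F G : nat -> seq nat -> V) l :
  removals (fun x u => F x u + G x u) l = removals F l + removals G l.
Proof.
elim: l F G => [|x l IH] F G /=; first by rewrite addr0.
by rewrite IH opprD addrACA.
Qed.

Lemma removals_cat (F : nat -> seq nat -> V) u v :
  removals F (u ++ v) = removals (fun x l => F x (l ++ v)) u +
    (-1) ^+ size u *: removals (fun x l => F x (u ++ l)) v.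
Proof.
elim: u F => [|x u IH] F /=; first by rewrite expr0 scale1r add0r.
by rewrite IH /= exprS mulN1r scaleNr opprD addrA.
Qed.

Lemma removals_map (F : nat -> seq nat -> V) (f : nat -> nat) l :
  removals F (map f l) = removals (fun x u => F (f x) (map f u)) l.
Proof. by elim: l F => [//|x l IH] F /=; rewrite IH. Qed.

Lemma alternating_removals (F : nat -> seq nat -> V) :
  (forall x, alternating (F x)) -> alternating (removals F).
Proof.
move=> aF; split => l1.
  elim: l1 F aF => [|z l1 IH] F aF x y l2 /=.
    rewrite !opprB.
    have -> : removals (fun z u => F z (x :: y :: u)) l2 =
              - removals (fun z u => F z (y :: x :: u)) l2.
      have := removalsD (fun z u => F z (x :: y :: u)) (fun z u => F z (y :: x :: u)) l2.
      rewrite removals0 => [/eqP|u z v _]; first by rewrite eq_sym addr_eq0 => /eqP.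
      by have [sw _] := aF z; rewrite (sw [::]) addNr.
    by rewrite addrA.
  have [sw _] := aF z; rewrite sw IH; first by rewrite opprK opprB addrC.
  by move=> w; apply: alternating_cons.
elim: l1 F aF => [|z l1 IH] F aF x l2 /=.
  rewrite opprB addrCA subrr addr0 removals0 // => u z v _.
  by have [_ du] := aF z; apply: (du [::]).
have [_ du] := aF z; rewrite du IH ?subr0 // => w; exact: alternating_cons.
Qed.

Lemma removalsN (F : nat -> seq nat -> V) l :
  removals (fun x u => - F x u) l = - removals F l.
Proof.
apply/eqP; rewrite eq_sym -subr_eq0 -opprD oppr_eq0 -removalsD.
by apply/eqP; apply: removals0 => u x v _; rewrite subrr.
Qed.

Lemma removalsZ c (F : nat -> seq nat -> V) u :
  removals (fun x v => c *: F x v) u = c *: removals F u.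
Proof. by elim: u F => [|x u IH] F /=; [rewrite scaler0|rewrite IH scalerBr]. Qed.

(** The two orders in which two entries can be removed come with opposite
    signs. *)
Lemma removals_removals (F : nat -> nat -> seq nat -> V) l :
  (forall x y u, F x y u = F y x u) ->
  removals (fun x u => removals (F x) u) l = 0.
Proof.
elim: l F => [//|x l IH] F E /=.
rewrite removalsD removalsN IH; last by move=> y z u; rewrite E.
rewrite oppr0 addr0 (_ : removals (F x) l = removals (fun y u => F y x u) l) ?subrr //.
by apply: removals_eq => u y v _; rewrite E.
Qed.

End Alternating.

Lemma removals_linear (k : comPzRingType) (V W : lmodType k) (L : V -> W)
  (F : nat -> seq nat -> V) l : linear L ->
  L (removals F l) = removals (fun x u => L (F x u)) l.
Proof.
move=> lL.
have L0 : L 0 = 0 by have := lL 1 0 0; rewrite scaler0 scale1r add0r => /(congr1 (fun x => x -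
  L 0)); rewrite subrr addrK.
have LB x y : L (x - y) = L x - L y by rewrite -[- y]scaleN1r addrC lL scaleN1r addrC.
by elim: l F => [//|x l IH] F /=; rewrite LB IH.
Qed.

(** * Cubical cochains with coefficients in an operad *)
Section Cubes.
Variables (k : comPzRingType) (P : operad k).

Notation fam r := (forall j : int, P r j).

Section TotalComposite.
Variables (m n l : nat) (a : 'I_m) (el : l.+1 = (m + n)%N).

(** The composite of the values of two families in degrees [p] and [q], as a
    family: it is total in [h], so that degrees can be rewritten. *)
Definition gcomp (F : fam m) (G : fam n) (p q h : int) : P l h :=
  match h =P p + q with
  | ReflectT e => ocomp a el e (F p) (G q)
  | ReflectF _ => 0
  end.

Lemma gcompE F G p q h (e : h = p + q) : gcomp F G p q h = ocomp a el e (F p) (G q).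
Proof. by rewrite /gcomp; case: eqP => // e'; rewrite (eq_irrelevance e e'). Qed.

Lemma gcomp_deg F G p q h : h != p + q -> gcomp F G p q h = 0.
Proof. by rewrite /gcomp; case: eqP. Qed.

Lemma ocomp0l i j h (ed : h = i + j) (q : P n j) : ocomp a el ed (0 : P m i) q = 0.
Proof.
by have := ocompDl a el ed (-1) 0 0 q; rewrite scaler0 addr0 scaleN1r addNr.
Qed.

Lemma ocomp0r i j h (ed : h = i + j) (p : P m i) : ocomp a el ed p (0 : P n j) = 0.
Proof.
by have := ocompDr a el ed (-1) p 0 0; rewrite scaler0 addr0 scaleN1r addNr.
Qed.

Lemma gcomp0l F G p q h : F p = 0 -> gcomp F G p q h = 0.
Proof. by rewrite /gcomp => E; case: eqP => // e; rewrite E ocomp0l. Qed.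

Lemma gcomp0r F G p q h : G q = 0 -> gcomp F G p q h = 0.
Proof. by rewrite /gcomp => E; case: eqP => // e; rewrite E ocomp0r. Qed.

Lemma gcomp_linl c F F' F'' G p q h : F p = c *: F' p + F'' p ->
  gcomp F G p q h = c *: gcomp F' G p q h + gcomp F'' G p q h.
Proof.
rewrite /gcomp => E; case: eqP => [e|_]; last by rewrite scaler0 addr0.
by rewrite E ocompDl.
Qed.

Lemma gcomp_linr c F G G' G'' p q h : G q = c *: G' q + G'' q ->
  gcomp F G p q h = c *: gcomp F G' p q h + gcomp F G'' p q h.
Proof.
rewrite /gcomp => E; case: eqP => [e|_]; last by rewrite scaler0 addr0.
by rewrite E ocompDr.
Qed.

Lemma gcompNl F F' G p q h : F p = - F' p -> gcomp F G p q h = - gcomp F' G p q h.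
Proof.
move=> E; rewrite (@gcomp_linl (-1) F F' (fun=> 0)) ?scaleN1r ?addr0 //.
by rewrite (@gcomp0l (fun=> 0)) // addr0.
Qed.

Lemma gcompNr F G G' p q h : G q = - G' q -> gcomp F G p q h = - gcomp F G' p q h.
Proof.
move=> E; rewrite (@gcomp_linr (-1) F G G' (fun=> 0)) ?scaleN1r ?addr0 //.
by rewrite (@gcomp0r F (fun=> 0)) // addr0.
Qed.

Lemma gcomp_eq F F' G G' p p' q q' h : p = p' -> q = q' -> F p' = F' p' -> G q' = G' q' ->
  gcomp F G p q h = gcomp F' G' p' q' h.
Proof. by move=> -> -> EF EG; rewrite /gcomp; case: eqP => // e; rewrite EF EG. Qed.

End TotalComposite.

(** In [z S u j], the list [u] contains the edge directions of a cell of the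
    cube [[0,1]^r], and the cell lies at the vertex given by [S] in the other
    directions, [true] standing for 1.  The value is taken at every degree [j],
    although a cochain of degree [i] is only non-zero for [j = i + size u]: in
    this way no term has to be transported from a degree to another. *)
Definition cubefam r := depfun (fun _ : nat -> bool => depfun (fun _ : seq nat =>
  depfun (fun j : int => P r j))).

Lemma cubefam_ext r (z z' : cubefam r) : (forall S u j, z S u j = z' S u j) -> z = z'.
Proof.
move=> E; apply: functional_extensionality_dep => S.
apply: functional_extensionality_dep => u.
exact: functional_extensionality_dep (E S u).
Qed.

Record cubical r (i : int) (z : cubefam r) : Prop := Cubical {
  cubical_deg : forall S u j, j != i + (size u)%:Z -> z S u j = 0;
  cubical_range : forall S u j, ~~ all (gtn r) u -> z S u j = 0;
  cubical_ext : forall S S' u j,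
    (forall x, (x < r)%N -> x \notin u -> S x = S' x) -> z S u j = z S' u j;
  cubical_alt : forall S j, alternating (fun u => z S u j) }.

Definition cubical_submodule r (i : int) : submodule (cubefam r).
Proof.
refine (@Submodule k _ (@cubical r i) _ _).
  by split=> //; split=> *; rewrite /= ?oppr0.
move=> c x y [dx rx ex ax] [dy ry ey ay]; split.
- by move=> S u j h; rewrite /= [LHS](_ : _ = c *: x S u j + y S u j) // dx // dy // scaler0 addr0.
- by move=> S u j h; rewrite /= [LHS](_ : _ = c *: x S u j + y S u j) // rx // ry // scaler0 addr0.
- move=> S S' u j h; rewrite [LHS](_ : _ = c *: x S u j + y S u j) //.
  by rewrite (ex _ _ _ _ h) (ey _ _ _ _ h).
- move=> S j; split.
    move=> l1 x1 y1 l2; case: (ax S j) => sx _; case: (ay S j) => sy _.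
    rewrite [LHS](_ : _ = c *: x S (l1 ++ x1 :: y1 :: l2) j + y S (l1 ++ x1 :: y1 :: l2) j) //.
    by rewrite sx sy scalerN -opprD.
  move=> l1 x1 l2; case: (ax S j) => _ sx; case: (ay S j) => _ sy.
  rewrite [LHS](_ : _ = c *: x S (l1 ++ x1 :: x1 :: l2) j + y S (l1 ++ x1 :: x1 :: l2) j) //.
  by rewrite sx sy scaler0 addr0.
Defined.

Lemma cubical_eq r (i : int) (z z' : cubefam r) : cubical i z -> cubical i z' ->
  (forall S u, all (gtn r) u -> z S u (i + (size u)%:Z) = z' S u (i + (size u)%:Z)) -> z = z'.
Proof.
move=> cz cz' E.
apply: cubefam_ext => S u j.
have [ru|ru] := boolP (all (gtn r) u); last first.
  by rewrite (cubical_range cz) // (cubical_range cz').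
have [->|ju] := eqVneq j (i + (size u)%:Z); first exact: E.
by rewrite (cubical_deg cz) // (cubical_deg cz').
Qed.

(** ** Differential *)

Definition upd (S : nat -> bool) x v : nat -> bool := fun y => if y == x then v else S y.

Definition face_diff r (z : cubefam r) S j x u : P r j :=
  z (upd S x true) u j - z (upd S x false) u j.

(** The cochain factor is on the left of the operad factor, so that the internal
    differential of [P] goes past a cochain of degree [- size u]. *)
Definition cube_d r (z : cubefam r) : cubefam r := fun S u j =>
  (-1) ^+ size u *: dgd (erefl (j + 1)) (z S u (j + 1)) + removals (face_diff z S j) u.

Lemma cubical_d r i j0 (e : i = j0 + 1) (z : cubefam r) : cubical i z -> cubical j0 (cube_d z).
Proof.
move=> cz; split.
- move=> S u j h; rewrite /cube_d (cubical_deg cz); last first.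
    by apply: contraNneq h => h; apply/eqP; apply: (addIr 1); rewrite h e addrAC.
  rewrite linear0 scaler0 add0r removals0 // => v x w E; rewrite /face_diff !(cubical_deg cz)
    ?subrr //;
  apply: contraNneq h => ->; rewrite E !size_cat /= e; lia.
- move=> S u j h; rewrite /cube_d (cubical_range cz) //.
  rewrite linear0 scaler0 add0r removals0 // => v x w E; rewrite /face_diff.
  move: h; rewrite E !all_cat /= andbCA negb_and => /orP[h|h]; last first.
    by rewrite !(cubical_range cz) ?subrr // all_cat.
  rewrite (cubical_ext cz (S' := upd S x false)) ?subrr // => y yr _.
  by rewrite /upd; case: eqP => // yx; rewrite -yx /= yr in h.
- move=> S S' u j h; rewrite /cube_d (cubical_ext cz _ h); congr (_ + _).
  apply: removals_eq => v x w E; rewrite /face_diff; congr (_ - _); apply: (cubical_ext cz) =>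
    y yr yu;
    by rewrite /upd; case: eqP => // /eqP yx; apply: h; rewrite // E mem_cat inE (negPf yx)
      -mem_cat.
- move=> S j; apply: alternatingD; last first.
    apply: alternating_removals => x; split => [l1 y y' l2|l1 y l2]; rewrite /face_diff.
      have [s1 _] := cubical_alt cz (upd S x true) j; have [s0 _] :=
        cubical_alt cz (upd S x false) j.
      by rewrite s1 s0 opprB opprK addrC.
    have [_ s1] := cubical_alt cz (upd S x true) j; have [_ s0] := cubical_alt cz (upd S x false) j.
    by rewrite s1 s0 subrr.
  have [s0 s1] := cubical_alt cz S (j + 1); split => [l1 y y' l2|l1 y l2].
    by rewrite s0 linearN scalerN !size_cat.
  by rewrite s1 linear0 scaler0.
Qed.

Lemma face_diff_linear r j S x u c (z z' : cubefam r) :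
  face_diff (c *: z + z') S j x u = c *: face_diff z S j x u + face_diff z' S j x u.
Proof.
rewrite [LHS](_ : _ = (c *: z (upd S x true) u j + z' (upd S x true) u j) -
  (c *: z (upd S x false) u j + z' (upd S x false) u j)) //.
by rewrite opprD addrACA -scalerBr.
Qed.

Lemma cube_d_linear r c (z z' : cubefam r) :
  cube_d (c *: z + z') = c *: cube_d z + cube_d z'.
Proof.
apply: cubefam_ext => S u j.
rewrite [RHS](_ : _ = c *: cube_d z S u j + cube_d z' S u j) //.
rewrite /cube_d; rewrite [dgd _ _](_ : _ = c *: dgd (erefl (j+1)) (z S u (j + 1)) +
  dgd (erefl (j+1)) (z' S u (j + 1))); last exact: linearP.
rewrite (@removals_eq _ _ _ (fun x v => c *: face_diff z S j x v + face_diff z' S j x v));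
  last first.
  by move=> *; apply: face_diff_linear.
rewrite removalsD removalsZ !scalerDr !scalerA addrACA; congr (_ *: _ + _ + _).
by rewrite mulrC.
Qed.

Lemma cube_dd r i (z : cubefam r) : cubical i z -> cube_d (cube_d z) = 0.
Proof.
move=> cz.
apply: cubefam_ext => S u j.
rewrite [RHS](_ : _ = 0) //.
rewrite {1}/cube_d {1}/cube_d linearD linearZ /= dgdd scaler0 add0r.
rewrite (removals_linear _ _ (L := dgd (erefl (j + 1)))); last exact: linearP.
rewrite -removalsZ.
rewrite (@removals_eq _ _ (face_diff (cube_d z) S j) (fun x v => - ((-1)
  ^+ size u *: dgd (erefl (j + 1)) (face_diff z S (j + 1) x v)) + removals (fun y w =>
    (z (upd (upd S x true) y true) w j - z (upd (upd S x true) y false) w j) -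
      (z (upd (upd S x false) y true) w j - z (upd (upd S x false) y false) w j)) v)).
  rewrite removalsD removalsN addrA subrr add0r.
  apply: removals_removals => x y v.
  have [->//|xy] := eqVneq x y.
  have E b c : upd (upd S x b) y c = upd (upd S y c) x b.
    apply: functional_extensionality_dep => w; rewrite /upd.
    by case: eqP => // ->; case: eqP => // yx; rewrite yx eqxx in xy.
  by rewrite !E !opprB addrACA [in RHS]addrACA [in LHS](addrC (- _)) //.
move=> v x w E; rewrite {1}/face_diff /cube_d opprD addrACA; congr (_ + _); last first.
  by rewrite -removalsN -removalsD.
rewrite /face_diff linearB -scalerBr E !size_cat /= addnS exprS mulN1r scaleNr opprK //.
Qed.

End Cubes.

(** * Relabelling of cubical cochains *)
Section Relabelling.
Variables (k : comPzRingType) (P : operad k).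

Definition permn r (s : 'S_r) (x : nat) : nat :=
  if insub x is Some i then val (s i) else x.

Lemma permn_ord r (s : 'S_r) (i : 'I_r) : permn s i = s i.
Proof. by rewrite /permn valK. Qed.

Lemma permn_lt r (s : 'S_r) x : (x < r)%N -> (permn s x < r)%N.
Proof. by move=> xr; rewrite -[x]/(val (Ordinal xr)) permn_ord. Qed.

Lemma permnM r (s t : 'S_r) x : permn (s * t)%g x = permn t (permn s x).
Proof.
have [xr|xr] := ltnP x r.
  by rewrite -[x]/(val (Ordinal xr)) !permn_ord permM.
by rewrite /permn !insubF //; apply/negbTE; rewrite -leqNgt.
Qed.

Lemma permn1 r x : permn (1%g : 'S_r) x = x.
Proof. by rewrite /permn; case: insubP => // i _ <-; rewrite perm1. Qed.

Lemma permnK r (s : 'S_r) : cancel (permn s) (permn s^-1%g).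
Proof. by move=> x; rewrite -permnM mulgV permn1. Qed.

Lemma permnVK r (s : 'S_r) : cancel (permn s^-1%g) (permn s).
Proof. by move=> x; rewrite -permnM mulVg permn1. Qed.

Lemma permnV_lt r (s : 'S_r) x : (permn s x < r)%N = (x < r)%N.
Proof.
apply/idP/idP; last exact: permn_lt.
by move/(permn_lt (s^-1)%g); rewrite permnK.
Qed.

(** No sign occurs, the list of edge directions being relabelled entry by
    entry. *)
Definition cube_act r (s : 'S_r) (z : cubefam P r) : cubefam P r := fun S u j =>
  oact s (z (S \o permn s) (map (permn s^-1%g) u) j).

Lemma alternating_map (V : lmodType k) (F : seq nat -> V) f :
  alternating F -> alternating (fun u => F (map f u)).
Proof. by move=> [sF dF]; split=> *; rewrite !map_cat /=; [apply: sF|apply: dF]. Qed.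

Lemma alternating_linear (V W : lmodType k) (L : {linear V -> W}) F :
  alternating F -> alternating (fun u => L (F u)).
Proof.
move=> [sF dF]; split=> *; first by rewrite sF linearN.
by rewrite dF linear0.
Qed.

Lemma cubical_act r i (s : 'S_r) (z : cubefam P r) : cubical i z -> cubical i (cube_act s z).
Proof.
move=> cz; split.
- by move=> S u j h; rewrite /cube_act (cubical_deg cz) ?linear0 // size_map.
- move=> S u j h; rewrite /cube_act (cubical_range cz) ?linear0 //.
  apply: contra h => /allP h; apply/allP => x xu.
  by have := h _ (map_f _ xu); rewrite /= permnV_lt.
- move=> S S' u j h; congr (oact s _); apply: (cubical_ext cz) => x xr xu /=.
  apply: h; first by rewrite permnV_lt.
  by apply: contra xu => /(map_f (permn s^-1%g)); rewrite permnK.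
- move=> S j.
  exact: (alternating_linear (oact s) (alternating_map _ (cubical_alt cz _ _))).
Qed.

Lemma cube_act_linear r (s : 'S_r) c (z z' : cubefam P r) :
  cube_act s (c *: z + z') = c *: cube_act s z + cube_act s z'.
Proof.
by apply: cubefam_ext => S u j; apply: linearP.
Qed.

Lemma cube_act1 r (z : cubefam P r) : cube_act 1%g z = z.
Proof.
apply: cubefam_ext => S u j; rewrite /cube_act oact1 invg1.
rewrite (eq_map (@permn1 r)) map_id.
suff -> : S \o permn (1%g : 'S_r) = S by [].
by apply: functional_extensionality_dep => x /=; rewrite permn1.
Qed.

Lemma cube_actM r (s t : 'S_r) (z : cubefam P r) :
  cube_act t (cube_act s z) = cube_act (s * t)%g z.
Proof.
apply: cubefam_ext => S u j; rewrite /cube_act oactM -map_comp.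
have -> : S \o permn (s * t)%g = (S \o permn t) \o permn s.
  by apply: functional_extensionality_dep => x /=; rewrite permnM.
suff -> : map (permn (s * t)^-1%g) u = map (permn s^-1%g \o permn t^-1%g) u by [].
by apply: eq_map => x; rewrite /= invMg permnM.
Qed.

Lemma cube_d_act r (s : 'S_r) (z : cubefam P r) :
  cube_d (cube_act s z) = cube_act s (cube_d z).
Proof.
apply: cubefam_ext => S u j; rewrite /cube_d /cube_act.
rewrite linearD linearZ /= size_map oact_d; congr (_ + _).
rewrite removals_map (removals_linear _ _ (L := oact s)); last exact: linearP.
apply: removals_eq => v x w _; rewrite /face_diff linearB.
have E b : upd S x b \o permn s = upd (S \o permn s) (permn s^-1%g x) b.
  apply: functional_extensionality_dep => y; rewrite /upd /=.
  by rewrite -(can_eq (permnVK s) (permn s y)) permnK.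
by rewrite !E.
Qed.

End Relabelling.

(** * Composition of cubical cochains *)
Section Composition.
Variables (k : comPzRingType) (P : operad k).

Definition inblock a n : pred nat := fun x => (a <= x < a + n)%N.

(** The left inverse of [outer a n] which sends the inputs of the block of the
    second operation to [a]. *)
Definition collapse a n x : nat :=
  if (x < a)%N then x else if (x < a + n)%N then a else (x - n).+1.

Definition outer_set a n (v : bool) (S : nat -> bool) : nat -> bool :=
  fun c => if c == a then v else S (outer a n c).

Definition inner_set a (S : nat -> bool) : nat -> bool := fun j => S (a + j)%N.

Definition ones S a n (u : seq nat) := all (fun x => S x || (x \in u)) (iota a n).

Definition vertex S a n u := ones S a n [::] && ~~ has (inblock a n) u.
Definition edge S a n u := ones S a n u && (count (inblock a n) u == 1%N).

Definition outer_list a n u := map (collapse a n) (filter (predC (inblock a n)) u).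
Definition inner_list a n u := map (subn^~ a) (filter (inblock a n) u).

Variables (m n l : nat) (a : 'I_m) (el : l.+1 = (m + n)%N).

Definition split_term (i j : int) (f : cubefam P m) (g : cubefam P n) S u h : P l h :=
  gcomp a el (f (outer_set a n (vertex S a n u) S) (outer_list a n u))
             (g (inner_set a S) (inner_list a n u))
    (i + (size (outer_list a n u))%:Z) (j + (size (inner_list a n u))%:Z) h.

Definition edge_term (i j : int) (f : cubefam P m) (g : cubefam P n) S u h : P l h :=
  if edge S a n u then
    gcomp a el (f (outer_set a n true S) (map (collapse a n) u)) (g (fun=> true) [::])
      (i + (size u)%:Z) j h
  else 0.

(** Under the minimum map of the block, the block part [v] of a cell is sent to
    the following chain of [[0,1] x [0,1]^n].  If [v] is the vertex
    [(1, ..., 1)], this is [1 x v] ([vertex]).  Otherwise it is [0 x v], with the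
    additional term [e x (1, ..., 1)], where [e] is the edge of [[0,1]], when [v]
    is an edge adjacent to [(1, ..., 1)] ([edge]).  The first sign comes from
    moving the cochain of [g] to the front, past [f] of degree [i]; the second
    one from the shuffle which brings the directions of the block to the front. *)
Definition cube_comp (i j : int) (f : cubefam P m) (g : cubefam P n) : cubefam P l :=
  fun S u h =>
    (-1) ^+ (`|i| * size (inner_list a n u) + crossings (inblock a n) u)%N *:
      split_term i j f g S u h + edge_term i j f g S u h.

Lemma size_inner_outer u : (size (outer_list a n u) + size (inner_list a n u))%N = size u.
Proof. by rewrite !size_map !size_filter addnC count_predC. Qed.

Lemma outer_lt (c : nat) : (c < m)%N -> c != a -> (outer a n c < l)%N.
Proof. by have am := ltn_ord a; move=> cm ca; rewrite /outer; case: (ltnP c a) => *; lia. Qed.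

Lemma outer_out (c : nat) : c != a -> ~~ inblock a n (outer a n c).
Proof. by clear el; move=> ca; rewrite /inblock /outer /=; case: (ltnP c a) => *; lia. Qed.

Lemma collapse_outer (c : nat) : c != a -> collapse a n (outer a n c) = c.
Proof.
clear el; rewrite /collapse /outer => ca; case: (ltnP c a) => h; first by rewrite h.
case: ltnP => h1; first lia.
by case: ltnP => h2; lia.
Qed.

Lemma collapse_range x : (l <= x)%N -> ~~ inblock a n x /\ ~~ (collapse a n x < m)%N.
Proof.
rewrite /inblock /collapse /=; have := ltn_ord a => am h; split; first lia.
by case: (ltnP x a) => h1; last case: (ltnP x (a + n)); lia.
Qed.

(** For the range: an edge direction out of range lies after the block, so that
    its image under [collapse] is out of range as well. *)
Lemma cubical_comp i j h0 (ed : h0 = i + j) f g : cubical i f -> cubical j g ->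
  cubical h0 (cube_comp i j f g).
Proof.
move=> cf cg; split.
- move=> S u h hu; rewrite /cube_comp /split_term /edge_term.
  rewrite gcomp_deg ?scaler0 ?add0r; last first.
    apply: contraNneq hu => ->; rewrite ed -(size_inner_outer u); apply/eqP; lia.
  case: ifP => // _; rewrite gcomp_deg //.
  by apply: contraNneq hu => ->; apply/eqP; lia.
- move=> S u h /allPn[x xu xl].
  have [xo xc] := @collapse_range x ltac:(by rewrite leqNgt).
  rewrite /cube_comp /split_term /edge_term gcomp0l ?scaler0 ?add0r.
    case: ifP => // _; rewrite gcomp0l // (cubical_range cf) //.
    by apply/allPn; exists (collapse a n x) => //; apply: map_f.
  rewrite (cubical_range cf) //.
  by apply/allPn; exists (collapse a n x) => //; apply: map_f; rewrite mem_filter /= xo.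
- move=> S S' u h H.
  have al : (a + n <= l)%N by have := ltn_ord a; lia.
  have E1 : ones S a n u = ones S' a n u.
    apply: eq_in_all => x; rewrite mem_iota => /andP[xa xn].
    by case: (boolP (x \in u)) => xu; rewrite ?orbT // H //; lia.
  have E2 : vertex S a n u = vertex S' a n u.
    rewrite /vertex; case: hasPn => [hu|_]; last by rewrite !andbF.
    rewrite !andbT; apply: eq_in_all => x; rewrite mem_iota => /andP[xa xn].
    rewrite !orbF H //; first lia.
    by apply: contraL (_ : inblock a n x) => [xu|]; [apply: hu|apply/andP].
  rewrite /cube_comp /split_term /edge_term /edge E1 E2.
  have Ef v w j1 : {subset [seq x <- u | predC (inblock a n) x] <= w} ->
      f (outer_set a n v S) (map (collapse a n) w) j1 = f (outer_set a n v S')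
        (map (collapse a n) w) j1.
    move=> uw; apply: (cubical_ext cf) => c cm cu; rewrite /outer_set; case: eqP => // /eqP ca.
    apply: H; first exact: outer_lt.
    apply: contra cu => ou; apply/mapP; exists (outer a n c); last by rewrite collapse_outer.
    by apply: uw; rewrite mem_filter ou /= outer_out.
  congr (_ *: _ + _).
    apply: gcomp_eq => //; first exact: Ef.
    apply: (cubical_ext cg) => x xn xu; apply: H; first lia.
    apply: contra xu => xu; apply/mapP; exists (a + x)%N; last lia.
    by rewrite mem_filter xu andbT; apply/andP; lia.
  case: ifP => // _; apply: gcomp_eq => //; apply: Ef => x.
  by rewrite mem_filter => /andP[].
- move=> S h; apply: alternatingD.
    pose H u v := gcomp a el (f (outer_set a n (ones S a n [::] && nilp v) S) u)
      (g (inner_set a S) v) (i + (size u)%:Z) (j + (size v)%:Z) h.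
    have HE u : split_term i j f g S u h = H (outer_list a n u) (inner_list a n u).
      rewrite /H /split_term /vertex.
      by have -> : nilp (inner_list a n u) = ~~ has (inblock a n) u
        by rewrite /nilp size_map size_filter has_count lt0n negbK.
    have sH u : size (inner_list a n u) = count (inblock a n) u by rewrite size_map size_filter.
    apply: eq_alternating (@alternating_split _ _ (inblock a n)
      (collapse a n) (subn^~ a) `|i|%N H _ _) => [u|v|u] /=.
    - by rewrite HE sH.
    - pose T := outer_set a n (ones S a n [::] && nilp v) S; split=> [u x y w|u x w];
      rewrite /H -/T.
        rewrite !size_cat; apply: gcompNl.
        by case: (cubical_alt cf T (i + (size u + size (x :: y :: w))%N%:Z)) => + _; apply.
      apply: gcomp0l.
      by case: (cubical_alt cf T (i + (size (u ++ x :: x :: w))%N%:Z)) => _; apply.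
    - split=> [v x y w|v x w]; rewrite /H.
        have -> : nilp (v ++ x :: y :: w) = nilp (v ++ y :: x :: w) by rewrite /nilp !size_cat.
        rewrite !size_cat; apply: gcompNr.
        by case: (cubical_alt cg (inner_set a S) (j + (size v + size (x :: y :: w))%N%:Z)) => +
          _; apply.
      apply: gcomp0r.
      by case: (cubical_alt cg (inner_set a S) (j + (size (v ++ x :: x :: w))%N%:Z)) => _; apply.
  split=> [u x y v|u x v]; rewrite /edge_term /edge /ones.
    have -> : count (inblock a n) (u ++ x :: y :: v) = count (inblock a n) (u ++ y :: x :: v).
      by rewrite !count_cat /= (addnCA (inblock a n x)).
    have -> : all (fun z => S z || (z \in u ++ x :: y :: v)) (iota a n) =
              all (fun z => S z || (z \in u ++ y :: x :: v)) (iota a n).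
      by apply: eq_all => z; rewrite !mem_cat !inE (orbCA (z == x)).
    case: ifP => _; last by rewrite oppr0.
    rewrite !size_cat !map_cat; apply: gcompNl.
    by case: (cubical_alt cf (outer_set a n true S) (i + (size u + size (x :: y :: v))%N%:Z))
      => + _; apply.
  case: ifP => // _; rewrite map_cat; apply: gcomp0l.
  by case: (cubical_alt cf (outer_set a n true S) (i + (size (u ++ x :: x :: v))%N%:Z)) => _; apply.
Qed.

End Composition.

(** * The Leibniz rule *)
Section SortedCells.
Variables (k : comPzRingType) (P : operad k).
Notation fam r := (forall j : int, P r j).

Section TotalComposite.
Variables (m n l : nat) (a : 'I_m) (el : l.+1 = (m + n)%N).

Lemma gcomp_d (F : fam m) (G : fam n) p q h :
  dgd (erefl (h + 1)) (gcomp a el F G (p + 1) (q + 1) (h + 1)) =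
    gcomp a el (fun j => dgd (erefl (j + 1)) (F (j + 1))) G p (q + 1) h +
    koszul k (p + 1) *: gcomp a el F (fun j => dgd (erefl (j + 1)) (G (j + 1))) (p + 1) q h.
Proof.
have [E|E] := eqVneq h (p + (q + 1)); last first.
  rewrite !gcomp_deg ?linear0 ?scaler0 ?addr0 //.
  - by apply: contraNneq E => ->; apply/eqP; lia.
  - by apply: contraNneq E => E; apply/eqP; lia.
have e1 : h + 1 = (p + 1) + (q + 1) by rewrite E addrAC.
have e2 : h = (p + 1) + q by rewrite E addrA addrAC.
rewrite (gcompE _ _ _ _ e1) (gcompE _ _ _ _ E) (gcompE _ _ _ _ e2).
exact: ocomp_d.
Qed.

Lemma gcompZl (c : k) (F F' : fam m) (G : fam n) p q h : F p = c *: F' p ->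
  gcomp a el F G p q h = c *: gcomp a el F' G p q h.
Proof.
move=> E; rewrite (@gcomp_linl _ _ _ _ _ _ _ c F F' (fun=> 0)) ?addr0 //.
by rewrite (@gcomp0l _ _ _ _ _ _ _ (fun=> 0)) // addr0.
Qed.

Lemma gcompBl (F F' F'' : fam m) (G : fam n) p q h : F p = F' p - F'' p ->
  gcomp a el F G p q h = gcomp a el F' G p q h - gcomp a el F'' G p q h.
Proof.
by move=> E; rewrite (@gcomp_linl _ _ _ _ _ _ _ (-1) F F'' F') ?scaleN1r 1?addrC.
Qed.

Lemma gcompBr (F : fam m) (G G' G'' : fam n) p q h : G q = G' q - G'' q ->
  gcomp a el F G p q h = gcomp a el F G' p q h - gcomp a el F G'' p q h.
Proof.
by move=> E; rewrite (@gcomp_linr _ _ _ _ _ _ _ (-1) F G G'' G') ?scaleN1r 1?addrC.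
Qed.

Lemma gcomp_removalsl (F : nat -> seq nat -> fam m) (G : fam n) p q h u :
  gcomp a el (fun p => removals (fun x v => F x v p) u) G p q h =
  removals (fun x v => gcomp a el (F x v) G p q h) u.
Proof.
elim: u F => [|x u IH] F /=; first exact: gcomp0l.
rewrite (@gcompBl _ (F x u) (fun p => removals (fun y v => F y (x :: v) p) u)) //.
by rewrite IH.
Qed.

Lemma gcomp_removalsr (F : fam m) (G : nat -> seq nat -> fam n) p q h u :
  gcomp a el F (fun q => removals (fun x v => G x v q) u) p q h =
  removals (fun x v => gcomp a el F (G x v) p q h) u.
Proof.
elim: u G => [|x u IH] G /=; first exact: gcomp0r.
rewrite (@gcompBr _ _ (G x u) (fun p => removals (fun y v => G y (x :: v) p) u)) //.
by rewrite IH.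
Qed.

End TotalComposite.

Section Sorted.
Variables (m n l : nat) (a : 'I_m) (el : l.+1 = (m + n)%N).
Variables (i j : int) (f : cubefam P m) (g : cubefam P n).

Definition sorted_split_term S u v h : P l h :=
  gcomp a el (f (outer_set a n (ones S a n [::] && nilp u) S) (map (collapse a n) v))
     (g (inner_set a S) (map (subn^~ a) u)) (i + (size v)%:Z) (j + (size u)%:Z) h.

Definition sorted_edge_term S v h : P l h :=
  gcomp a el (f (outer_set a n true S) ((a : nat) :: map (collapse a n) v)) (g (fun=> true) [::])
    (i + (size v).+1%:Z) j h.

Lemma filter_outer u v : all (inblock a n) u -> all (predC (inblock a n)) v ->
  [seq x <- u ++ v | inblock a n x] = u /\
  [seq x <- u ++ v | predC (inblock a n) x] = v.
Proof.
move=> iu ov; rewrite !filter_cat (all_filterP iu) (all_filterP ov).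
rewrite (_ : [seq x <- v | inblock a n x] = [::]).
  rewrite (_ : [seq x <- u | predC (inblock a n) x] = [::]) ?cats0 //.
  by apply/eqP; rewrite -[_ == _]negbK -has_filter has_predC iu.
by apply/eqP; rewrite -[_ == _]negbK -has_filter -all_predC.
Qed.

(** On a cell whose block directions come first there are no crossings, and the
    edge term replaces the unique block direction by [a]. *)
Lemma cube_comp_sorted S u v h : all (inblock a n) u -> all (predC (inblock a n)) v ->
  cube_comp a el i j f g S (u ++ v) h =
    (-1) ^+ (`|i| * size u)%N *: sorted_split_term S u v h +
    if ones S a n u && (size u == 1%N) then sorted_edge_term S v h else 0.
Proof.
move=> iu ov; have [Ei Eo] := filter_outer iu ov.
rewrite /cube_comp /inner_list /split_term /outer_list /inner_list Ei Eo /vertex.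
have -> : has (inblock a n) (u ++ v) = ~~ nilp u.
  by rewrite has_count -size_filter Ei lt0n.
rewrite negbK crossings_sorted // addn0 !size_map; congr (_ *: _ + _).
rewrite /edge_term /edge -size_filter Ei.
have -> : ones S a n (u ++ v) = ones S a n u.
  apply: eq_in_all => x; rewrite mem_iota mem_cat => bx.
  case: (boolP (x \in v)) => [xv|]; last by rewrite orbF.
  by have := allP ov _ xv; rewrite /= /inblock bx.
case: ifP => // /andP[_]; case: u iu {Ei Eo} => [//|x [|//]] /= /andP[/andP[x1 x2] _] _.
by rewrite {1}/collapse ltnNge x1 /= x2.
Qed.

End Sorted.

Section Cut.
Variables (m n l : nat) (a : 'I_m) (el : l.+1 = (m + n)%N).

Lemma outer_setU x S b v : ~~ inblock a n x ->
  outer_set a n v (upd S x b) = upd (outer_set a n v S) (collapse a n x) b.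
Proof.
clear el.
move=> ox; apply: functional_extensionality_dep => c; rewrite /outer_set /upd.
have [->|ca] := eqVneq c a; last first.
  have -> // : (outer a n c == x) = (c == collapse a n x).
  apply/eqP/eqP => [<-|->]; first by rewrite collapse_outer.
  move: ox; rewrite /inblock /outer /collapse /=; case: (ltnP x a) => h1; first by rewrite h1.
  case: (ltnP x (a + n)) => h3 h2; first lia.
  by case: (ltnP _ a) => h4; lia.
suff -> : (nat_of_ord a == collapse a n x) = false by [].
move: ox; rewrite /inblock /collapse /=; case: (ltnP x a) => h1; first lia.
by case: (ltnP x (a + n)) => h3; lia.
Qed.

Lemma outer_set_in x S b v : inblock a n x -> 
  outer_set a n v (upd S x b) = outer_set a n v S.
Proof.
clear el.
move=> ix; apply: functional_extensionality_dep => c; rewrite /outer_set /upd.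
case: eqP => // /eqP ca; case: eqP => // cx.
by have := @outer_out m n a c ca; rewrite cx ix.
Qed.

Lemma onesU x S b u : ~~ inblock a n x -> ones (upd S x b) a n u = ones S a n u.
Proof.
clear el.
move=> ox; apply: eq_in_all => y; rewrite mem_iota /upd.
by case: eqP => // ->; move=> yx; rewrite /inblock yx in ox.
Qed.

Lemma inner_setU (i : int) (g : cubefam P n) x S b u q : cubical i g -> ~~ inblock a n x ->
  g (inner_set a (upd S x b)) u q = g (inner_set a S) u q.
Proof.
clear el.
move=> cg ox; apply: (cubical_ext cg) => y yn _; rewrite /inner_set /upd.
by case: eqP => // yx; move: ox; rewrite -yx /inblock; lia.
Qed.

Lemma inner_set_in x S b : inblock a n x ->
  inner_set a (upd S x b) = upd (inner_set a S) (x - a)%N b.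
Proof.
clear el.
case/andP => ax _; apply: functional_extensionality_dep => y; rewrite /inner_set /upd.
by have -> : (a + y == x)%N = (y == (x - a)%N) by apply/eqP/eqP; lia.
Qed.

End Cut.
End SortedCells.

Section LeibnizFaces.
Variables (k : comPzRingType) (P : operad k).
Variables (m n l : nat) (a : 'I_m) (el : l.+1 = (m + n)%N).
Variables (i j i' j' : int) (ei : i = i' + 1) (ej : j = j' + 1).
Variables (f : cubefam P m) (g : cubefam P n).
Hypotheses (cf : cubical i f) (cg : cubical j g).

Lemma ones_upd_true S x u : ones (upd S x true) a n u = ones S a n (x :: u).
Proof.
by apply: eq_all => y; rewrite /upd inE; case: eqP => //= _; rewrite orbT.
Qed.

Lemma ones_upd_false S x u : inblock a n x -> x \notin u -> ones (upd S x false) a n u = false.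
Proof.
move=> ix xu; apply/negbTE/allPn; exists x; first by rewrite mem_iota.
by rewrite /upd eqxx (negPf xu).
Qed.

(** A face can only be adjacent to [(1, ..., 1)] along one block direction if the
    cell has two of them.  The faces at 1 in these two directions then have the
    same image under the minimum map, and opposite signs. *)
Lemma removals_edge S u v h : all (inblock a n) u ->
  removals (fun x t =>
    (if ones (upd S x true) a n t && (size t == 1%N)
      then sorted_edge_term a el i j f g (upd S x true) v h else 0) -
    (if ones (upd S x false) a n t && (size t == 1%N)
      then sorted_edge_term a el i j f g (upd S x false) v h else 0)) u = 0.
Proof.
move=> iu.
have [su|su] := eqVneq (size u) 2%N; last first.
  apply: removals0 => u1 x u2 E.
  have -> : (size (u1 ++ u2) == 1%N) = false.
    by apply: contra_neqF su => /eqP; rewrite E !size_cat /=; lia.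
  by rewrite !andbF subrr.
case: u su iu => [|x [|y [|//]]] //= _ /and3P[ix iy _]; rewrite subr0 !andbT.
rewrite !ones_upd_true.
rewrite (_ : ones S a n [:: y; x] = ones S a n [:: x; y]); last first.
  by apply: eq_all => z; rewrite !inE (orbC (z == y)).
have [->|xy] := eqVneq x y; first by rewrite subrr.
rewrite !ones_upd_false ?inE // 1?eq_sym // /sorted_edge_term !outer_set_in //.
by rewrite subrr.
Qed.

(** The block faces of a cell are those of the second operation, with one
    exception: if the cell is an edge adjacent to [(1, ..., 1)], its face at 1 is
    the vertex [(1, ..., 1)], at which the first operation is evaluated at 1
    instead of 0 in the direction [a].  The difference is a [face_diff] of [f]. *)
Lemma removals_inner S u v h : all (inblock a n) u -> all (predC (inblock a n)) v ->
  removals (fun x t => face_diff (cube_comp a el i j f g) S h x (t ++ v)) u =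
    (if ones S a n u && (size u == 1%N) then
       gcomp a el (fun p => face_diff f (outer_set a n true S) p a (map (collapse a n) v))
         (g (fun=> true) [::]) (i + (size v)%:Z) j h else 0) +
    (-1) ^+ (`|i| + `|i| * size u)%N *:
      gcomp a el (f (outer_set a n (ones S a n [::] && nilp u) S) (map (collapse a n) v))
        (fun q => removals (face_diff g (inner_set a S) q) (map (subn^~ a) u))
        (i + (size v)%:Z) (j' + (size u)%:Z) h.
Proof.
move=> iu ov.
rewrite (@removals_eq _ _ _ (fun x t =>
  ((-1) ^+ (`|i| * size t)%N *: sorted_split_term a el i j f g (upd S x true) t v h -
   (-1) ^+ (`|i| * size t)%N *: sorted_split_term a el i j f g (upd S x false) t v h) +
   ((if ones (upd S x true) a n t && (size t == 1%N)
     then sorted_edge_term a el i j f g (upd S x true) v h else 0) -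
    (if ones (upd S x false) a n t && (size t == 1%N)
      then sorted_edge_term a el i j f g (upd S x false) v h else 0)))); last first.
  move=> u1 x u2 E; rewrite /face_diff.
  have i12 : all (inblock a n) (u1 ++ u2) by move: iu; rewrite E !all_cat /= => /and3P[-> _ ->].
  by rewrite !cube_comp_sorted // opprD addrACA.
rewrite removalsD removals_edge // addr0.
have [su|su] := leqP 2 (size u); last first.
  case: u su iu => [_ _|x [_|//]] /=; first by rewrite andbF add0r gcomp0r // scaler0.
  rewrite andbT => ix; rewrite subr0 muln0 muln1 expr0 !scale1r.
  have -> : (-1) ^+ (`|i| + `|i|)%N = 1 :> k by rewrite -(expr0 (-1)); parity.
  rewrite scale1r /sorted_split_term /= !andbT andbF addr0.
  rewrite ones_upd_true ones_upd_false // !outer_set_in // !(inner_set_in _ _ ix).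
  set G1 := g (upd _ _ true) [::]; set G0 := g (upd _ _ false) [::].
  have -> : (j' + 1%N = j)%R by rewrite ej.
  rewrite [X in _ = _ + X](@gcompBr _ _ _ _ _ _ _ _ _ G1 G0) //; last by rewrite subr0.
  case: ifP => o1; last by rewrite add0r.
  have -> : G1 = g (fun=> true) [::].
    apply: functional_extensionality_dep => q; apply: (cubical_ext cg) => y yn _.
    rewrite /upd; case: eqP => // /eqP yx; rewrite /inner_set.
    have := allP o1 (a + y)%N; rewrite mem_iota inE => /(_ ltac:(lia)) /orP[//|/eqP E].
    by case/eqP: yx; rewrite -E; lia.
  rewrite [X in _ = X + _](@gcompBl _ _ _ _ _ _ _ _ (f (outer_set a n true S)
    (map (collapse a n) v))
    (f (outer_set a n false S) (map (collapse a n) v))); last first.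
    rewrite /face_diff; congr (_ - _); [set T := upd _ _ _|set T := upd _ _ _].
      suff -> : T = outer_set a n true S by [].
      by apply: functional_extensionality_dep => c; rewrite /T /upd /outer_set; case: eqP.
    suff -> : T = outer_set a n false S by [].
    by apply: functional_extensionality_dep => c; rewrite /T /upd /outer_set; case: eqP.
  by rewrite addrA subrK.
have -> : (size u == 1%N) = false by lia.
rewrite andbF add0r (@gcomp_removalsr _ _ _ _ _ _ _ _ (fun x t q => face_diff g (inner_set a S)
  q x t)).
rewrite removals_map -removalsZ.
apply: removals_eq => u1 x u2 E; rewrite -scalerBr.
have ix : inblock a n x by move: iu; rewrite E all_cat /= => /and3P[].
have st : size u = (size (u1 ++ u2)).+1 by rewrite E !size_cat addnS.
have -> : (-1) ^+ (`|i| * size (u1 ++ u2))%N = (-1) ^+ (`|i| + `|i| * size u)%N :> k.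
  by rewrite st; parity.
congr (_ *: _); rewrite /sorted_split_term !outer_set_in // !(inner_set_in _ _ ix).
have -> : nilp (u1 ++ u2) = false by rewrite /nilp; lia.
have -> : nilp u = false by rewrite /nilp; lia.
rewrite !andbF; have -> : j' + size u = j + size (u1 ++ u2) by rewrite st; lia.
by symmetry; apply: gcompBr.
Qed.

Lemma removals_if (V : lmodType k) (e : bool) (F : nat -> seq nat -> V) u :
  removals (fun x t => if e then F x t else 0) u = if e then removals F u else 0.
Proof. by case: e => //; apply: removals0. Qed.

Lemma gcompBl_eq (F F' F'' : forall q, P m q) (G G' G'' : forall q, P n q) p q h :
  F p = F' p - F'' p -> G' q = G q -> G'' q = G q ->
  gcomp a el F G p q h = gcomp a el F' G' p q h - gcomp a el F'' G'' p q h.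
Proof.
move=> EF E1 E2; rewrite (@gcompBl _ _ _ _ _ _ _ _ F' F'') //.
by congr (_ - _); apply: gcomp_eq.
Qed.

(** Faces in the directions outside of the block are those of the first
    operation, in both terms of the composite. *)
Lemma removals_outer S u v h : all (inblock a n) u -> all (predC (inblock a n)) v ->
  removals (fun x t => face_diff (cube_comp a el i j f g) S h x (u ++ t)) v =
    (-1) ^+ (`|i| * size u)%N *:
      gcomp a el (fun p => removals (face_diff f (outer_set a n (ones S a n [::] && nilp u) S) p)
          (map (collapse a n) v))
        (g (inner_set a S) (map (subn^~ a) u)) (i' + (size v)%:Z) (j + (size u)%:Z) h +
    (if ones S a n u && (size u == 1%N) then
      gcomp a el (fun p => removals
          (fun y t => face_diff f (outer_set a n true S) p y ((a : nat) :: t))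
            (map (collapse a n) v))
        (g (fun=> true) [::]) (i' + (size v).+1%:Z) j h else 0).
Proof.
move=> iu ov; set e := _ && (size u == _).
rewrite (@gcomp_removalsl _ _ _ _ _ _ _ (fun x t p =>
  face_diff f (outer_set a n (ones S a n [::] && nilp u) S) p x t)).
rewrite (@gcomp_removalsl _ _ _ _ _ _ _ (fun x t p => face_diff f (outer_set a n true S)
  p x ((a : nat) :: t))).
rewrite !removals_map -removalsZ.
rewrite -removals_if -removalsD; apply: removals_eq => v1 x v2 E.
have ox : ~~ inblock a n x by move: ov; rewrite E all_cat /= => /and3P[].
have o12 : all (predC (inblock a n)) (v1 ++ v2).
  by move: ov; rewrite E !all_cat /= => /and3P[-> _ ->].
have st : size v = (size (v1 ++ v2)).+1 by rewrite E !size_cat addnS.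
rewrite /face_diff !cube_comp_sorted // opprD addrACA !onesU //; congr (_ + _).
  rewrite -scalerBr; congr (_ *: _); rewrite /sorted_split_term !onesU // !outer_setU //.
  have -> : i' + size v = i + size (v1 ++ v2) by rewrite st; lia.
  symmetry; apply: gcompBl_eq => //; first by apply: (inner_setU _ _ _ _ cg ox).
  by apply: (inner_setU _ _ _ _ cg ox).
rewrite -/e; case: e; last by rewrite subrr.
rewrite /sorted_edge_term !outer_setU //.
have -> : i' + (size v).+1 = i + (size (v1 ++ v2)).+1 by rewrite st; lia.
by symmetry; apply: gcompBl.
Qed.

End LeibnizFaces.

Section LeibnizRule.
Variables (k : comPzRingType) (P : operad k).

Lemma cubicalD r (i : int) (x y : cubefam P r) : cubical i x -> cubical i y -> cubical i (x + y).
Proof.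
by move=> cx cy; rewrite -[x]scale1r; apply: (submodule_lin (s := cubical_submodule P r i)).
Qed.

Lemma cubicalZ r (i : int) c (x : cubefam P r) : cubical i x -> cubical i (c *: x).
Proof.
move=> cx; rewrite -[_ *: _]addr0; apply: (submodule_lin (s := cubical_submodule P r i)) => //.
exact: submodule0.
Qed.

Lemma koszulE (i : int) : koszul k i = (-1) ^+ (absz i).
Proof. by []. Qed.

Variables (m n l : nat) (a : 'I_m) (el : l.+1 = (m + n)%N).
Variables (i j i' j' : int) (ei : i = i' + 1) (ej : j = j' + 1).
Variables (f : cubefam P m) (g : cubefam P n).
Hypotheses (cf : cubical i f) (cg : cubical j g).

Lemma gcomp_cube_dl T w (G : forall q, P n q) p q h :
  gcomp a el (cube_d f T w) G p q h =
  (-1) ^+ size w *: gcomp a el (fun p => dgd (erefl (p + 1)) (f T w (p + 1))) G p q h +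
  gcomp a el (fun p => removals (face_diff f T p) w) G p q h.
Proof. exact: gcomp_linl. Qed.

Lemma gcomp_cube_dr T w (F : forall q, P m q) p q h :
  gcomp a el F (cube_d g T w) p q h =
  (-1) ^+ size w *: gcomp a el F (fun p => dgd (erefl (p + 1)) (g T w (p + 1))) p q h +
  gcomp a el F (fun p => removals (face_diff g T p) w) p q h.
Proof. exact: gcomp_linr. Qed.

(** The exceptional face of [removals_inner] is the face in the direction [a]
    that the edge term of [cube_d f] contributes. *)
Lemma cube_comp_d :
  cube_d (cube_comp a el i j f g) =
  cube_comp a el i' j (cube_d f) g + koszul k i *: cube_comp a el i j' f (cube_d g).
Proof.
apply: cubefam_ext => S w h; move: w.
have eh : i + j = (i' + j) + 1 by rewrite ei; lia.
have e2 : i' + j = i + j' by rewrite ei ej; lia.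
have cL : cubical (i' + j) (cube_d (cube_comp a el i j f g)).
  exact: (cubical_d eh (cubical_comp _ _ erefl cf cg)).
have cR : cubical (i' + j) (cube_comp a el i' j (cube_d f) g +
  koszul k i *: cube_comp a el i j' f (cube_d g)).
  apply: cubicalD; first exact: (cubical_comp _ _ erefl (cubical_d ei cf) cg).
  by apply: cubicalZ; apply: (cubical_comp _ _ e2 cf (cubical_d ej cg)).
apply: (alt_eq (p := inblock a n) (cubical_alt cL S h) (cubical_alt cR S h)) => u v iu ov.
rewrite [RHS](_ : _ = cube_comp a el i' j (cube_d f) g S (u ++ v) h +
   koszul k i *: cube_comp a el i j' f (cube_d g) S (u ++ v) h) //.
rewrite /cube_d -/(cube_d f) -/(cube_d g) removals_cat (removals_inner el ei ej f cg S h iu ov)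
  (removals_outer el ei ej f cg S h iu ov).
rewrite !cube_comp_sorted //.
rewrite /sorted_split_term /sorted_edge_term.
rewrite !gcomp_cube_dl !gcomp_cube_dr.
set T := outer_set a n (_ && _) S; set T1 := outer_set a n true S.
set w := map (collapse a n) v; set u' := map (subn^~ a) u.
have Ei : i + size v = i' + size v + 1 by rewrite ei; lia.
have Ei1 : i + (size v).+1 = i' + (size v).+1 + 1 by rewrite ei; lia.
have Ei2 : i + size v = i' + (size v).+1 by rewrite ei; lia.
have Ej : j + size u = j' + size u + 1 by rewrite ej; lia.
rewrite linearD linearZ /= (fun_if (dgd _)) linear0.
have -> : dgd (erefl (h + 1)) (gcomp a el (f T w) (g (inner_set a S) u') (i + size v) (j +
  size u) (h + 1)) =
  gcomp a el (fun p => dgd (erefl (p + 1)) (f T w (p + 1))) (g (inner_set a S) u') (i' +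
    size v) (j + size u) h +
  koszul k (i + size v) *: gcomp a el (f T w) (fun p => dgd (erefl (p + 1)) (g (inner_set a S)
    u' (p + 1))) (i + size v) (j' + size u) h.
  by rewrite Ei Ej; apply: gcomp_d.
have -> : dgd (erefl (h + 1)) (gcomp a el (f T1 ((a : nat) :: w)) (g xpredT [::]) (i +
  (size v).+1) j (h + 1)) =
  gcomp a el (fun p => dgd (erefl (p + 1)) (f T1 ((a : nat) :: w) (p + 1))) (g xpredT [::])
    (i' + (size v).+1) j h +
  koszul k (i + (size v).+1) *: gcomp a el (f T1 ((a : nat) :: w)) (fun p => dgd (erefl (p +
    1)) (g xpredT [::] (p + 1))) (i + (size v).+1) j' h.
  by rewrite Ei1 {1 2}ej; apply: gcomp_d.
have -> : gcomp a el (fun p => face_diff f T1 p a w - removals (fun y t =>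
  face_diff f T1 p y ((a : nat) :: t)) w)
    (g xpredT [::]) (i' + (size v).+1) j h =
  gcomp a el (fun p => face_diff f T1 p a w) (g xpredT [::]) (i' + (size v).+1) j h -
  gcomp a el (fun p => removals (fun y t => face_diff f T1 p y ((a : nat) :: t)) w) (g xpredT [::])
     (i' + (size v).+1) j h by apply: gcompBl.
rewrite (@gcomp0r _ _ _ _ _ _ _ _ (fun=> 0)) // addr0 expr0 scale1r -Ei2.
rewrite !size_map size_cat !koszulE.
repeat match goal with |- context [gcomp ?a ?el ?F ?G ?p ?q ?h] =>
  let X := fresh "X" in set X := gcomp a el F G p q h; clearbody X end.
case: ifP => [/andP[_ /eqP su]|_]; rewrite ?addr0 ?add0r !(scalerDr, scalerA) -?exprD !addrA.
  rewrite [RHS](ACl (1*6*3*8*4*7*2*5)) /= -[X in _ = _ - X]scale1r -scaleNr ei su.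
  by do ![congr (_ + _)]; congr (_ *: _) => //; parity.
rewrite [RHS](ACl (1*3*4*2)) /= ei.
by do ![congr (_ + _)]; congr (_ *: _); parity.
Qed.

End LeibnizRule.

(** * Equivariance of the composition *)
Section OuterCollapse.
Variables (m n l : nat) (a : 'I_m) (el : l.+1 = (m + n)%N).

Lemma collapse_lt x : (x < l)%N -> (collapse a n x < m)%N.
Proof.
have am := ltn_ord a; rewrite /collapse => xl; case: (ltnP x a) => h; first lia.
by case: (ltnP x (a + n)) => h'; lia.
Qed.

Lemma collapse_neq x : ~~ inblock a n x -> collapse a n x != a.
Proof.
clear el l; rewrite /inblock /collapse /=; case: (ltnP x a) => h; first by move=> _; apply/eqP; lia.
by case: (ltnP x (a + n)) => h' h2; [|apply/eqP]; lia.
Qed.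

Lemma collapse_in x : inblock a n x -> collapse a n x = a.
Proof. by clear el l; case/andP => h1 h2; rewrite /collapse ltnNge h1 /= h2. Qed.

Lemma outer_collapse x : ~~ inblock a n x -> outer a n (collapse a n x) = x.
Proof.
clear el l; rewrite /inblock /collapse /outer /=; case: (ltnP x a) => h; first by rewrite h.
by case: (ltnP x (a + n)) => h' h2; [|case: (ltnP _ a)]; lia.
Qed.

End OuterCollapse.

Section Equivariance.
Variables (k : comPzRingType) (P : operad k).
Variables (m n l : nat) (a : 'I_m) (el : l.+1 = (m + n)%N).
Variables (s : 'S_m) (t : 'S_n) (rho : 'S_l) (B : block_perm a s t rho).

Lemma gcomp_act (F : forall p, P m p) (G : forall p, P n p) p q h :
  gcomp (s a) el (fun p => oact s (F p)) (fun q => oact t (G q)) p q h =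
  oact rho (gcomp a el F G p q h).
Proof.
rewrite /gcomp; case: eqP => [e|_]; last by rewrite linear0.
exact: ocomp_act.
Qed.

Lemma block_perm_in j : (j < n)%N -> permn rho (a + j) = (s a + permn t j)%N.
Proof.
move=> jn; have al : (a + j < l)%N by have := ltn_ord a; lia.
rewrite -[X in permn t X]/(val (Ordinal jn)) -[X in permn rho X]/(val (Ordinal al)) !permn_ord.
exact: B.2.
Qed.

Lemma block_perm_out c : (c < m)%N -> c != a ->
  permn rho (outer a n c) = outer (s a) n (permn s c).
Proof.
move=> cm ca; have xl : (outer a n c < l)%N by apply: outer_lt.
rewrite -[X in permn s X]/(val (Ordinal cm)) -[X in permn rho X]/(val (Ordinal xl)) !permn_ord.
exact: B.1.
Qed.

Lemma permn_neq c : (c < m)%N -> c != a -> permn s c != s a.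
Proof. by move=> _; apply: contra => /eqP; rewrite -permn_ord => /(can_inj (permnK s)) ->. Qed.

Lemma inblock_perm x : (x < l)%N -> inblock (s a) n (permn rho x) = inblock a n x.
Proof.
move=> xl; have [ix|ox] := boolP (inblock a n x).
  case/andP: ix => x1 x2; have -> : x = (a + (x - a))%N by lia.
  have jn : (x - a < n)%N by lia.
  rewrite block_perm_in // /inblock; have := permn_lt t jn; lia.
have cm := collapse_lt a el xl; have cn := collapse_neq ox.
rewrite -(outer_collapse ox) block_perm_out //.
by apply/negbTE/outer_out/permn_neq.
Qed.

Lemma collapse_perm x : (x < l)%N -> collapse (s a) n (permn rho x) = permn s (collapse a n x).
Proof.
move=> xl; have [ix|ox] := boolP (inblock a n x).
  by rewrite (collapse_in ix) permn_ord collapse_in // inblock_perm.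
have cm := collapse_lt a el xl; have cn := collapse_neq ox.
rewrite -{1}(outer_collapse ox) block_perm_out // collapse_outer //.
exact: permn_neq.
Qed.

Lemma inner_perm x : inblock a n x -> (permn rho x - s a)%N = permn t (x - a)%N.
Proof.
case/andP => x1 x2; have {1}-> : x = (a + (x - a))%N by lia.
by rewrite block_perm_in; lia.
Qed.

Lemma ones_perm S u : ones S (s a) n (map (permn rho) u) = ones (S \o permn rho) a n u.
Proof.
have inv x : inblock a n x -> inblock (s a) n (permn rho x).
  by move=> ix; rewrite inblock_perm //; case/andP: ix => *; have := ltn_ord a; lia.
apply/allP/allP => H x; rewrite mem_iota => ix.
  have /= := H (permn rho x); rewrite mem_iota => /(_ (inv _ ix)).
  by rewrite (mem_map (can_inj (permnK rho))).
have -> : x = permn rho (permn rho^-1%g x) by rewrite permnVK.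
have xl : (x < l)%N by have := ltn_ord (s a); case/andP: ix; lia.
have /= := H (permn rho^-1%g x); rewrite (mem_map (can_inj (permnK rho))); apply.
rewrite mem_iota -/(inblock a n _) -inblock_perm ?permnVK //.
exact: permn_lt.
Qed.

Lemma filter_perm u : all (gtn l) u ->
  filter (inblock (s a) n) (map (permn rho) u) = map (permn rho) (filter (inblock a n) u) /\
  filter (predC (inblock (s a) n)) (map (permn rho) u) = map (permn rho)
    (filter (predC (inblock a n)) u).
Proof.
by move=> /allP ul; rewrite !filter_map; split; congr map; apply: eq_in_filter => x /ul xl /=;
  rewrite inblock_perm.
Qed.

Lemma crossings_perm u : all (gtn l) u ->
  crossings (inblock (s a) n) (map (permn rho) u) = crossings (inblock a n) u.
Proof.
elim: u => //= x u IH /andP[xl ul]; rewrite IH // inblock_perm //; congr (_ * _ + _)%N.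
by rewrite count_map; apply: eq_in_count => y /(allP ul) yl /=; rewrite inblock_perm.
Qed.

Variables (i j : int) (f : cubefam P m) (g : cubefam P n).
Hypotheses (cf : cubical i f) (cg : cubical j g).

Lemma act_outer v S u p : all (gtn l) u ->
  cube_act s f (outer_set (s a) n v S) (map (collapse (s a) n) (map (permn rho) u)) p =
  oact s (f (outer_set a n v (S \o permn rho)) (map (collapse a n) u) p).
Proof.
move=> ul; rewrite /cube_act -!map_comp; congr (oact s _).
have -> : [seq (permn s^-1%g \o (collapse (s a) n \o permn rho)) x | x <- u] = map (collapse a n) u.
  by apply/eq_in_map => x /(allP ul) xl /=; rewrite collapse_perm // permnK.
apply: (cubical_ext cf) => c cm _; rewrite /outer_set /=.
have [->|ca] := eqVneq c a; first by rewrite permn_ord eqxx.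
by rewrite (negPf (permn_neq cm ca)) block_perm_out.
Qed.

(** A block permutation carries the block at [a] to the block at [s a], and a
    minimum is symmetric: relabellings commute with the minimum maps. *)
Lemma cube_comp_act :
  cube_comp (s a) el i j (cube_act s f) (cube_act t g) = cube_act rho (cube_comp a el i j f g).
Proof.
apply: (@cubical_eq _ _ _ (i + j)).
- by apply: cubical_comp => //; apply: cubical_act.
- by apply: cubical_act; apply: cubical_comp.
move=> S u ul; set h := (i + j + _).
set w := map (permn rho^-1%g) u.
have Eu : u = map (permn rho) w.
  by rewrite -map_comp -[LHS]map_id; apply: eq_map => x /=; rewrite permnVK.
have wl : all (gtn l) w by apply/allP => x /mapP[y /(allP ul) yl ->]; apply: permn_lt.
rewrite [RHS]/cube_act -/w /cube_comp.
rewrite linearD linearZ /= {1 2 3 4}Eu.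
have [Ei Eo] := filter_perm wl.
have El : inner_list (s a) n (map (permn rho) w) = map (permn t) (inner_list a n w).
  rewrite /inner_list Ei -!map_comp; apply/eq_in_map => x /=.
  by rewrite mem_filter => /andP[ix _]; rewrite inner_perm.
have Eh : has (inblock (s a) n) (map (permn rho) w) = has (inblock a n) w.
  by rewrite !has_filter Ei; case: (filter _ w).
rewrite crossings_perm // El size_map; congr (_ *: _ + _).
  rewrite /split_term -gcomp_act /vertex El Eh -[[::]]/(map (permn rho) [::]) ones_perm.
  rewrite !size_map Eo !size_map; apply: gcomp_eq => //.
    rewrite /outer_list Eo act_outer //.
    by apply/allP => x; rewrite mem_filter => /andP[_ /(allP wl)].
  rewrite /cube_act -map_comp; congr (oact t _).
  rewrite (eq_map (permnK t)) map_id; apply: (cubical_ext cg) => y yn _.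
  by rewrite /inner_set /= block_perm_in.
rewrite /edge_term /edge ones_perm -!size_filter Ei size_map; case: ifP => _;
  last by rewrite linear0.
rewrite -gcomp_act size_map; apply: gcomp_eq => //; exact: act_outer.
Qed.

End Equivariance.

(** * Constant cochains and the unit *)
Section Constants.
Variables (k : comPzRingType) (P : operad k).

Definition single r i (p : P r i) (j : int) : P r j :=
  match i =P j with
  | ReflectT e => ecast j (P r j) e p
  | ReflectF _ => 0
  end.

Lemma singleE r i (p : P r i) : single p i = p.
Proof. by rewrite /single; case: eqP => // e; rewrite (eq_irrelevance e erefl). Qed.

Lemma single_deg r i (p : P r i) j : j != i -> single p j = 0.
Proof. by rewrite /single eq_sym; case: eqP. Qed.

Lemma single_linear r i (c : k) (p q : P r i) j :
  single (c *: p + q) j = c *: single p j + single q j.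
Proof. by rewrite /single; case: eqP => [e|_]; [case: j / e|rewrite scaler0 addr0]. Qed.

Definition cube_const r i (p : P r i) : cubefam P r :=
  fun S u j => if nilp u then single p j else 0.

Lemma cubical_const r i (p : P r i) : cubical i (cube_const p).
Proof.
split; rewrite /cube_const.
- move=> S u j h; case: nilP => // E; apply: single_deg.
  by move: h; rewrite E addr0.
- by move=> S [|x u].
- by [].
- by move=> S j; split=> [[|z u] x y v|[|z u] x v] //=; rewrite oppr0.
Qed.

Lemma cube_const_linear r i (c : k) (p q : P r i) :
  cube_const (c *: p + q) = c *: cube_const p + cube_const q.
Proof.
apply: cubefam_ext => S u j.
rewrite [RHS](_ : _ = c *: cube_const p S u j + cube_const q S u j) // /cube_const.
by case: ifP => _; [exact: single_linear|rewrite scaler0 addr0].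
Qed.

Lemma cube_const_act r i (s : 'S_r) (p : P r i) :
  cube_const (oact s p) = cube_act s (cube_const p).
Proof.
apply: cubefam_ext => S u j; rewrite /cube_act /cube_const /nilp size_map.
case: ifP => _; last by rewrite linear0.
by rewrite /single; case: eqP => [e|_]; [case: j / e|rewrite linear0].
Qed.

Lemma cube_const_d r i j (e : i = j + 1) (p : P r i) :
  cube_const (dgd e p) = cube_d (cube_const p).
Proof.
apply: cubefam_ext => S u q; rewrite /cube_d.
rewrite removals0 ?addr0; last by move=> v x w _; rewrite /face_diff /cube_const subrr.
rewrite /cube_const; case: nilP => [->|_]; last by rewrite linear0 scaler0.
rewrite /= expr0 scale1r; have [->|qj] := eqVneq q j.
  by subst i; rewrite !singleE.
rewrite single_deg // single_deg ?linear0 //.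
by apply: contraNneq qj => qi; apply/eqP; lia.
Qed.

Section Comp.
Variables (m n l : nat) (a : 'I_m) (el : l.+1 = (m + n)%N).

Lemma cube_const_comp i j h (ed : h = i + j) (p : P m i) (q : P n j) :
  cube_const (ocomp a el ed p q) = cube_comp a el i j (cube_const p) (cube_const q).
Proof.
apply: cubefam_ext => S u h'; rewrite /cube_comp /split_term /edge_term.
rewrite {1}/cube_const; case: nilP => [->|nu].
  rewrite /edge /= andbF addr0 muln0 expr0 scale1r.
  rewrite -[outer_list a n [::]]/[::] -[inner_list a n [::]]/[::] !addr0.
  have [->|hh] := eqVneq h' h; first by rewrite (gcompE _ _ _ _ ed) /cube_const /= !singleE.
  by rewrite single_deg // gcomp_deg // -ed.
rewrite [X in if _ then X else _]gcomp0l ?if_same ?addr0; last by rewrite /cube_const; case: u nu.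
have := size_inner_outer n a u; case E1: (outer_list a n u) => [|x v]; last first.
  by rewrite [X in _ *: X]gcomp0l ?scaler0.
case E2: (inner_list a n u) => [|x v]; last by rewrite [X in _ *: X]gcomp0r ?scaler0.
by move/esym/size0nil.
Qed.

Lemma cube_comp_inner (i : int) (j : int) (f : cubefam P m) (g : cubefam P n) S u h :
  all (inblock a n) u ->
  cube_comp a el i j f g S u h = (-1) ^+ (`|i| * size u)%N *: sorted_split_term a el i j f g S
    u [::] h +
    if ones S a n u && (size u == 1%N) then sorted_edge_term a el i j f g S [::] h else 0.
Proof. by move=> iu; rewrite -[u in LHS]cats0 cube_comp_sorted. Qed.

End Comp.

Lemma cube_comp1l n j (el : n.+1 = (1 + n)%N) (g : cubefam P n) : cubical j g ->
  cube_comp ord0 el 0 j (cube_const (ounit P)) g = g.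
Proof.
move=> cg; apply: (@cubical_eq _ _ _ j) => //.
  by apply: cubical_comp cg; [rewrite add0r|exact: cubical_const].
move=> S u un; rewrite cube_comp_inner; last first.
  by apply/allP => x /(allP un) /= xn; rewrite /inblock.
rewrite mul0n expr0 scale1r /sorted_edge_term gcomp0l // if_same addr0 /sorted_split_term /=.
rewrite add0r (gcompE _ _ _ _ (esym (add0r _))) /cube_const /= singleE ocomp1l.
rewrite (_ : inner_set _ S = S) // (_ : map _ u = u) //.
by rewrite -[RHS]map_id; apply: eq_map => x; rewrite subn0.
Qed.

(** The minimum of a block of one coordinate is this coordinate: the cases of a
    vertex and of an edge in this direction are taken care of by the two terms of
    the composite. *)
Lemma cube_comp1r m (a : 'I_m) i (el : m.+1 = (m + 1)%N) (f : cubefam P m) : cubical i f ->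
  cube_comp a el i 0 f (cube_const (ounit P)) = f.
Proof.
move=> cf.
apply: cubefam_ext => S w h; move: w.
have cL := cubical_comp a el (esym (addr0 i)) cf (cubical_const (ounit P)).
apply: (alt_eq (p := inblock a 1) (cubical_alt cL S h) (cubical_alt cf S h)) => u v iu ov.
rewrite cube_comp_sorted //.
have [hE|hN] := eqVneq h (i + (size (u ++ v))%:Z); last first.
  rewrite (cubical_deg cf) // /sorted_split_term /sorted_edge_term.
  rewrite [X in _ *: X](gcomp_deg); last by apply: contraNneq hN => ->; apply/eqP;
    rewrite size_cat; lia.
  rewrite scaler0 add0r; case: ifP => // /andP[_ /eqP su]; apply: gcomp_deg.
  by apply: contraNneq hN => ->; apply/eqP; rewrite size_cat su; lia.
have ina x : inblock a 1 x -> x = a by rewrite /inblock; lia.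
have Ecol : map (collapse a 1) v = v.
  rewrite -[RHS]map_id; apply: eq_map => x; rewrite /collapse.
  by case: (ltnP x a) => // h1; case: (ltnP x (a + 1)) => h2; lia.
have Eout b : b = S a -> outer_set a 1 b S = S.
  move=> ->; apply: functional_extensionality_dep => c; rewrite /outer_set /outer.
  by case: eqP => [->//|_]; rewrite addn1 /= if_same.
case: u iu hE => [_|x [|y u]] /=.
- move=> hE; rewrite andbF addr0 muln0 expr0 scale1r /sorted_split_term /= !addr0 Ecol.
  rewrite hE (gcompE _ _ _ _ (esym (addr0 (i + (size v)%:Z))))
    /cube_const /= singleE ocomp1r Eout //.
  by rewrite /ones /= orbF andbT andbT.
- rewrite andbT => ix hE; rewrite (ina _ ix) /sorted_split_term gcomp0r // scaler0 add0r.
  rewrite /ones /= inE eqxx orbT /= /sorted_edge_term Ecol.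
  rewrite -hE (gcompE _ _ _ _ (esym (addr0 h))) /cube_const /= singleE ocomp1r.
  apply: (cubical_ext cf) => c _; rewrite inE negb_or => /andP[ca _].
  by rewrite /outer_set (negPf ca) /outer addn1 /= if_same.
- case/and3P => /ina -> /ina -> _ _; rewrite andbF addr0 /sorted_split_term gcomp0r //.
  by rewrite scaler0; case: (cubical_alt cf S h) => _ /(_ [::]) /= ->.
Qed.

End Constants.

(** * Associativity of the composition *)
Section CompositeSorted.
Variables (k : comPzRingType) (P : operad k).
Variables (m n l : nat) (a : 'I_m) (el : l.+1 = (m + n)%N).
Variables (i j : int) (f : cubefam P m) (g : cubefam P n).

Lemma gcomp_compl n' l' (c : 'I_l) (el' : l'.+1 = (l + n')%N) (G : forall q, P n' q)
    S u v p q h : all (inblock a n) u -> all (predC (inblock a n)) v ->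
  gcomp c el' (cube_comp a el i j f g S (u ++ v)) G p q h =
  (-1) ^+ (`|i| * size u)%N *: gcomp c el' (sorted_split_term a el i j f g S u v) G p q h +
  if ones S a n u && (size u == 1%N) then
    gcomp c el' (sorted_edge_term a el i j f g S v) G p q h else 0.
Proof.
move=> iu ov; rewrite (@gcomp_linl _ _ _ _ _ c el' _ _ (sorted_split_term a el i j f g S u v)
  (fun p => if ones S a n u && (size u == 1%N) then sorted_edge_term a el i j f g S v p else 0)
    _ _ _ _
  (cube_comp_sorted _ _ _ _ _ _ _ iu ov)).
by case: ifP => // _; rewrite [X in _ + X = _](@gcomp0l _ _ _ _ _ _ _ (fun=> 0)).
Qed.

Lemma gcomp_compr m' l' (c : 'I_m') (el' : l'.+1 = (m' + l)%N) (F : forall q, P m' q)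
    S u v p q h : all (inblock a n) u -> all (predC (inblock a n)) v ->
  gcomp c el' F (cube_comp a el i j f g S (u ++ v)) p q h =
  (-1) ^+ (`|i| * size u)%N *: gcomp c el' F (sorted_split_term a el i j f g S u v) p q h +
  if ones S a n u && (size u == 1%N) then
    gcomp c el' F (sorted_edge_term a el i j f g S v) p q h else 0.
Proof.
move=> iu ov; rewrite (@gcomp_linr _ _ _ _ _ c el' _ F _ (sorted_split_term a el i j f g S u v)
  (fun p => if ones S a n u && (size u == 1%N) then sorted_edge_term a el i j f g S v p else 0)
    _ _ _
  (cube_comp_sorted _ _ _ _ _ _ _ iu ov)).
by case: ifP => // _; rewrite [X in _ + X = _](@gcomp0r _ _ _ _ _ _ _ _ (fun=> 0)).
Qed.

End CompositeSorted.

Section Associativity.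
Variables (k : comPzRingType) (P : operad k).
Variables (m n n' l1 l2 l : nat) (a : 'I_m) (b : 'I_n) (ab : 'I_l1).
Variables (el1 : l1.+1 = (m + n)%N) (el2 : l2.+1 = (n + n')%N).
Variables (el1' : l.+1 = (l1 + n')%N) (el2' : l.+1 = (m + l2)%N).
Hypothesis Eab : ab = inner a b :> nat.

Lemma gcompA (F : forall p, P m p) (G : forall p, P n p) (H : forall p, P n' p)
    p q r p1 q1 h : p1 = p + q -> q1 = q + r ->
  gcomp ab el1' (gcomp a el1 F G p q) H p1 r h =
  gcomp a el2' F (gcomp b el2 G H q r) p q1 h.
Proof.
move=> ep eq; have [E|E] := eqVneq h (p + q + r); last first.
  by rewrite !gcomp_deg // ?eq ?ep // addrA.
have e1 : h = p1 + r by rewrite ep.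
have e2 : h = p + q1 by rewrite eq addrA.
rewrite (gcompE _ _ _ _ e1) (gcompE _ _ _ _ e2) (gcompE _ _ _ _ ep) (gcompE _ _ _ _ eq).
exact: ocompA.
Qed.

Lemma collapseA x : collapse a n (collapse ab n' x) = collapse a l2 x.
Proof.
have bn := ltn_ord b; have := Eab; rewrite /inner /collapse => ->.
case: (ltnP x (a + b)) => h1.
  case: (ltnP x a) => h2 //; case: (ltnP x (a + n)) => h3; last by lia.
  by case: (ltnP x (a + l2)) => // h4; lia.
case: (ltnP x (a + b + n')) => h2.
  have -> : (a + b < a)%N = false by lia.
  have -> : (a + b < a + n)%N by lia.
  have -> : (x < a)%N = false by lia.
  by have -> : (x < a + l2)%N by lia.
have -> : ((x - n').+1 < a)%N = false by lia.
have -> : (x < a)%N = false by lia.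
case: (ltnP x (a + l2)) => h3; first by have -> : ((x - n').+1 < a + n)%N by lia.
have -> : ((x - n').+1 < a + n)%N = false by lia.
by lia.
Qed.

Lemma collapse_sub x : (a <= x)%N -> (collapse ab n' x - a)%N = collapse b n' (x - a).
Proof.
have := Eab; rewrite /inner /collapse => -> ax.
have -> : (x - a < b)%N = (x < a + b)%N by lia.
have -> : (x - a < b + n')%N = (x < a + b + n')%N by lia.
by case: ifP => h1 //; case: ifP => h2; lia.
Qed.

Lemma outerA c : c != a :> nat -> outer ab n' (outer a n c) = outer a l2 c /\ outer a n c != ab.
Proof.
have bn := ltn_ord b; have := Eab; rewrite /inner /outer => -> ca.
case: (ltnP c a) => h1.
  have -> : (c < a + b)%N by lia.
  by split=> //; apply/eqP; lia.
have -> : ((c + n).-1 < a + b)%N = false by lia.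
by split; [|apply/eqP]; lia.
Qed.

Lemma outer_setA v w S : outer_set a n v (outer_set ab n' w S) = outer_set a l2 v S.
Proof.
apply: functional_extensionality_dep => c; rewrite /outer_set; case: eqP => // /eqP ca.
by have [-> /negPf ->] := outerA ca.
Qed.

Lemma inner_outerA w S : inner_set a (outer_set ab n' w S) = outer_set b n' w (inner_set a S).
Proof.
apply: functional_extensionality_dep => c; rewrite /inner_set /outer_set Eab /inner eqn_add2l.
case: eqP => // cb; congr S; rewrite /outer ltn_add2l; case: ifP => // cb'.
by lia.
Qed.

Lemma inner_setA S : inner_set ab S = inner_set b (inner_set a S).
Proof. by apply: functional_extensionality_dep => c; rewrite /inner_set Eab /inner addnA. Qed.

Lemma ones_inner S u : all (inblock ab n') u ->
  ones (inner_set a S) b n' (map (subn^~ a) u) = ones S ab n' u.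
Proof.
move=> iu; have := Eab; rewrite /inner => E; apply/allP/allP => H x; rewrite mem_iota => ix.
  have := H (x - a)%N; rewrite mem_iota /inner_set => /(_ ltac:(lia)).
  have -> : (a + (x - a) = x)%N by lia.
  case/orP => [->//|/mapP[y yu xy]]; suff -> : x = y by rewrite yu orbT.
  by have := allP iu _ yu; rewrite /inblock; lia.
rewrite /inner_set; have := H (a + x)%N; rewrite mem_iota => /(_ ltac:(lia)).
case/orP => [->//|xu]; apply/orP; right; apply/mapP; exists (a + x)%N => //; lia.
Qed.

(** A minimum of minima is 1 if and only if all the coordinates are 1. *)
Lemma ones_cat S u v : all (inblock ab n') u -> all (predC (inblock ab n')) v ->
  ones S a l2 (u ++ v) = ones S ab n' u && ones (outer_set ab n' true S)
    a n (map (collapse ab n') v).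
Proof.
move=> iu ov; have E := Eab; rewrite /inner in E; have bn := ltn_ord b.
apply/allP/andP => [H|[/allP H1 /allP H2] x]; last first.
  rewrite mem_iota => ix; rewrite mem_cat.
  have [xb|xb] := boolP (inblock ab n' x).
    have := H1 x; rewrite mem_iota => /(_ xb) /orP[->//|->]; by rewrite orbT.
  have cx : (a <= collapse ab n' x < a + n)%N.
    move: xb; rewrite /inblock /collapse; case: (ltnP x ab) => h1; first lia.
    by case: (ltnP x (ab + n')); lia.
  have := H2 (collapse ab n' x); rewrite mem_iota => /(_ cx).
  rewrite /outer_set (negPf (collapse_neq xb)) outer_collapse // => /orP[->//|/mapP[y yv xy]].
  suff -> : x = y by rewrite yv !orbT.
  have yb := allP ov _ yv.
  by rewrite -(outer_collapse xb) xy outer_collapse.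
split; apply/allP => x; rewrite mem_iota => ix.
  have := H x; rewrite mem_iota mem_cat => /(_ ltac:(lia)) /or3P[->//|->|xv]; first by rewrite orbT.
  by have := allP ov _ xv; rewrite /= /inblock ix.
rewrite /outer_set; have [//|xab] := eqVneq x ab.
have ob : ~~ inblock ab n' (outer ab n' x) by apply: outer_out.
have ca : (a <= outer ab n' x < a + l2)%N.
  by rewrite /outer; case: (ltnP x ab) => h1; lia.
have := H (outer ab n' x); rewrite mem_iota mem_cat => /(_ ca) /or3P[->//|xu|xv].
  by rewrite (allP iu _ xu) in ob.
by apply/orP; right; apply/mapP; exists (outer ab n' x) => //; rewrite collapse_outer.
Qed.

Lemma ones_outer S w v : ones (outer_set ab n' w S) a n v = ones (outer_set ab n' true S)
  a n v && (w || (nat_of_ord ab \in v)).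
Proof.
have E := Eab; rewrite /inner in E; have bn := ltn_ord b.
apply/allP/andP => [H|[/allP H1 H2] x ix].
  split; last by have := H ab; rewrite mem_iota /outer_set eqxx; apply; lia.
  by apply/allP => x /H; rewrite /outer_set; case: eqP => // _ _; rewrite orTb.
have := H1 x ix; rewrite /outer_set; case: eqP => // -> _; exact: H2.
Qed.

Variables (i j j' : int) (f : cubefam P m) (g : cubefam P n) (q : cubefam P n').
Hypotheses (cf : cubical i f) (cg : cubical j g) (cq : cubical j' q).

Lemma collapse_inblock x : inblock a l2 x -> inblock a n (collapse ab n' x).
Proof.
have E := Eab; rewrite /inner in E; have bn := ltn_ord b.
case/andP => h1 h2; rewrite /inblock /collapse; case: (ltnP x ab) => h3; first lia.
by case: (ltnP x (ab + n')); lia.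
Qed.

Lemma collapse_outblock x : ~~ inblock a l2 x -> ~~ inblock a n (collapse ab n' x)
  /\ ~~ inblock ab n' x.
Proof.
have E := Eab; rewrite /inner in E; have bn := ltn_ord b.
rewrite /inblock /collapse => h; split; last lia.
case: (ltnP x ab) => h1; first lia.
by case: (ltnP x (ab + n')); lia.
Qed.

(** On a cell with directions [w1] in the innermost block, [w2] in the rest of
    the middle block and [w3] elsewhere, the left-hand side has four terms: each
    of its two composites contributes by its split or by its edge term.  The
    right-hand side has three, because the edge term of its outer composite
    evaluates the inner one at [(1, ..., 1)].  The terms in which [f] is evaluated
    on a vertex in the direction [a] correspond to each other.  In the two other
    terms of the left-hand side, the only direction of the large block lies
    inside, respectively outside, of the innermost block, and together they give
    the remaining term of the right-hand side. *)
Lemma cube_compA :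
  cube_comp ab el1' (i + j) j' (cube_comp a el1 i j f g) q =
  cube_comp a el2' i (j + j') f (cube_comp b el2 j j' g q).
Proof.
apply: cubefam_ext => S w h; move: w.
have cL := cubical_comp ab el1' erefl (cubical_comp a el1 erefl cf cg) cq.
have cR := cubical_comp a el2' (esym (addrA i j j')) cf (cubical_comp b el2 erefl cg cq).
apply: (alt_eq3 (p := inblock a l2) (q := inblock ab n') (cubical_alt cL S h) (cubical_alt cR S h)).
move=> w1 w2 w3 i1 i1' i2 o2 o3.
have E := Eab; rewrite /inner in E.
have o3' : all (predC (inblock ab n')) w3.
  by apply: sub_all o3 => x /= /collapse_outblock [].
have i2' : all (inblock a n) (map (collapse ab n') w2).
  by rewrite all_map; apply: sub_all i2 => x /= /collapse_inblock.
have o3'' : all (predC (inblock a n)) (map (collapse ab n') w3).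
  by rewrite all_map; apply: sub_all o3 => x /= /collapse_outblock [].
have bn := ltn_ord b.
have iab : inblock a n ab by rewrite /inblock E; clear -bn; lia.
have j1 : all (inblock b n') (map (subn^~ a) w1).
  rewrite all_map; apply: sub_all i1' => x /=; rewrite /inblock E; clear; lia.
have p2 : all (predC (inblock b n')) (map (subn^~ a) w2).
  rewrite all_map; apply/allP => x xw; have := allP i2 _ xw; have := allP o2 _ xw.
  by rewrite /= /inblock E; clear; lia.
rewrite cube_comp_sorted //; last by rewrite all_cat o2.
rewrite catA cube_comp_sorted //; last by rewrite all_cat i1.
rewrite /sorted_split_term /sorted_edge_term !map_cat -(cat_cons _ _ (map _ w3)).
rewrite !gcomp_compl //=; last by rewrite iab.
rewrite gcomp_compr // -[[::] in X in _ = _ + X]/([::] ++ [::]).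
rewrite ones_inner // ones_cat // !size_map.
have H3 : map (collapse a n) (map (collapse ab n') w3) = map (collapse a l2) w3.
  by rewrite -map_comp; apply: eq_map => x; rewrite /= collapseA.
have H2 : map (subn^~ a) (map (collapse ab n') w2) = map (collapse b n') (map (subn^~ a) w2).
  rewrite -!map_comp; apply/eq_in_map => x xw /=; rewrite collapse_sub //.
  by have := allP i2 _ xw; case/andP.
have H1 : map (subn^~ ab) w1 = map (subn^~ b) (map (subn^~ a) w1).
  by rewrite -map_comp; apply: eq_map => x /=; rewrite E subnDA.
rewrite H1 inner_setA.
have Ev : ones S a l2 [::] = ones S ab n' [::] && ones (outer_set ab n' true S) a n [::].
  exact: (@ones_cat S [::] [::]).
have EAA : gcomp ab el1'
     (sorted_split_term a el1 i j f g
        (outer_set ab n' (ones S ab n' [::] && nilp w1) S)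
        (map (collapse ab n') w2) (map (collapse ab n') w3))
     (q (inner_set b (inner_set a S)) (map (subn^~ b) (map (subn^~ a) w1)))
     (i + j + size (w2 ++ w3)) (j' + size w1) h =
   gcomp a el2'
     (f (outer_set a l2 (ones S a l2 [::] && nilp (w1 ++ w2)) S)
        (map (collapse a l2) w3))
     (sorted_split_term b el2 j j' g q (inner_set a S)
        (map (subn^~ a) w1) (map (subn^~ a) w2))
     (i + size w3) (j + j' + size (w1 ++ w2)) h.
  rewrite (gcompA _ _ _ (q1 := j + j' + size (w1 ++ w2))); first last.
  - by rewrite !size_map size_cat; clear; lia.
  - by rewrite !size_map size_cat; clear; lia.
  rewrite H3 H2 outer_setA inner_outerA /sorted_split_term !size_map.
  rewrite ones_outer orbF Ev /nilp !size_map size_cat addn_eq0 (ones_inner S (u := [::])) //.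
  by rewrite (andbCA (ones (outer_set _ _ _ _) _ _ _)) !andbA.
have EBA : ones S ab n' w1 && (size w1 == 1%N) -> gcomp ab el1'
      (sorted_split_term a el1 i j f g (outer_set ab n' true S)
         ((ab : nat) :: map (collapse ab n') w2) (map (collapse ab n') w3))
      (q xpredT [::]) (i + j + (size (w2 ++ w3)).+1) j' h =
     gcomp a el2'
       (f (outer_set a l2 (ones S a l2 [::] && nilp (w1 ++ w2)) S)
          (map (collapse a l2) w3))
       (sorted_edge_term b el2 j j' g q (inner_set a S) (map (subn^~ a) w2))
       (i + size w3) (j + j' + size (w1 ++ w2)) h.
  case/andP => _ /eqP s1.
  rewrite (gcompA _ _ _ (q1 := j + j' + size (w1 ++ w2))); first last.
  - by rewrite /= !size_map size_cat s1; clear; lia.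
  - by rewrite /= !size_map size_cat; clear; lia.
  rewrite /= H3 H2 outer_setA inner_outerA /sorted_edge_term !size_map.
  have -> : (ab - a)%N = b by rewrite E addKn.
  by rewrite andbF /nilp size_cat s1 andbF.
have ELB w : gcomp ab el1'
      (sorted_edge_term a el1 i j f g (outer_set ab n' w S) (map (collapse ab n') w3))
      (q (fun=> true) [::]) (i + j + (size w3).+1) j' h =
    gcomp a el2'
      (f (outer_set a l2 true S) ((a : nat) :: map (collapse a l2) w3))
      (cube_comp b el2 j j' g q (fun=> true) ([::] ++ [::]))
      (i + (size w3).+1) (j + j') h.
  rewrite gcomp_compr // andbF addr0 muln0 expr0 scale1r.
  rewrite (gcompA _ _ _ (q1 := j + j')); first last.
  - by [].
  - by rewrite size_map; clear; lia.
  rewrite H3 outer_setA /sorted_split_term /= !addr0 !size_map.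
  have -> : outer_set b n' (ones (fun=> true) b n' [::] && true) (fun=> true) = fun=> true.
    apply: functional_extensionality_dep => c; rewrite /outer_set.
    by case: eqP => // _; rewrite andbT; apply/allP.
  by [].
have nab : nat_of_ord ab \notin map (collapse ab n') w2.
  apply/mapP => -[x xw ex]; have /= := allP o2 _ xw.
  by move/collapse_neq; rewrite -ex eqxx.
rewrite EAA !scalerDr !scalerA.
have -> : (-1) ^+ (`|i + j| * size w1) * (-1) ^+ (`|i| * size w2) =
   (-1) ^+ (`|i| * size (w1 ++ w2)) * (-1) ^+ (`|j| * size w1) :> k.
  by rewrite -!exprD size_cat; parity.
rewrite -[LHS]addrA -[RHS]addrA; congr (_ + _).
rewrite ones_outer (negPf nab) orbF.
move: EBA; case: w1 {EAA H1 i1 i1' j1} => [_|x w1 EBA].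
  rewrite !andbF !addr0 /= !muln0 expr0 scale1r scaler0 add0r andbT.
  rewrite (andbC (ones (outer_set _ _ _ _) _ _ _)) ?andbA.
  case: ifP => // /andP[/andP[O1 _] /eqP s2].
  have -> : q (inner_set b (inner_set a S)) [::] = q (fun=> true) [::].
    apply: functional_extensionality_dep => p; apply: (cubical_ext cq) => y yn _.
    have := allP O1 (ab + y)%N; rewrite mem_iota orbF => <-; last by move: yn; clear; lia.
    by rewrite /inner_set E addnA.
  by rewrite size_cat s2 add1n; exact: ELB.
rewrite !andbF /= scaler0 add0r.
case: ifP => [e1|ne1].
  have /andP[O1 /eqP[s1]] := e1; rewrite EBA // O1 /=.
  rewrite (size0nil s1) /=; congr (_ + _); first by rewrite andbF.
  have [->|nw2] := eqVneq w2 [::]; last by rewrite eqSS size_eq0 (negPf nw2) !andbF.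
  rewrite (_ : ones _ a n [:: (ab : nat)] = ones (outer_set ab n' true S) a n [::]).
    by case: ifP => // _; exact: ELB.
  apply: eq_all => y; rewrite inE orbF /outer_set; case: eqP => //= _; exact: orbF.
rewrite scaler0 add0r; case: ifP => // /andP[/andP[O1 _]].
by move: ne1; rewrite O1 /= size_cat eqSS; case: (size w1) => // _; rewrite eqSS.
Qed.

End Associativity.

(** * Commutation of composites at distinct inputs *)
Section Commutation.
Variables (k : comPzRingType) (P : operad k).
Variables (m n n' l1 l2 l : nat) (a b : 'I_m) (b' : 'I_l1) (a' : 'I_l2).
Variables (el1 : l1.+1 = (m + n)%N) (el2 : l2.+1 = (m + n')%N).
Variables (el1' : l.+1 = (l1 + n')%N) (el2' : l.+1 = (l2 + n)%N).
Hypotheses (ab : (a < b)%N) (Eb : b' = outer a n b :> nat) (Ea : a' = outer b n' a :> nat).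

Lemma gcompAC (F : forall p, P m p) (G : forall p, P n p) (H : forall p, P n' p)
    p q r p1 p2 h : p1 = p + q -> p2 = p + r ->
  gcomp b' el1' (gcomp a el1 F G p q) H p1 r h =
  (-1) ^+ (`|q| * `|r|)%N *: gcomp a' el2' (gcomp b el2 F H p r) G p2 q h.
Proof.
move=> e1 e2; have [E|E] := eqVneq h (p + q + r); last first.
  rewrite !gcomp_deg ?scaler0 // ?e1 // e2; apply: contraNneq E => ->; apply/eqP; clear; lia.
have e3 : h = p1 + r by rewrite e1.
have e4 : h = p2 + q by rewrite e2 E addrAC.
rewrite (gcompE _ _ _ _ e3) (gcompE _ _ _ _ e4) (gcompE _ _ _ _ e1) (gcompE _ _ _ _ e2).
exact: ocompAC.
Qed.

Lemma Ea' : a' = a :> nat.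
Proof. by rewrite Ea /outer ab. Qed.

Lemma Eb' : b' = (b + n).-1 :> nat.
Proof. by rewrite Eb /outer ltnNge (ltnW ab). Qed.

Lemma outer_setAC v w S :
  outer_set a n v (outer_set b' n' w S) = outer_set b n' w (outer_set a n v S).
Proof.
have E := Eb'; apply: functional_extensionality_dep => c; rewrite /outer_set.
have [->|ca] := eqVneq c a.
  have -> : (nat_of_ord a == b) = false by move: ab; clear; lia.
  by rewrite {1}/outer ab eqxx.
have [->|cb] := eqVneq c b; first by rewrite -Eb eqxx.
have -> : (outer a n c == b') = false.
  by apply/negbTE; move: ab ca cb; rewrite E /outer; clear; case: (ltnP c a); lia.
have -> : (outer b n' c == a) = false.
  by apply/negbTE; move: ab ca cb; rewrite /outer; clear; case: (ltnP c b); lia.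
congr S; move: ab ca cb; rewrite /outer E; clear.
case: (ltnP c a) => h1 h2 h3 h4.
  have -> : (c < (b + n).-1)%N by lia.
  have -> : (c < b)%N by lia.
  by rewrite h1.
case: (ltnP c b) => h5.
  have -> : ((c + n).-1 < (b + n).-1)%N by lia.
  by have -> : (c < a)%N = false by lia.
have -> : ((c + n).-1 < (b + n).-1)%N = false by lia.
have -> : ((c + n').-1 < a)%N = false by lia.
by lia.
Qed.

Lemma collapseAC x : collapse a n (collapse b' n' x) = collapse b n' (collapse a n x).
Proof.
move: ab; rewrite /collapse Eb'; clear => ab.
case: (ltnP x (b + n).-1) => h1.
  case: (ltnP x a) => h2; first by have -> : (x < b)%N by lia.
  case: (ltnP x (a + n)) => h3; first by rewrite ab.
  by have -> : ((x - n).+1 < b)%N by lia.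
have -> : (x < a)%N = false by lia.
have -> : (x < a + n)%N = false by lia.
have -> : ((x - n).+1 < b)%N = false by lia.
case: (ltnP x ((b + n).-1 + n')) => h2.
  have -> : ((b + n).-1 < a)%N = false by lia.
  have -> : ((b + n).-1 < a + n)%N = false by lia.
  have -> : ((x - n).+1 < b + n')%N by lia.
  by lia.
have -> : ((x - n').+1 < a)%N = false by lia.
have -> : ((x - n').+1 < a + n)%N = false by lia.
have -> : ((x - n).+1 < b + n')%N = false by lia.
by lia.
Qed.

Lemma collapse_below x : inblock a n x -> collapse b' n' x = x.
Proof.
move: ab; rewrite /inblock /collapse Eb'; clear => ab /andP[h1 h2].
by have -> : (x < (b + n).-1)%N by lia.
Qed.

Lemma collapse_above x : inblock b' n' x ->
  (collapse a n x - b)%N = (x - b')%N /\ inblock b n' (collapse a n x).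
Proof.
move: ab; rewrite /inblock /collapse Eb'; clear => ab /andP[h1 h2].
have -> : (x < a)%N = false by lia.
have -> : (x < a + n)%N = false by lia.
by split; lia.
Qed.

Lemma inner_below (i : int) (g : cubefam P n) w S u p : cubical i g ->
  g (inner_set a (outer_set b' n' w S)) u p = g (inner_set a S) u p.
Proof.
move=> cg; apply: (cubical_ext cg) => y yn _; rewrite /inner_set /outer_set /outer.
move: ab yn; rewrite Eb'; clear => ab yn.
have -> : (a + y == (b + n).-1)%N = false by lia.
by have -> : (a + y < (b + n).-1)%N by lia.
Qed.

Lemma inner_above w S : inner_set b (outer_set a n w S) = inner_set b' S.
Proof.
apply: functional_extensionality_dep => c; rewrite /inner_set /outer_set /outer.
move: ab; rewrite Eb'; clear => ab.
have -> : (b + c == a)%N = false by lia.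
have -> : (b + c < a)%N = false by lia.
by congr S; lia.
Qed.

Lemma ones_below w S u : ones (outer_set b' n' w S) a n u = ones S a n u.
Proof.
apply: eq_in_all => x; rewrite mem_iota /outer_set /outer.
move: ab; rewrite Eb'; clear => ab /andP[h1 h2].
have -> : (x == (b + n).-1) = false by lia.
by have -> : (x < (b + n).-1)%N by lia.
Qed.

Lemma ones_above w S u : all (inblock b' n') u ->
  ones (outer_set a n w S) b n' (map (collapse a n) u) = ones S b' n' u.
Proof.
move=> iu; have E := Eb'; have H x : inblock b n' x -> [/\ (x == a) = false,
    outer a n x = (x + n).-1 & inblock b' n' (x + n).-1].
  rewrite /outer /inblock E; move: ab; clear => ab /andP[h1 h2].
  have -> : (x < a)%N = false by lia.
  by split; lia.
have K x : inblock b' n' x -> [/\ inblock b n' (x - n).+1, ((x - n).+1 + n).-1 = x &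
    collapse a n x = (x - n).+1].
  rewrite /inblock /collapse E; move: ab; clear => ab /andP[h1 h2].
  have -> : (x < a)%N = false by lia.
  have -> : (x < a + n)%N = false by lia.
  by split; lia.
apply/allP/allP => A x; rewrite mem_iota => ix.
  have [k1 k2 k3] := K x ix; have [h1 h2 h3] := H _ k1.
  have := A (x - n).+1; rewrite mem_iota => /(_ k1); rewrite /outer_set h1 h2 k2.
  case/orP => [->//|/mapP[y yu xy]].
  have [_ y2 y3] := K y (allP iu _ yu).
  by rewrite -k2 xy y3 y2 yu orbT.
have [h1 h2 h3] := H _ ix; rewrite /outer_set h1 h2.
have := A (x + n).-1; rewrite mem_iota => /(_ h3) /orP[->//|xu].
apply/orP; right; apply/mapP; exists (x + n).-1 => //.
by have [_ _ ->] := K _ h3; move: ix ab h1; rewrite /inblock; clear; lia.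
Qed.

Variables (i j j' : int) (f : cubefam P m) (g : cubefam P n) (q : cubefam P n').
Hypotheses (cf : cubical i f) (cg : cubical j g) (cq : cubical j' q).

(** The minima over two disjoint blocks do not interact, so that each of the four
    terms of a side corresponds to one term of the other side.  The signs come
    from the exchange of the operations [g] and [q], of their directions [w1] and
    [w2], and of the directions [a] and [b] when both edge terms occur. *)
Lemma cube_compAC :
  cube_comp b' el1' (i + j) j' (cube_comp a el1 i j f g) q =
  (-1) ^+ (`|j| * `|j'|)%N *: cube_comp a' el2' (i + j') j (cube_comp b el2 i j' f q) g.
Proof.
apply: cubefam_ext => S w h; move: w.
have cF := cubical_comp a el1 erefl cf cg.
have cL := cubical_comp b' el1' erefl cF cq.
have cG := cubical_comp b el2 erefl cf cq.
have cR := cubicalZ ((-1) ^+ (`|j| * `|j'|)%N) (cubical_comp a' el2' (addrAC i j j') cG cg).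
apply: (alt_eq3 (p := predU (inblock a n) (inblock b' n')) (q := inblock a n)
  (cubical_alt cL S h) (cubical_alt cR S h)) => w1 w2 w3 _ i1 i2 o2 o3.
have i2' : all (inblock b' n') w2.
  apply/allP => x xw; have /= := allP i2 _ xw; have /= := allP o2 _ xw.
  by case: (inblock a n x).
have o3a : all (predC (inblock a n)) w3.
  by apply: sub_all o3 => x; rewrite /= negb_or => /andP[].
have o3b : all (predC (inblock b' n')) w3.
  by apply: sub_all o3 => x; rewrite /= negb_or => /andP[].
have o1 : all (predC (inblock b' n')) w1.
  apply: sub_all i1 => x; rewrite /= /inblock Eb'; move: ab; clear; lia.
have c1 : map (collapse b' n') w1 = w1.
  by rewrite -[RHS]map_id; apply/eq_in_map => x /(allP i1) /collapse_below ->.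
have o3a' : all (predC (inblock a n)) (map (collapse b' n') w3).
  rewrite all_map; apply/allP => x xw /=; apply/negP => ix.
  have := allP o3a _ xw; have := allP o3b _ xw; move: ix; rewrite /= /inblock /collapse Eb'.
  move: ab; clear => ab; case: (ltnP x (b + n).-1) => h1; first lia.
  by case: (ltnP x ((b + n).-1 + n')); lia.
have o3b' : all (predC (inblock b n')) (map (collapse a n) w3).
  rewrite all_map; apply/allP => x xw /=; apply/negP => ix.
  have := allP o3a _ xw; have := allP o3b _ xw; move: ix; rewrite /= /inblock /collapse Eb'.
  move: ab; clear => ab; case: (ltnP x a) => h1; first lia.
  by case: (ltnP x (a + n)); lia.
have i2'' : all (inblock b n') (map (collapse a n) w2).
  by rewrite all_map; apply: sub_all i2' => x /collapse_above [].
have ob : ~~ inblock a n b' by rewrite /inblock Eb'; move: ab; clear; lia.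
have oa : ~~ inblock b n' a by rewrite /inblock; move: ab; clear; lia.
rewrite (alt_catC _ _ _ (cubical_alt cL S h)).
rewrite cube_comp_sorted //; last by rewrite all_cat o1.
rewrite [RHS](_ : _ = (-1) ^+ (`|j| * `|j'|)%N *:
  cube_comp a' el2' (i + j') j (cube_comp b el2 i j' f q) g S (w1 ++ w2 ++ w3) h) //.
rewrite (@cube_comp_sorted _ _ _ _ _ a') ?Ea' //; last by rewrite all_cat o2.
rewrite /sorted_split_term /sorted_edge_term Ea' !map_cat c1.
have swapL S' p r G : gcomp b' el1' (cube_comp a el1 i j f g S' ((b' : nat)
  :: w1 ++ map (collapse b' n') w3)) G p r h =
  (-1) ^+ size w1 *: gcomp b' el1' (cube_comp a el1 i j f g S' (w1 ++ (b' : nat)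
    :: map (collapse b' n') w3)) G p r h.
  apply: gcompZl; rewrite (alt_front _ _ _ (cubical_alt cF S' p)).
  by rewrite scalerA -exprD -[LHS]scale1r -(expr0 (-1)); congr (_ *: _); parity.
have swapR S' p r G : gcomp a' el2' (cube_comp b el2 i j' f q S' ((a : nat)
  :: map (collapse a n) w2 ++ map (collapse a n) w3)) G p r h =
  (-1) ^+ size w2 *: gcomp a' el2' (cube_comp b el2 i j' f q S' (map (collapse a n)
    w2 ++ (a : nat) :: map (collapse a n) w3)) G p r h.
  apply: gcompZl; rewrite (alt_front _ _ _ (cubical_alt cG S' p)) size_map.
  by rewrite scalerA -exprD -[LHS]scale1r -(expr0 (-1)); congr (_ *: _); parity.
rewrite swapL swapR !gcomp_compl //=; [|by rewrite oa|by rewrite ob].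
rewrite !ones_above // !ones_below !size_map !size_cat.
have C3 : map (collapse a n) (map (collapse b' n') w3) = map (collapse b n')
  (map (collapse a n) w3).
  by rewrite -!map_comp; apply: eq_map => x; rewrite /= collapseAC.
have C2 : map (subn^~ b) (map (collapse a n) w2) = map (subn^~ b') w2.
  by rewrite -map_comp; apply/eq_in_map => x /(allP i2') /collapse_above [].
have Cb : collapse a n b' = b by rewrite Eb collapse_outer // neq_ltn ab orbT.
have Ca : collapse b n' a = a by rewrite /collapse ab.
have O2 w : ones (outer_set a n w S) b n' [::] = ones S b' n' [::].
  exact: (@ones_above w S [::]).
have EAA : gcomp b' el1'
      (sorted_split_term a el1 i j f g
         (outer_set b' n' (ones S b' n' [::] && nilp w2) S) w1 (map (collapse b' n') w3))
      (q (inner_set b' S) (map (subn^~ b') w2))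
      (i + j + (size w1 + size w3)%N) (j' + size w2) h =
    (-1) ^+ (absz (j + (size w1)%:Z)%R * absz (j' + (size w2)%:Z)%R)%N *:
    gcomp a' el2'
      (sorted_split_term b el2 i j' f q
         (outer_set a n (ones S a n [::] && nilp w1) S)
         (map (collapse a n) w2) (map (collapse a n) w3))
      (g (inner_set a S) (map (subn^~ a) w1))
      (i + j' + (size w2 + size w3)%N) (j + size w1) h.
  rewrite (gcompAC _ _ _ (p2 := i + j' + (size w2 + size w3)%N)); first last.
  - by rewrite size_map; clear; lia.
  - by rewrite size_map; clear; lia.
  congr (_ *: _); apply: gcomp_eq => //; last exact: (inner_below _ _ _ _ cg).
  by rewrite /sorted_split_term C3 C2 inner_above outer_setAC ones_below O2 /nilp !size_map.
have EAB : ones S a n w1 && (size w1 == 1%N) -> gcomp b' el1'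
        (sorted_edge_term a el1 i j f g
           (outer_set b' n' (ones S b' n' [::] && nilp w2) S)
           (map (collapse b' n') w3))
        (q (inner_set b' S) (map (subn^~ b') w2))
        (i + j + (size w1 + size w3)%N) (j' + size w2) h =
     (-1) ^+ (`|j| * absz (j' + (size w2)%:Z)%R)%N *:
      gcomp a' el2'
        (sorted_split_term b el2 i j' f q (outer_set a n true S)
           (map (collapse a n) w2)
           ((a : nat) :: map (collapse a n) w3))
        (g (fun=> true) [::]) (i + j' + (size w2 + size w3).+1) j h.
  case/andP => _ /eqP s1.
  rewrite (gcompAC _ _ _ (p2 := i + j' + (size w2 + size w3).+1)); first last.
  - by rewrite size_map; clear; lia.
  - by rewrite size_map s1; clear; lia.
  congr (_ *: _); apply: gcomp_eq => //.
  by rewrite /sorted_split_term /= Ca C3 C2 inner_above outer_setAC O2 /nilp !size_map.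
have EBA : ones S b' n' w2 && (size w2 == 1%N) -> gcomp b' el1'
        (sorted_split_term a el1 i j f g (outer_set b' n' true S) w1
           ((b' : nat) :: map (collapse b' n') w3))
        (q (fun=> true) [::]) (i + j + (size w1 + size w3).+1) j' h =
   (-1) ^+ (absz (j + (size w1)%:Z)%R * `|j'|)%N *:
     gcomp a' el2'
        (sorted_edge_term b el2 i j' f q
           (outer_set a n (ones S a n [::] && nilp w1) S)
           (map (collapse a n) w3))
        (g (inner_set a S) (map (subn^~ a) w1))
        (i + j' + (size w2 + size w3)%N) (j + size w1) h.
  case/andP => _ /eqP s2.
  rewrite (gcompAC _ _ _ (p2 := i + j' + (size w2 + size w3)%N)); first last.
  - by rewrite /= size_map s2; clear; lia.
  - by rewrite /= size_map; clear; lia.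
  congr (_ *: _); apply: gcomp_eq => //; last exact: (inner_below _ _ _ _ cg).
  by rewrite /sorted_edge_term /= Cb C3 outer_setAC ones_below !size_map.
have EBB : gcomp b' el1'
          (sorted_edge_term a el1 i j f g (outer_set b' n' true S)
             ((b' : nat) :: map (collapse b' n') w3))
          (q (fun=> true) [::]) (i + j + (1 + size w3).+1) j' h =
   (-1) ^+ (`|j| * `|j'|).+1 *:
        gcomp a' el2'
          (sorted_edge_term b el2 i j' f q (outer_set a n true S)
             ((a : nat) :: map (collapse a n) w3))
          (g (fun=> true) [::]) (i + j' + (1 + size w3).+1) j h.
  rewrite (gcompAC _ _ _ (p2 := i + j' + (1 + size w3).+1)); first last.
  - by rewrite /= size_map; clear; lia.
  - by rewrite /= size_map; clear; lia.
  rewrite exprS mulN1r scaleNr -scalerN; congr (_ *: _); apply: gcompNl.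
  rewrite /sorted_edge_term /= Ca Cb C3 outer_setAC !size_map; apply: gcompNl.
  by case: (cubical_alt cf (outer_set b n' true (outer_set a n true S)) (i + (size w3).+2)) =>
    /(_ [::]) /= ->.
case: ifP EAB => [e1|_] EAB; case: ifP EBA => [e2|_] EBA.
- rewrite EAA EAB // EBA //; have /andP[_ /eqP s1] := e1; have /andP[_ /eqP s2] := e2.
  rewrite s1 s2 EBB !(scalerDr, scalerA) -!exprD [RHS]addrACA.
  by congr (_ *: _ + _ *: _ + (_ *: _ + _ *: _)); parity.
- rewrite EAA EAB //; have /andP[_ /eqP ->] := e1; rewrite !(addr0, scaler0) !(scalerDr,
  scalerA) -!exprD.
  by congr (_ *: _ + _ *: _); parity.
- rewrite EAA EBA //; have /andP[_ /eqP ->] := e2; rewrite !(addr0, scaler0) !(scalerDr,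
  scalerA) -!exprD.
  by congr (_ *: _ + _ *: _); parity.
by rewrite EAA !(addr0, scaler0) !scalerA -!exprD; congr (_ *: _); parity.
Qed.

End Commutation.

(** * The path operad *)
Section PathOperad.
Variables (k : comPzRingType) (P : operad k).

Section Bilinear.
Variables (m n l : nat) (a : 'I_m) (el : l.+1 = (m + n)%N) (i j : int) (c : k).

Lemma cube_comp_linl (f f' : cubefam P m) (g : cubefam P n) :
  cube_comp a el i j (c *: f + f') g = c *: cube_comp a el i j f g + cube_comp a el i j f' g.
Proof.
apply: cubefam_ext => S u h.
rewrite [RHS](_ : _ = c *: cube_comp a el i j f g S u h + cube_comp a el i j f' g S u h) //.
have E1 : split_term a el i j (c *: f + f') g S u h =
  c *: split_term a el i j f g S u h + split_term a el i j f' g S u h by exact: gcomp_linl.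
have E2 : edge_term a el i j (c *: f + f') g S u h =
  c *: edge_term a el i j f g S u h + edge_term a el i j f' g S u h.
  by rewrite /edge_term; case: ifP => _; [exact: gcomp_linl|rewrite scaler0 addr0].
by rewrite /cube_comp E1 E2 !scalerDr !scalerA addrACA [c * _]mulrC.
Qed.

Lemma cube_comp_linr (f : cubefam P m) (g g' : cubefam P n) :
  cube_comp a el i j f (c *: g + g') = c *: cube_comp a el i j f g + cube_comp a el i j f g'.
Proof.
apply: cubefam_ext => S u h.
rewrite [RHS](_ : _ = c *: cube_comp a el i j f g S u h + cube_comp a el i j f g' S u h) //.
have E1 : split_term a el i j f (c *: g + g') S u h =
  c *: split_term a el i j f g S u h + split_term a el i j f g' S u h by exact: gcomp_linr.
have E2 : edge_term a el i j f (c *: g + g') S u h =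
  c *: edge_term a el i j f g S u h + edge_term a el i j f g' S u h.
  by rewrite /edge_term; case: ifP => _; [exact: gcomp_linr|rewrite scaler0 addr0].
by rewrite /cube_comp E1 E2 !scalerDr !scalerA addrACA [c * _]mulrC.
Qed.

End Bilinear.

Definition path_mod r i := submod (cubical_submodule P r i).

Section D.
Variables (r : nat) (i j : int) (e : i = j + 1).
Definition path_d_fun (x : path_mod r i) : path_mod r j :=
  @Submod _ _ (cubical_submodule P r j) _ (cubical_d e (submodP x)).
Fact path_d_linear : linear path_d_fun.
Proof. by move=> c x y; apply: submod_inj; exact: cube_d_linear. Qed.
HB.instance Definition _ := GRing.isLinear.Build k _ _ _ path_d_fun path_d_linear.
End D.

Section Act.
Variables (r : nat) (i : int) (s : 'S_r).
Definition path_act_fun (x : path_mod r i) : path_mod r i :=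
  @Submod _ _ (cubical_submodule P r i) _ (cubical_act s (submodP x)).
Fact path_act_linear : linear path_act_fun.
Proof. by move=> c x y; apply: submod_inj; exact: cube_act_linear. Qed.
HB.instance Definition _ := GRing.isLinear.Build k _ _ _ path_act_fun path_act_linear.
End Act.

Definition path_dgmod (r : nat) : dgmod k.
Proof.
refine (@DGMod k (fun i => path_mod r i : lmodType k)
  (fun i j e => @path_d_fun r i j e : {linear _ -> _}) _).
by move=> i j l e e' x; apply: submod_inj; exact: (cube_dd (submodP x)).
Defined.

(** The path object [P^I], with [P^I(r)] the tensor product of the normalized
    cochains of [[0,1]^r] with [P(r)]. *)
Definition path_operad : operad k.
Proof.
refine (@Operad k path_dgmod
  (fun r i s => @path_act_fun r i s : {linear _ -> _})
  (@Submod _ _ (cubical_submodule P 1 0) _ (cubical_const (ounit P)))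
  (fun m n l i j h a el ed p q => @Submod _ _ (cubical_submodule P l h) _
     (cubical_comp a el ed (submodP p) (submodP q)))
  _ _ _ _ _ _ _ _ _ _ _ _ _).
- move=> i x; apply: submod_inj; apply: cubefam_ext => S u j.
  exact: ononunitary.
- by move=> r i x; apply: submod_inj; exact: cube_act1.
- by move=> r i s t x; apply: submod_inj; exact: cube_actM.
- by move=> r i j e s x; apply: submod_inj; exact: cube_d_act.
- by move=> *; apply: submod_inj; exact: cube_comp_linl.
- by move=> *; apply: submod_inj; exact: cube_comp_linr.
- move=> j e; apply: submod_inj; rewrite /= -(cube_const_d e) ounit_d.
  by have := cube_const_linear (-1) (0 : P 1%N j) 0; rewrite scaler0 addr0 scaleN1r addNr.
- move=> m n l i j h i' j' h' a el ed edl edr ei ej eh p q; apply: submod_inj.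
  exact: (cube_comp_d a el ei ej (submodP p) (submodP q)).
- move=> m n l i j h a el ed s t rho p q B; apply: submod_inj.
  exact: (cube_comp_act el B (submodP p) (submodP q)).
- by move=> n i el ed q; apply: submod_inj; exact: (cube_comp1l el (submodP q)).
- by move=> m i a el ed p; apply: submod_inj; exact: (cube_comp1r a el (submodP p)).
- move=> m n n' l1 l2 l i j j' h1 h2 h a b ab el1 ed1 el2 ed2 el1' ed1' el2' ed2' p q q' E.
  apply: submod_inj; subst h1 h2.
  exact: (cube_compA el1 el2 el1' el2' E (submodP p) (submodP q) (submodP q')).
- move=> m n n' l1 l2 l i j j' h1 h2 h a b b' a' el1 ed1 el2 ed2 el1' ed1'.
  move=> el2' ed2' p q q' ab Eb Ea; apply: submod_inj; subst h1 h2.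
  exact: (cube_compAC el1 el2 el1' el2' ab Eb Ea (submodP p) (submodP q) (submodP q')).
Defined.

(** ** Constant paths and endpoints *)

Section Const.
Variables (r : nat) (i : int).
Definition path_const_fun (x : P r i) : path_operad r i :=
  @Submod _ _ (cubical_submodule P r i) _ (cubical_const x).
Fact path_const_linear : linear path_const_fun.
Proof. by move=> c x y; apply: submod_inj; exact: cube_const_linear. Qed.
HB.instance Definition _ := GRing.isLinear.Build k _ _ _ path_const_fun path_const_linear.
End Const.

Definition path_const : operad_mor P path_operad.
Proof.
refine (@OperadMor k P path_operad (fun r i => @path_const_fun r i : {linear _ -> _}) _ _ _ _).
- by move=> *; apply: submod_inj; exact: cube_const_d.
- by move=> *; apply: submod_inj; exact: cube_const_act.
- by [].
- by move=> *; apply: submod_inj; exact: cube_const_comp.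
Defined.

Section Endpoint.
Variables (v : bool) (r : nat) (i : int).
Definition endpoint_fun (x : path_operad r i) : P r i := submod_val x (fun=> v) [::] i.
Fact endpoint_linear : linear endpoint_fun.
Proof. by []. Qed.
HB.instance Definition _ := GRing.isLinear.Build k _ _ _ endpoint_fun endpoint_linear.
End Endpoint.

(** Evaluation at [(v, ..., v)] respects composites, because the minimum of a
    non-empty block equal to [v] is [v].  For [v] false, an empty block would be
    an obstruction, but there are no operations of arity zero. *)
Definition endpoint (v : bool) : operad_mor path_operad P.
Proof.
refine (@OperadMor k path_operad P (fun r i => @endpoint_fun v r i : {linear _ -> _}) _ _ _ _).
- move=> r i j e x; subst i.
  by rewrite /= /endpoint_fun /= /cube_d /= expr0 scale1r addr0.
- move=> r i s x; rewrite /= /endpoint_fun /= /cube_act /=.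
  by congr (oact s _).
- by rewrite /= /endpoint_fun /= /cube_const /= singleE.
- move=> m n l i j h a el ed p q; rewrite /= /endpoint_fun /=.
  case: n q el => [|n] q el.
    have -> : submod_val q = 0.
      by apply: cubefam_ext => S u h'; apply: ononunitary.
    rewrite ocomp0r /cube_comp /split_term /edge_term /edge /= ?andbF addr0.
    by rewrite gcomp0r // scaler0.
  rewrite /cube_comp /split_term /edge_term /edge /= ?andbF addr0 muln0 expr0 scale1r.
  have -> : vertex (fun=> v) a n.+1 [::] = v.
    by rewrite /vertex /= andbT /ones /=; case: v => //=; apply/allP.
  have -> : outer_set a n.+1 v (fun=> v) = fun=> v.
    by apply: functional_extensionality_dep => c; rewrite /outer_set if_same.
  by rewrite !addr0 (gcompE _ _ _ _ ed).
Defined.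

Lemma endpoint_const v r i (x : P r i) : endpoint v r i (path_const r i x) = x.
Proof. by rewrite /= /endpoint_fun /= /cube_const /= singleE. Qed.

(** A path from 0 to [x], which need not be a cycle even if [x] is one: the
    endpoints are therefore surjective, with independent values. *)
Definition peak_fun r i (x : P r i) : cubefam P r := fun S u j =>
  if nilp u && all S (iota 0 r) then single x j else 0.

Lemma cubical_peak r i (x : P r i) : cubical i (peak_fun x).
Proof.
split; rewrite /peak_fun.
- move=> S u j h; case: ifP => // /andP[/nilP E _]; apply: single_deg.
  by move: h; rewrite E addr0.
- by move=> S [|y u].
- move=> S S' u j H; case: nilP => //= E.
  have -> // : all S (iota 0 r) = all S' (iota 0 r).
  by apply: eq_in_all => y; rewrite mem_iota => yr; apply: H; rewrite // E.
- by move=> S j; split=> [[|z u] y y' w|[|z u] y w] //=; rewrite oppr0.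
Qed.

Definition peak r i (x : P r i) : path_operad r i :=
  @Submod _ _ (cubical_submodule P r i) _ (cubical_peak x).

Lemma endpoint1_peak r i (x : P r i) : endpoint true r i (peak x) = x.
Proof. by rewrite /= /endpoint_fun /= /peak_fun /= all_predT singleE. Qed.

Lemma endpoint0_peak r i (x : P r i) : endpoint false r i (peak x) = 0.
Proof.
rewrite /= /endpoint_fun /= /peak_fun /=; case: r x => [|r] x //=.
by rewrite singleE; apply: ononunitary.
Qed.

End PathOperad.

Section PathMap.
Variables (k : comPzRingType) (P Q : operad k) (phi : operad_mor P Q).

Definition cube_map r (z : cubefam P r) : cubefam Q r := fun S u j => phi r j (z S u j).

Lemma cubical_map r i (z : cubefam P r) : cubical i z -> cubical i (cube_map z).
Proof.
move=> cz; split; rewrite /cube_map.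
- by move=> S u j h; rewrite (cubical_deg cz) // linear0.
- by move=> S u j h; rewrite (cubical_range cz) // linear0.
- by move=> S S' u j H; rewrite (cubical_ext cz _ H).
- by move=> S j; exact: (alternating_linear (phi r j) (cubical_alt cz _ _)).
Qed.

Section Fun.
Variables (r : nat) (i : int).
Definition map_paths_fun (x : path_operad P r i) : path_operad Q r i :=
  @Submod _ _ (cubical_submodule Q r i) _ (cubical_map (submodP x)).
Fact map_paths_linear : linear map_paths_fun.
Proof.
move=> c x y; apply: submod_inj; apply: cubefam_ext => S u j.
exact: linearP.
Qed.
HB.instance Definition _ := GRing.isLinear.Build k _ _ _ map_paths_fun map_paths_linear.
End Fun.

Lemma gcomp_map m n l (a : 'I_m) (el : l.+1 = (m + n)%N) (F : forall q, P m q)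
    (G : forall q, P n q) p q h :
  phi l h (gcomp a el F G p q h) = gcomp a el (fun p => phi m p (F p)) (fun q => phi n q (G q))
    p q h.
Proof. by rewrite /gcomp; case: eqP => [e|_]; [exact: omor_comp|rewrite linear0]. Qed.

Definition map_paths : operad_mor (path_operad P) (path_operad Q).
Proof.
refine (@OperadMor k _ _ (fun r i => @map_paths_fun r i : {linear _ -> _}) _ _ _ _).
- move=> r i j e x; apply: submod_inj; apply: cubefam_ext => S u h.
  rewrite /= /cube_map /cube_d linearD linearZ /= omor_d; congr (_ + _).
  rewrite (removals_linear _ _ (L := phi r h)); last exact: linearP.
  by apply: removals_eq => *; rewrite /face_diff linearB.
- move=> r i s x; apply: submod_inj; apply: cubefam_ext => S u h.
  exact: omor_act.
- apply: submod_inj; apply: cubefam_ext => S u h.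
  rewrite /= /cube_map /cube_const; case: ifP => _; last by rewrite linear0.
  have [->|h0] := eqVneq h 0; first by rewrite !singleE omor_unit.
  by rewrite !single_deg // linear0.
- move=> m n l i j h a el ed p q; apply: submod_inj; apply: cubefam_ext => S u h'.
  rewrite /= /cube_map /cube_comp linearD linearZ /= /split_term /edge_term gcomp_map.
  by congr (_ + _); case: ifP => _; [exact: gcomp_map|rewrite linear0].
Defined.

End PathMap.

(** * Contraction of paths *)
Section Contraction.
Variables (k : comPzRingType) (P : operad k) (r : nat) (i : int).

(** The cochain homotopy of the contraction of the coordinate [m] to 0. *)
Definition flatten_dir (m : nat) (z : cubefam P r) : cubefam P r := fun S u j =>
  if S m && (m \notin u) then z S (m :: u) j else 0.

Lemma cubical_flatten m (z : cubefam P r) : (m < r)%N -> cubical i z -> cubical (i + 1)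
  (flatten_dir m z).
Proof.
move=> mr cz; split; rewrite /flatten_dir.
- move=> S u j h; case: ifP => // _; apply: (cubical_deg cz).
  by apply: contraNneq h => ->; apply/eqP => /=; lia.
- by move=> S u j h; case: ifP => // _; rewrite (cubical_range cz) //= mr.
- move=> S S' u j H; have [mu|mu] := boolP (m \in u); first by rewrite !andbF.
  rewrite !andbT (H m) //; case: ifP => // _; apply: (cubical_ext cz) => x xr.
  by rewrite inE negb_or => /andP[_]; apply: H.
- move=> S j; split=> [u x y v|u x v].
    have -> : (m \notin u ++ x :: y :: v) = (m \notin u ++ y :: x :: v).
      by rewrite !mem_cat !inE (orbCA (m == x)).
    case: ifP => _; last by rewrite oppr0.
    by case: (cubical_alt cz S j) => /(_ (m :: u)) /= ->.
  by case: ifP => // _; case: (cubical_alt cz S j) => _ /(_ (m :: u)) /= ->.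
Qed.

(** For a cycle, [z] minus the right-hand side is the pullback of [z] along the
    projection of the cube to its face at 0 in the direction [m]. *)
Lemma cube_d_flatten m (z : cubefam P r) S u j : (m < r)%N -> cubical i z -> cube_d z = 0 ->
  cube_d (flatten_dir m z) S u j = if m \in u then z S u j else z S u j - z (upd S m false) u j.
Proof.
move=> mr cz dz; move: u.
have cD := cubical_d erefl (cubical_flatten mr cz).
pose F u := if m \in u then z S u j else z S u j - z (upd S m false) u j.
have aF : alternating F.
  split=> [u x y v|u x v]; rewrite /F.
    have -> : (m \in u ++ x :: y :: v) = (m \in u ++ y :: x :: v).
      by rewrite !mem_cat !inE (orbCA (m == x)).
    have [sz _] := cubical_alt cz S j; have [sz' _] := cubical_alt cz (upd S m false) j.
    by case: ifP => _; rewrite sz // sz' opprB opprK addrC.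
  have [_ sz] := cubical_alt cz S j; have [_ sz'] := cubical_alt cz (upd S m false) j.
  by case: ifP => _; rewrite sz // sz' subr0.
apply: (alt_eq (p := pred1 m) (cubical_alt cD S j) aF) => u v um vm.
have mv : m \notin v by apply/negP => /(allP vm) /=; rewrite eqxx.
case: u um => [_|x [|y u]] /=; last first.
- case/and3P => /eqP -> /eqP -> _; rewrite -!cat_cons.
  by rewrite (alt_not_uniq (cubical_alt cD S j)) ?(alt_not_uniq aF) //= inE eqxx.
- rewrite andbT => /eqP ->; rewrite /F inE eqxx /= /cube_d {1}/flatten_dir inE eqxx andbF.
  rewrite linear0 scaler0 add0r /= [X in _ - X]removals0; last first.
    by move=> u1 x1 u2 _; rewrite /face_diff /flatten_dir !inE eqxx !andbF subrr.
  rewrite subr0 /face_diff /flatten_dir /upd eqxx mv /= subr0; apply: (cubical_ext cz) => x1 _.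
  by rewrite inE negb_or => /andP[/negPf ->].
rewrite /F (negPf mv).
have Dz : cube_d z S (m :: v) j = 0 by rewrite dz.
move: Dz; rewrite /cube_d /= /flatten_dir mv andbT.
have updE b : b = S m -> z (upd S m b) v j = z S v j.
  by move=> ->; apply: (cubical_ext cz) => x _ _; rewrite /upd; case: eqP => // ->.
case Sm: (S m).
  rewrite (@removals_eq _ _ (face_diff _ S j) (fun x t => face_diff z S j x (m :: t))); last first.
    move=> u1 x u2 E; rewrite /face_diff /upd.
    have -> : (m == x) = false by apply: contraNF mv => /eqP ->; rewrite E mem_cat inE eqxx orbT.
    have -> : m \notin u1 ++ u2.
      by apply: contra mv; rewrite E !mem_cat inE => /orP[->|->]; rewrite ?orbT.
    by rewrite Sm.
  rewrite exprS mulN1r scaleNr /face_diff updE //.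
  move=> /eqP; rewrite addrCA addr_eq0 => /eqP ->.
  by rewrite opprD !opprK.
move=> _; rewrite linear0 scaler0 add0r updE // subrr; apply: removals0 => u1 x u2 E.
rewrite /face_diff /upd.
have -> : (m == x) = false by apply: contraNF mv => /eqP ->; rewrite E mem_cat inE eqxx orbT.
by rewrite Sm subrr.
Qed.

(** The coordinates are contracted to 0 one after the other. *)
Lemma path_contraction (z : cubefam P r) : cubical i z -> cube_d z = 0 ->
  exists w : cubefam P r, [/\ cubical (i + 1) w, forall j, w (fun=> false) [::] j = 0 &
    z - cube_d w = cube_const (z (fun=> false) [::] i)].
Proof.
move=> cz dz.
(* After [t] steps, [z] is replaced by its pullback along the projection which
   sends the first [t] coordinates to 0. *)
suff H t : (t <= r)%N -> exists w : cubefam P r, [/\ cubical (i + 1) w,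
    (forall j, w (fun=> false) [::] j = 0) &
    forall S u j, (z - cube_d w) S u j =
      if has (gtn t) u then 0 else z (fun x => if (x < t)%N then false else S x) u j].
  have [w [cw w0 Ew]] := H r (leqnn r); exists w; split=> //.
  apply: cubefam_ext => S u j; rewrite Ew /cube_const.
  case: u => [|x u] /=; last first.
    case: ifP => // /negbT; rewrite negb_or => /andP[xr _].
    by rewrite (cubical_range cz) //= (negPf xr).
  have -> : z (fun x => if (x < r)%N then false else S x) [::] j = z (fun=> false) [::] j.
    by apply: (cubical_ext cz) => x ->.
  have [->|ji] := eqVneq j i; first by rewrite singleE.
  by rewrite single_deg // (cubical_deg cz) // addr0.
elim: t => [_|t IH tr].
  exists 0; split=> //; first exact: (submodule0 (cubical_submodule P r (i + 1))).
  move=> S u j; have -> : cube_d 0 = 0 :> cubefam P r.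
    by have := cube_d_linear (-1) (0 : cubefam P r) 0; rewrite scaler0 addr0 scaleN1r addNr.
  by rewrite subr0; case: hasP => // -[].
have [w [cw w0 Ew]] := IH (ltnW tr).
have cdw := cubical_d erefl cw.
have cz' : cubical i (z - cube_d w).
  by rewrite -scaleN1r; apply: cubicalD => //; apply: cubicalZ.
have dB (x y : cubefam P r) : cube_d (x - y) = cube_d x - cube_d y.
  by rewrite -scaleN1r addrC cube_d_linear scaleN1r addrC.
have dD (x y : cubefam P r) : cube_d (x + y) = cube_d x + cube_d y.
  by rewrite -[x]scale1r cube_d_linear !scale1r.
have dz' : cube_d (z - cube_d w) = 0 by rewrite dB dz (cube_dd cw) subr0.
exists (w + flatten_dir t (z - cube_d w)); split.
- by apply: cubicalD => //; apply: cubical_flatten.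
- by move=> j; rewrite [LHS](_ : _ = w (fun=> false) [::] j + 0) // w0 addr0.
move=> S u j; rewrite dD opprD addrA.
rewrite [LHS](_ : _ = (z - cube_d w) S u j - cube_d (flatten_dir t (z - cube_d w)) S u j) //.
rewrite cube_d_flatten // !Ew.
have [tu|tu] := boolP (t \in u).
  rewrite subrr; case: ifP => // /hasP []; exists t => //=.
rewrite opprB addrCA subrr addr0.
have -> : has (gtn t.+1) u = has (gtn t) u.
  apply: eq_in_has => x xu /=; rewrite ltnS leq_eqVlt; case: eqP => // xt.
  by rewrite -xt xu in tu.
case: ifP => // _; apply: (cubical_ext cz) => x xr xu; rewrite /upd.
by rewrite ltnS [(x <= t)%N]leq_eqVlt; case: (x == t); rewrite ?if_same.
Qed.

End Contraction.

(** * Morphisms, equalizers and connective covers *)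
Section Morphisms.
Variable k : comPzRingType.

Definition omor_compose (A B C : operad k) (f : operad_mor B C) (g : operad_mor A B) :
  operad_mor A C.
Proof.
refine (@OperadMor k A C (fun r i => (f r i \o g r i) : {linear A r i -> C r i}) _ _ _ _).
- by move=> r i j e x; rewrite /= !omor_d.
- by move=> r i s x; rewrite /= !omor_act.
- by rewrite /= !omor_unit.
- by move=> *; rewrite /= !omor_comp.
Defined.

Definition omor_id (A : operad k) : operad_mor A A.
Proof. by refine (@OperadMor k A A (fun r i => idfun : {linear A r i -> A r i}) _ _ _ _). Defined.

Section Prod.
Variables A B C : operad k.

Definition prod_fst : operad_mor (prod_operad A B) A.
Proof. by refine (@OperadMor k (prod_operad A B) A (fun r i =>
  fst : {linear (A r i * B r i)%type -> A r i}) _ _ _ _). Defined.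

Definition prod_snd : operad_mor (prod_operad A B) B.
Proof. by refine (@OperadMor k (prod_operad A B) B (fun r i =>
  snd : {linear (A r i * B r i)%type -> B r i}) _ _ _ _). Defined.

Variables (f : operad_mor C A) (g : operad_mor C B).
Section Fun.
Variables (r : nat) (i : int).
Definition pair_fun (x : C r i) : prod_operad A B r i := (f r i x, g r i x).
Fact pair_linear : linear pair_fun.
Proof. by move=> c x y; rewrite /pair_fun !linearP. Qed.
HB.instance Definition _ := GRing.isLinear.Build k _ _ _ pair_fun pair_linear.
End Fun.

Definition omor_pair : operad_mor C (prod_operad A B).
Proof.
refine (@OperadMor k _ _ (fun r i => @pair_fun r i : {linear _ -> _}) _ _ _ _).
- by move=> *; rewrite /= /pair_fun /= /prod_d_fun /= !omor_d.
- by move=> *; rewrite /= /pair_fun /= /prod_act_fun /= !omor_act.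
- by rewrite /= /pair_fun !omor_unit.
- by move=> *; rewrite /= /pair_fun !omor_comp.
Defined.
End Prod.

Section Sub.
Variables (P : operad k) (K : suboperad P).

Section Incl.
Variables (r : nat) (i : int).
Definition sub_incl_fun (x : sub_operad K r i) : P r i := submod_val x.
Fact sub_incl_linear : linear sub_incl_fun.
Proof. by []. Qed.
HB.instance Definition _ := GRing.isLinear.Build k _ _ _ sub_incl_fun sub_incl_linear.
End Incl.

Definition sub_incl : operad_mor (sub_operad K) P.
Proof. by refine (@OperadMor k _ _ (fun r i => @sub_incl_fun r i : {linear _ -> _})
  _ _ _ _). Defined.

Variables (A : operad k) (f : operad_mor A P) (Kf : forall r i x, K r i (f r i x)).

Section Corestr.
Variables (r : nat) (i : int).
Definition corestrict_fun (x : A r i) : sub_operad K r i := Submod (Kf x).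
Fact corestrict_linear : linear corestrict_fun.
Proof. by move=> c x y; apply: submod_inj; exact: linearP. Qed.
HB.instance Definition _ := GRing.isLinear.Build k _ _ _ corestrict_fun corestrict_linear.
End Corestr.

Definition corestrict : operad_mor A (sub_operad K).
Proof.
refine (@OperadMor k _ _ (fun r i => @corestrict_fun r i : {linear _ -> _}) _ _ _ _).
- by move=> *; apply: submod_inj; exact: omor_d.
- by move=> *; apply: submod_inj; exact: omor_act.
- by apply: submod_inj; exact: omor_unit.
- by move=> *; apply: submod_inj; exact: omor_comp.
Defined.
End Sub.

Definition preimage_mod (A B : operad k) (f : operad_mor A B) (K : suboperad B) r i :
  submodule (A r i).
Proof.
refine (@Submodule k _ (fun x => K r i (f r i x)) _ _).
- by rewrite linear0; exact: submodule0.
- by move=> c x y Kx Ky; rewrite linearP; exact: submodule_lin.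
Defined.

Definition preimage (A B : operad k) (f : operad_mor A B) (K : suboperad B) : suboperad A.
Proof.
refine (@Suboperad k A (preimage_mod f K) _ _ _ _).
- by move=> *; rewrite /= omor_d; exact: suboperad_d.
- by move=> *; rewrite /= omor_act; exact: suboperad_act.
- by rewrite /= omor_unit; exact: suboperad_unit.
- by move=> *; rewrite /= omor_comp; exact: suboperad_comp.
Defined.

Definition equalizer_mod (A B : operad k) (f g : operad_mor A B) r i : submodule (A r i).
Proof.
refine (@Submodule k _ (fun x => f r i x = g r i x) _ _); first by rewrite !linear0.
by move=> c x y Ex Ey; rewrite !linearP Ex Ey.
Defined.

Definition equalizer (A B : operad k) (f g : operad_mor A B) : suboperad A.
Proof.
refine (@Suboperad k A (equalizer_mod f g) _ _ _ _).
- by move=> r i j e x E; rewrite /= !omor_d E.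
- by move=> r i s x E; rewrite /= !omor_act E.
- by rewrite /= !omor_unit.
- by move=> m n l i j h a el ed p q Ep Eq; rewrite /= !omor_comp Ep Eq.
Defined.

Definition connective (P : operad k) (r : nat) (i : int) (x : P r i) : Prop :=
  (i < 0 -> x = 0) /\ (i = 0 -> cycle x).

Definition connective_mod (P : operad k) r i : submodule (P r i).
Proof.
refine (@Submodule k _ (@connective P r i) _ _).
  by split=> // _ j e; rewrite linear0.
move=> c x y [x0 cx] [y0 cy]; split=> [i0|i0 j e].
  by rewrite x0 // y0 // scaler0 addr0.
by rewrite linearP cx // cy // scaler0 addr0.
Defined.

(** This is closed under composition: in total degree 0, either both operations
    are cycles of degree 0 or one of them has negative degree and vanishes. *)
Definition connective_cover (P : operad k) : suboperad P.
Proof.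
refine (@Suboperad k P (connective_mod P) _ _ _ _).
- move=> r i j e x [x0 cx]; split=> [j0|j0 h e']; last exact: dgdd.
  have [i0|i0] := ltP i 0; first by rewrite x0 // linear0.
  by apply: cx; lia.
- move=> r i s x [x0 cx]; split=> [i0|i0 j e]; first by rewrite x0 // linear0.
  by rewrite oact_d cx // linear0.
- by split=> // _ j e; exact: ounit_d.
- move=> m n l i j h a el ed p q [p0 cp] [q0 cq].
  have [i0|i0] := ltP i 0; first by rewrite (p0 i0) ocomp0l; split=> // _ h' e; rewrite linear0.
  have [j0|j0] := ltP j 0; first by rewrite (q0 j0) ocomp0r; split=> // _ h' e; rewrite linear0.
  split=> [h0|h0 h' e]; first by exfalso; lia.
  have ei : i = (i - 1) + 1 by lia.
  have ej : j = (j - 1) + 1 by lia.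
  have e1 : h' = (i - 1) + j by lia.
  have e2 : h' = i + (j - 1) by lia.
  rewrite (ocomp_d a el ed e1 e2 ei ej e) cp; last by lia.
  by rewrite cq; [rewrite ocomp0l ocomp0r scaler0 addr0|lia].
Defined.

End Morphisms.

(** * The path object of pairs of paths *)
Section PathHomotopy.
Variables (k : comPzRingType) (P : operad k).

(** The homotopy fixes the starting point, which makes it possible to use it in
    the suboperads defined below by a condition on this point. *)
Lemma path_homologous_const r i (x : path_operad P r i) : cycle x ->
  exists w : path_operad P r (i + 1), endpoint P false r (i + 1) w = 0 /\
    dgd erefl w = x - path_const P r i (endpoint P false r i x).
Proof.
move=> cx.
have dx : cube_d (submod_val x) = 0.
  have e : i = (i - 1) + 1 by rewrite subrK.
  by have /(congr1 (@submod_val _ _ _)) := cx _ e.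
have [w [cw w0 Ew]] := path_contraction (submodP x) dx.
exists (@Submod _ _ (cubical_submodule P r (i + 1)) w cw); split; first exact: w0.
apply: submod_inj; rewrite /=.
by rewrite [RHS](_ : _ = submod_val x - cube_const (submod_val x (fun=> false) [::] i)) //
  -Ew opprB addrC subrK.
Qed.

Lemma cycle_omor (A B : operad k) (f : operad_mor A B) r i (x : A r i) : cycle x -> cycle (f r i x).
Proof. by move=> cx j e; rewrite -omor_d cx linear0. Qed.

Lemma cycleB (A : operad k) r i (x y : A r i) : cycle x -> cycle y -> cycle (x - y).
Proof. by move=> cx cy j e; rewrite linearB cx cy subrr. Qed.

Lemma boundary_omor (A B : operad k) (f : operad_mor A B) r i (x : A r i) : boundary x ->
  boundary (f r i x).
Proof. by move=> [j [e [y <-]]]; exists j, e, (f r j y); rewrite omor_d. Qed.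

Lemma boundaryD (A : operad k) r i (x y : A r i) : boundary x -> boundary y -> boundary (x + y).
Proof.
move=> [j [e [x' <-]]] [j' [e' [y' <-]]]; subst j; subst j'; exists (i + 1), erefl, (x' + y').
by rewrite linearD.
Qed.

Let E := equalizer (omor_compose (endpoint P false) (prod_fst (path_operad P) (path_operad P)))
                   (omor_compose (endpoint P false) (prod_snd (path_operad P) (path_operad P))).

(** Pairs of paths with a common starting point, that is, paths made of two
    segments. *)
Definition double_path := sub_operad E.

Definition double_const : operad_mor P double_path.
Proof. by apply: (@corestrict _ _ E _ (omor_pair (path_const P) (path_const P))). Defined.

Definition double_ends : operad_mor double_path (prod_operad P P) :=
  omor_pair
    (omor_compose (endpoint P true) (omor_compose (prod_fst _ _) (sub_incl E)))
    (omor_compose (endpoint P true) (omor_compose (prod_snd _ _) (sub_incl E))).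

Lemma double_const_ends r i (x : P r i) : double_ends r i (double_const r i x) = (x, x).
Proof.
rewrite -[LHS]/(endpoint P true r i (path_const P r i x), endpoint P true r i (path_const P r i x)).
by rewrite endpoint_const.
Qed.

Lemma double_ends_fibration : fibration double_ends.
Proof.
move=> r i [y y'].
have Ey : E r i (peak y, peak y').
  by rewrite -[_ (_, _)]/(endpoint P false r i (peak y) = endpoint P false r i (peak y'))
    !endpoint0_peak.
exists (Submod Ey).
rewrite -[LHS]/(endpoint P true r i (peak y), endpoint P true r i (peak y')).
by rewrite !endpoint1_peak.
Qed.

Lemma double_const_weak_equivalence : weak_equivalence double_const.
Proof.
move=> r i; split=> [x y cx cy|z cz].
  move=> /(boundary_omor double_ends); rewrite linearB !double_const_ends.
  by move=> /(boundary_omor (prod_fst P P)).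
pose z1 := (submod_val z).1; pose z2 := (submod_val z).2.
have Ez : endpoint P false r i z1 = endpoint P false r i z2 := submodP z.
have cz1 : cycle z1.
  exact: (@cycle_omor _ _ (omor_compose (prod_fst _ _) (sub_incl E)) _ _ z cz).
have cz2 : cycle z2.
  exact: (@cycle_omor _ _ (omor_compose (prod_snd _ _) (sub_incl E)) _ _ z cz).
have [w1 [w10 d1]] := path_homologous_const cz1.
have [w2 [w20 d2]] := path_homologous_const cz2.
exists (endpoint P false r i z1); split; first exact: cycle_omor.
have Ew : E r (i + 1) (- w1, - w2).
  rewrite -[_ (_, _)]/(endpoint P false r (i + 1) (- w1) = endpoint P false r (i + 1) (- w2)).
  by rewrite !linearN w10 w20.
exists (i + 1), erefl, (Submod Ew); apply: submod_inj.
rewrite [LHS](_ : _ = (dgd erefl (- w1), dgd erefl (- w2))) //.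
rewrite !linearN d1 d2 !opprB -Ez submodB.
rewrite -[submod_val (double_const r i _)]/(path_const P r i _, path_const P r i _).
by case: (submod_val z) @z1 @z2 {Ez cz1 cz2 w10 w20 d1 d2 Ew}.
Qed.

End PathHomotopy.

(** * Lifting to paths from the connective cover *)
Section Lifting.
Variables (k : comPzRingType) (P : operad k).
Hypothesis acyclicP : forall r i (x : P r i), i < 0 -> cycle x -> boundary x.

Let K := preimage (endpoint P false) (connective_cover P).
Definition connective_paths := sub_operad K.
Definition connective_end : operad_mor connective_paths P :=
  omor_compose (endpoint P true) (sub_incl K).

Lemma connective_end_fibration : fibration connective_end.
Proof.
move=> r i y.
have Ky : K r i (peak y).
  rewrite -[_ (peak y)]/(connective (endpoint P false r i (peak y))) endpoint0_peak.
  by split=> // _ j e; rewrite linear0.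
by exists (Submod Ky); exact: endpoint1_peak.
Qed.

(** Up to homology, a path is its starting point, and the connective cover has
    the homology of [P].  For the injectivity, let the end of a cycle [x] be a
    boundary; then so is its start [y], which has to be the boundary of a
    connective element [q].  Every element of positive degree is connective, and
    if [q] has degree at most 0, then [x] has negative degree, so that [y] is zero
    and one takes [q] to be zero. *)
Lemma connective_end_weak_equivalence : weak_equivalence connective_end.
Proof.
move=> r i; split=> [x y cx cy|z cz].
  rewrite /homologous -linearB; have := cycleB cx cy; move: (x - y) => {cx cy y}x cx bx.
  have cx' : cycle (submod_val x) := cycle_omor (sub_incl K) cx.
  have [w [w0 dw]] := path_homologous_const cx'.
  have [x0 cx0] := submodP x.
  set y := endpoint P false r i (submod_val x) in dw x0 cx0.
  have [q [tq dq]] : exists q : P r (i + 1), connective q /\ dgd erefl q = y.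
    have [i0|i0] := ltP i 0.
      exists 0; rewrite linear0 x0 //; split=> //.
      by split=> // _ j e; rewrite linear0.
    have [j [e [q Eq]]] := bx; subst j.
    exists (q - endpoint P true r (i + 1) w); split; first by split; lia.
    rewrite linearB Eq -omor_d dw (linearB (endpoint P true r i)) endpoint_const.
    by rewrite opprB addrCA subrr addr0.
  have Kw : K r (i + 1) (path_const P r (i + 1) q + w).
    rewrite -[_ (_ + _)]/(connective (endpoint P false r (i + 1) (path_const P r (i + 1) q + w))).
    by rewrite linearD w0 addr0 endpoint_const.
  exists (i + 1), erefl, (Submod Kw); apply: submod_inj.
  rewrite [LHS](_ : _ = dgd erefl (path_const P r (i + 1) q + w)) //.
  by rewrite linearD -omor_d dq dw addrC subrK.
have [i0|i0] := ltP i 0.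
  exists 0; split; first by move=> j e; rewrite linear0.
  by rewrite /homologous linear0 sub0r -scaleN1r; have [j [e [y Ey]]] := acyclicP i0 cz;
    exists j, e, (- y); rewrite linearN Ey scaleN1r.
have Kz : K r i (path_const P r i z).
  rewrite -[_ (path_const _ _ _ _)]/(connective (endpoint P false r i (path_const P r i z))).
  by rewrite endpoint_const; split=> //; rewrite ltNge i0.
exists (Submod Kz); split.
  move=> j e; apply: submod_inj.
  by rewrite [LHS](_ : _ = dgd e (path_const P r i z)) // -omor_d cz linear0.
exists (i + 1), erefl, 0; rewrite linear0.
rewrite -[X in _ = X - _]/(endpoint P true r i (path_const P r i z)).
by rewrite endpoint_const subrr.
Qed.

Lemma cofibrant_connective_lift : cofibrant P ->
  exists g : operad_mor P (path_operad P), forall r i (x : P r i),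
    connective (endpoint P false r i (g r i x)) /\ endpoint P true r i (g r i x) = x.
Proof.
move=> [I [u [iI cu]]]; have [v _] := iI connective_paths; have [t tu] := iI P.
have comm r i x : connective_end r i (v r i x) = omor_id P r i (u r i x).
  exact: (etrans (esym (tu (omor_compose connective_end v) r i x))
    (tu (omor_compose (omor_id P) u) r i x)).
have [g [_ gP]] := cu _ _ _ connective_end_fibration connective_end_weak_equivalence _ _ comm.
exists (omor_compose (sub_incl K) g) => r i x; split; last exact: gP.
exact: (submodP (g r i x)).
Qed.

(** The images under [phi0] and [phi1] of a path given by [g] start at the images
    of the same connective operation, hence at the same point. *)
Lemma right_homotopic_of_connective (Q : operad k) (phi0 phi1 : operad_mor P Q) :
  cofibrant P -> (forall r i (x : P r i), connective x -> phi0 r i x = phi1 r i x) ->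
  right_homotopic phi0 phi1.
Proof.
move=> cP E01; have [g gP] := cofibrant_connective_lift cP.
exists (double_path Q), (double_const Q), (double_ends Q); split.
- exact: double_const_weak_equivalence.
- exact: double_ends_fibration.
- exact: double_const_ends.
have KH r i (x : P r i) : equalizer
    (omor_compose (endpoint Q false) (prod_fst (path_operad Q) (path_operad Q)))
    (omor_compose (endpoint Q false) (prod_snd (path_operad Q) (path_operad Q))) r i
    (omor_pair (omor_compose (map_paths phi0) g) (omor_compose (map_paths phi1) g) r i x).
  by have [cx _] := gP r i x; exact: E01.
exists (corestrict KH) => r i x; have [_ gx] := gP r i x.
rewrite -[LHS]/(phi0 r i (endpoint P true r i (g r i x)), phi1 r i (endpoint P true r i (g r i x))).
by rewrite gx.
Qed.

End Lifting.

(** * Vanishing of homology in negative degrees *)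
Section Vanishing.
Variable k : comPzRingType.

Definition negatively_acyclic (P : operad k) : Prop :=
  forall r i (x : P r i), i < 0 -> cycle x -> boundary x.

Lemma weak_equivalence_negatively_acyclic (P Q : operad k) (f : operad_mor P Q) :
  weak_equivalence f -> negatively_acyclic P <-> negatively_acyclic Q.
Proof.
move=> wf; split=> [nP r i z i0 cz|nQ r i x i0 cx].
  have [x [cx fz]] := (wf r i).2 z cz.
  have -> : z = f r i x + -1 *: (f r i x - z) by rewrite scaleN1r opprB addrCA subrr addr0.
  apply: boundaryD; first by apply: boundary_omor; exact: nP.
  by have [j [e [y Ey]]] := fz; exists j, e, (-1 *: y); rewrite linearZ Ey.
have c0 : cycle (0 : P r i) by move=> j e; rewrite linear0.
rewrite -[x]subr0; apply: (wf r i).1 => //; rewrite /homologous linear0 subr0.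
by apply: nQ => //; exact: cycle_omor.
Qed.

Lemma weakly_equivalent_negatively_acyclic (P Q : operad k) :
  weakly_equivalent P Q -> negatively_acyclic P <-> negatively_acyclic Q.
Proof.
elim=> [A B [f wf]|A|A B _ [h1 h2]|A B C _ [h1 h2] _ [h3 h4]]; last by split; auto.
- exact: weak_equivalence_negatively_acyclic wf.
- by [].
- by split.
Qed.

Lemma com_eq0 r i (x : com k r i) : i != 0 -> x = 0.
Proof.
move=> i0; apply/rowP => -[j Hj]; exfalso.
by move: Hj; rewrite (negPf i0) andbF.
Qed.

Lemma En_negatively_acyclic (R : realType) (n : option nat) (P : operad k) :
  En_operad R n P -> negatively_acyclic P.
Proof.
suff H (Q : operad k) : (forall r m (z : Q r (- (m.+1)%:Z)), z = 0) -> weakly_equivalent P Q ->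
    negatively_acyclic P.
  case: n => [n [Q [ch [chQ PQ]]]|PC]; first exact: H (chains_neg chQ) PQ.
  by apply: H PC => r m z; apply: com_eq0; rewrite oppr_eq0.
move=> Q0 /weakly_equivalent_negatively_acyclic [_]; apply=> r i x i0 _.
case: i x i0 => // m; rewrite NegzE => x _.
by exists (- m.+1%:Z + 1), erefl, 0; rewrite linear0 (Q0 _ _ x).
Qed.

End Vanishing.

Local Close Scope ring_scope.

Theorem theorem2 (R : realType) (k : comPzRingType) (n : option nat)
    (P : operad k) (G : operad k) (eps : operad_mor G (com k))
    (h : forall (r : nat) (i : int), P r i -> G r i)
    (phi0 phi1 : operad_mor P (com k)) :
  n <> Some 0 ->
  En_operad R n P -> cofibrant P ->
  canonical_augmentation n eps ->
  homology_iso h ->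
  induces_in_homology h eps phi0 ->
  induces_in_homology h eps phi1 ->
  right_homotopic phi0 phi1.
Proof.
move=> _ nP cP _ _ h0 h1.
apply: (right_homotopic_of_connective (En_negatively_acyclic nP) cP) => r i x [xneg xcyc].
have [i0|i0] := eqVneq i 0%R; last by rewrite (com_eq0 (phi0 r i x) i0) (com_eq0 (phi1 r i x) i0).
have cx := xcyc i0.
have com_homologous (y z : com k r i) : homologous y z -> y = z.
  by move=> [j [e [w /esym /eqP]]]; rewrite subr_eq0 => /eqP.
by rewrite (com_homologous _ _ (h0 _ _ _ cx)) (com_homologous _ _ (h1 _ _ _ cx)).
Qed.
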